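(* Let $p$ be a prime of the form $4k+1$ with $\left(\frac{-11}{p}\right)=1$. Suppose $p=c^2+d^2$ and $4p=x^2+11y^2$ with $c,d,x,y\in\mathbb Z$, $c\equiv 1\pmod 4$, $d=2^rd_0$ with $2\nmid d_0$, $y=2^ty_0$ and $y_0\equiv 1\pmod 4$. Assume that $(c,x+2d)=1$ or $(d_0,x+2c)=1$. (i) If $p\equiv 1\pmod 8$, then $$(-11)^{[p/8]}\equiv\begin{cases}\pm(-1)^{[x/4]}\pmod p&\text{if }2\nmid x\text{ and }x\equiv\pm4c,\pm9c\pmod{11},\\ \pm(-1)^{[x/4]}\frac dc\pmod p&\text{if }2\nmid x\text{ and }x\equiv\pm4d,\pm9d\pmod{11},\\ \mp(-1)^{[x/8]+\frac y8}\pmod p&\text{if }2\mid x\text{ and }x\equiv\pm4c,\pm9c\pmod{11},\\ \mp(-1)^{[x/8]+\frac y8}\frac dc\pmod p&\text{if }2\mid x\text{ and }x\equiv\pm4d,\pm9d\pmod{11}.\end{cases}$$ (ii) If $p\equiv 5\pmod 8$, then $$(-11)^{[p/8]}\equiv\begin{cases}\mp(-1)^{\frac{x^2-1}8}\frac yx\pmod p&\text{if }2\nmid x\text{ and }x\equiv\pm4c,\pm9c\pmod{11},\\ \mp(-1)^{\frac{x^2-1}8}\frac{dy}{cx}\pmod p&\text{if }2\nmid x\text{ and }x\equiv\pm4d,\pm9d\pmod{11},\\ \mp(-1)^{\frac{p-5}8}\frac yx\pmod p&\text{if }2\mid x\text{ and }x\equiv\pm4c,\pm9c\pmod{11},\\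 \mp(-1)^{\frac{p-5}8}\frac{dy}{cx}\pmod p&\text{if }2\mid x\text{ and }x\equiv\pm4d,\pm9d\pmod{11}.\end{cases}$$
   Context: $\left(\frac{\cdot}{p}\right)$ is the Legendre symbol, $[\cdot]$ is the greatest integer function (floor), and $(m,n)$ is the greatest common divisor. $r,t$ are nonnegative integers. Fractions in congruences modulo $p$ have denominators prime to $p$ and are interpreted via inverses modulo $p$. In each line containing $\pm$ or $\mp$, the upper signs are taken together and the lower signs are taken together; e.g. ''$x\equiv\pm4c,\pm9c$'' with upper sign means $x\equiv 4c$ or $x\equiv 9c\pmod{11}$, and with lower sign means $x\equiv -4c$ or $x\equiv -9c\pmod{11}$. *)

(* Defs.v *)
From mathcomp Require Export all_boot all_order all_algebra.

Set Implicit Arguments.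
Unset Strict Implicit.
Unset Printing Implicit Defensive.

Import GRing.Theory Num.Theory.
Local Open Scope ring_scope.

(* The Legendre symbol (a/p). Since 'F_p is built from the least prime divisor
   of p, this is only meaningful for p prime. *)
Definition legendre (a : int) (p : nat) : int :=
  if (a%:~R : 'F_p) == 0 then 0
  else if [exists z : 'F_p, z ^+ 2 == a%:~R] then 1
  else -1.

(* x = +-4u, +-9u (mod 11), where s = 1 selects the upper signs and s = -1 the
   lower ones. *)
Definition mod11_cond (s x u : int) : Prop :=
  (x = s * (4 * u) %[mod 11])%Z \/ (x = s * (9 * u) %[mod 11])%Z.

(* Main.v *)
Require Import Defs.
From mathcomp Require Import all_field.
From mathcomp Require Import ring zify.
Import GRing.Theory Num.Theory.
Local Open Scope ring_scope.

Set Implicit Arguments.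
Unset Strict Implicit.
Unset Printing Implicit Defensive.

(** Since [(x / y) ^ 2 = -11] in F_p, the power [(-11) ^ [p/8]] is
    [(x / y) ^ ((p - 1) / 4)], up to a factor [y / x] when [p = 5 (mod 8)].
    So the quartic character of [x / y] modulo the Gaussian prime [c + d i] is
    wanted, in whose residue field F_p the imaginary unit is [d / c].  Rational
    quartic reciprocity turns it into a quotient of the quartic symbols of
    [c + d i] modulo the rational integers [x] and [y], times explicit factors.

    This quotient is computed with one auxiliary Gaussian integer.  Put
    [(X, Y) = (x, y)] and [W = 2 (d + c i)] when x is odd, and
    [(X, Y) = (x / 2, y / 2)] and [W = d + c i] or [d - c i] when x is even,
    so that [W = U + V i] satisfies [U^2 + V^2 = X^2 + 11 Y^2]; up to a unit and
    a rational factor, [W] is [c + d i] or its conjugate.  For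
    [z = X + W] and [A = X + U] this gives
         [N(z) = 2 X A + 11 Y^2]   and   [z^2 = 2 A W - 11 Y^2].
    The quartic symbol modulo an odd rational integer does not see rational
    factors.  Hence [W] and [z] have the same symbol modulo [X], the symbol of
    [W] modulo [Y] is the square of that of [z], and modulo [A], where [z] is
    [V i], the symbol is that of [i].  On the other hand [2 X A] and [- 11 Y^2]
    are congruent modulo [N(z)], so they have the same quartic character over
    [z]; by reciprocity this relates the symbols of [z] modulo [X], [A], [Y]
    and 11.  What results is that the symbols of [W] modulo [X] and [Y] differ
    by the symbol of [z] modulo 11 and by terms depending only on residues
    modulo powers of 2 ([qsym_diff_odd], [qsym_diff_even]).  The symbol modulo
    11 is determined by the residues of x, c and d ([qsym11_c], [qsym11_d]);
    the other terms are the exponents of -1 in the statement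
    ([odd_exponent_1] and its three companions).

    Reciprocity itself comes from Gauss sums ([jacobi_reciprocity]): the power
    [gauss 1 ^+ q], in a field of characteristic q, is known both from the
    Frobenius map and from [gauss 1 ^+ 4], which is a product of the Jacobi sum
    and its conjugate.  This proves the law for the Jacobi sum of a prime
    [p = 1 (mod 4)], which is a generator of a prime ideal over p and is even in
    its imaginary part.  Dividing a primitive Gaussian integer by Jacobi sums
    until a unit remains extends it to all that have even imaginary part, in the
    form of a periodicity ([recip_sym_periodic]).  The integer [z] above need not
    be primitive, and [gcd_removal] adapts its two identities to its primitive
    part.

    Symbols take values in ['Z_4], the exponent of the imaginary unit, so
    products of symbols appear as sums. *)

(** * Fourth roots of unity and their indices *)

Section QuarticIndex.

Variables (K : fieldType) (i : K).
Hypothesis i2 : i ^+ 2 = -1.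

(** Exponents rather than roots of unity are recorded, because the symbols to be
    compared come from fields of different characteristics. *)
Definition qidx (x : K) : 'Z_4 :=
  if x == 1 then 0 else if x == i then 1 else if x == -1 then 2 else 3.

Lemma i4 : i ^+ 4 = 1.
Proof. by rewrite (exprM i 2 2) i2 sqrrN expr1n. Qed.

Lemma i_neq0 : i != 0.
Proof.
apply/eqP=> i0; have := i2; rewrite i0 expr0n /= => /esym/eqP.
by rewrite oppr_eq0 oner_eq0.
Qed.

Lemma i_expn_mod4 n : i ^+ (n%:R : 'Z_4) = i ^+ n.
Proof. by rewrite val_Zp_nat // (expr_mod _ i4). Qed.

Lemma i_expD (m n : 'Z_4) : i ^+ (m + n)%R = i ^+ m * i ^+ n.
Proof. by rewrite -exprD -(i_expn_mod4 (m + n)%N) natrD !natr_Zp. Qed.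

Lemma i_expN (n : 'Z_4) : i ^+ (- n)%R = (i ^+ n)^-1.
Proof.
have nz : i ^+ n != 0 by rewrite expf_neq0 // i_neq0.
by apply: (mulIf nz); rewrite -i_expD addNr mulVf.
Qed.

Lemma i_expMn (n : 'Z_4) k : i ^+ (n *+ k)%R = (i ^+ n) ^+ k.
Proof.
elim: k => [|k IHk]; first by rewrite mulr0n expr0.
by rewrite mulrS i_expD IHk exprS.
Qed.

Lemma Z4_cases (n : 'Z_4) : [\/ n = 0, n = 1, n = 2 | n = 3].
Proof.
case: n => [[|[|[|[|n]]]] hn] //.
- by constructor 1; apply: val_inj.
- by constructor 2; apply: val_inj.
- by constructor 3; apply: val_inj.
- by constructor 4; apply: val_inj.
Qed.

Hypothesis two_neq0 : (2 : K) != 0.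

Lemma i_exp_Z4 :
  [/\ i ^+ (1%R : 'Z_4) = i, i ^+ (2%R : 'Z_4) = -1 & i ^+ (3%R : 'Z_4) = - i].
Proof.
have e3 : i ^+ 3 = - i by rewrite exprSr i2 mulN1r.
by split; [exact: expr1 | exact: i2 | exact: e3].
Qed.

Lemma i_exp_eq1 (n : 'Z_4) : i ^+ n = 1 -> n = 0.
Proof.
have m11 : (-1 : K) != 1 by rewrite eq_sym -subr_eq0 opprK.
have [e1 e2 e3] := i_exp_Z4.
case: (Z4_cases n) => ->; rewrite ?(e1, e2, e3) // => h; exfalso.
- by move: m11; rewrite -i2 h expr1n eqxx.
- by rewrite h eqxx in m11.
- by move: m11; rewrite -i2 -sqrrN h expr1n eqxx.
Qed.

Lemma i_exp_inj : injective (fun n : 'Z_4 => i ^+ n).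
Proof.
move=> m n h; apply/eqP; rewrite -subr_eq0; apply/eqP/i_exp_eq1.
by rewrite i_expD i_expN h mulfV // expf_neq0 // i_neq0.
Qed.

Lemma qidxK x : x ^+ 4 = 1 -> i ^+ (qidx x) = x.
Proof.
have [e1 e2 e3] := i_exp_Z4.
move=> x4; rewrite /qidx; case: eqP => [-> //|/eqP x1].
case: eqP => [->|/eqP xi]; first by rewrite e1.
case: eqP => [->|/eqP xm1]; rewrite ?e2 ?e3 //.
have : (x - 1) * (x - i) * (x + 1) * (x + i) = 0.
  have -> : (x - 1) * (x - i) * (x + 1) * (x + i)
    = (x ^+ 2 - 1) * (x ^+ 2 - i ^+ 2) by ring.
  by rewrite i2 opprK -subr_sqr_1 -exprM x4 subrr.
move/eqP; rewrite !mulf_eq0 !subr_eq0 !addr_eq0.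
by rewrite (negPf x1) (negPf xi) (negPf xm1) => /eqP ->.
Qed.

Lemma qidx_exp (n : 'Z_4) : qidx (i ^+ n) = n.
Proof. by apply: i_exp_inj; rewrite qidxK // exprAC i4 expr1n. Qed.

End QuarticIndex.

(** * Gaussian integers as pairs *)

Definition gmul (z w : int * int) : int * int :=
  (z.1 * w.1 - z.2 * w.2, z.1 * w.2 + z.2 * w.1).
Definition gconj (z : int * int) : int * int := (z.1, - z.2).
Definition gnorm (z : int * int) : int := z.1 ^+ 2 + z.2 ^+ 2.
(** A prime ideal of the Gaussian integers is represented by a field with a
    square root [i] of -1; it contains [z] when [gev i z] is 0. *)
Definition gev (K : fieldType) (i : K) (z : int * int) : K :=
  z.1%:~R + z.2%:~R * i.

Section Evaluation.

Variables (K : fieldType) (i : K).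
Hypothesis i2 : i ^+ 2 = -1.

Lemma gevM z w : gev i (gmul z w) = gev i z * gev i w.
Proof.
rewrite /gev /gmul /= !(rmorphD, rmorphN, rmorphM) /=.
have -> : z.2%:~R * w.2%:~R = - (z.2%:~R * w.2%:~R * i ^+ 2) :> K.
  by rewrite i2; ring.
by ring.
Qed.

Lemma gev_conj z : gev i (gconj z) = gev (- i) z.
Proof. by rewrite /gev /= rmorphN /=; ring. Qed.

Lemma gev_norm z : gev i z * gev (- i) z = (gnorm z)%:~R.
Proof.
rewrite /gev /gnorm rmorphD !rmorphXn /=.
have -> : z.2%:~R ^+ 2 = - (z.2%:~R ^+ 2 * i ^+ 2) :> K by rewrite i2; ring.
by ring.
Qed.

End Evaluation.

Definition re4 (n : 'Z_4) : int := if n == 0 then 1 else if n == 2 then -1 else 0.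
Definition im4 (n : 'Z_4) : int := if n == 1 then 1 else if n == 3 then -1 else 0.

Lemma gev_pow4 (K : fieldType) (i : K) (i2 : i ^+ 2 = -1) (n : 'Z_4) :
  gev i (re4 n, im4 n) = i ^+ n.
Proof.
have [e1 e2 e3] := i_exp_Z4 i2.
case: (Z4_cases n) => ->; rewrite ?e1 ?e2 ?e3 /gev /re4 /im4 /=; ring.
Qed.

Lemma gev_pow4N (K : fieldType) (i : K) (i2 : i ^+ 2 = -1) (n : 'Z_4) :
  gev (- i) (re4 n, im4 n) = i ^+ (3%:R * n)%R.
Proof.
have [e1 e2 e3] := i_exp_Z4 i2.
have h k : gev (- i) (re4 k, im4 k) = (- i) ^+ k by apply: gev_pow4; rewrite sqrrN.
rewrite h; case: (Z4_cases n) => ->.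
- by rewrite mulr0.
- by rewrite mulr1 e3; exact: expr1.
- have -> : 3%:R * 2%:R = 2 :> 'Z_4 by apply: val_inj.
  by rewrite e2 -[LHS]/((- i) ^+ 2) sqrrN.
- have -> : 3%:R * 3%:R = 1 :> 'Z_4 by apply: val_inj.
  by rewrite e1 -[LHS]/((- i) ^+ 3) exprS sqrrN i2 mulrN1 opprK.
Qed.

(** * Quartic Gauss and Jacobi sums *)

(** As integer coordinates, these are independent of the field in which the
    sum is evaluated: they serve in characteristic 0 for the norm, in
    characteristic q for reciprocity and in F_p itself for the ideal. *)
Definition jacobi (p : nat) (ind : 'F_p -> 'Z_4) : int * int :=
  (\sum_(a : 'F_p | (a != 0) && (a != 1)) re4 (ind a + ind (1 - a)),
   \sum_(a : 'F_p | (a != 0) && (a != 1)) im4 (ind a + ind (1 - a))).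

Section GaussSums.

Variables (p : nat) (K : fieldType) (i zeta : K) (ind : 'F_p -> 'Z_4) (g : 'F_p).
Hypothesis p_pr : prime p.
Hypothesis i2 : i ^+ 2 = -1.
Hypothesis two_neq0 : (2 : K) != 0.
Hypothesis zeta_p : zeta ^+ p = 1.
Hypothesis zeta_neq1 : zeta != 1.
Hypothesis indM : forall a b, a != 0 -> b != 0 -> ind (a * b) = ind a + ind b.
Hypothesis g_neq0 : g != 0.
Hypothesis ind_g : ind g *+ 2 != 0.

Definition chi (n : 'Z_4) (a : 'F_p) : K := if a == 0 then 0 else i ^+ (n * ind a)%R.
Definition zpow (a : 'F_p) : K := zeta ^+ a.
Definition gauss n := \sum_a chi n a * zpow a.
Definition jac_sum m n := \sum_a chi m a * chi n (1 - a).

Lemma zpowD a b : zpow (a + b) = zpow a * zpow b.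
Proof.
rewrite /zpow -exprD /=; move: (nat_of_ord a) (nat_of_ord b) => m n.
by rewrite Fp_cast // expr_mod.
Qed.

Lemma zpow_nat (n : nat) : zpow n%:R = zeta ^+ n.
Proof. by rewrite /zpow val_Fp_nat // expr_mod. Qed.

Lemma zpow1 : zpow 1 = zeta.
Proof. by rewrite -[1]/(1%:R) zpow_nat expr1. Qed.

Lemma zpow0 : zpow 0 = 1.
Proof. by []. Qed.

(** The sum is invariant under multiplication by [zeta]. *)
Lemma zpow_sum b : b != 0 -> \sum_a zpow (a * b) = 0.
Proof.
move=> b0; set S := \sum_a _.
have zb : S = \sum_a zpow a.
  by rewrite [RHS](reindex_inj (mulIf b0)).
have: zeta * S = S.
  rewrite zb {2}(reindex_inj (addIr 1)) /= mulr_sumr; apply: eq_bigr => a _.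
  by rewrite zpowD zpow1 mulrC.
move/eqP; rewrite -subr_eq0 -{2}[S]mul1r -mulrBl mulf_eq0 subr_eq0.
by rewrite (negPf zeta_neq1) => /eqP.
Qed.

Lemma chi0 n : chi n 0 = 0. Proof. by rewrite /chi eqxx. Qed.

Lemma chiE n a : a != 0 -> chi n a = i ^+ (n * ind a)%R.
Proof. by rewrite /chi => /negPf ->. Qed.

Lemma chiM n a b : chi n (a * b) = chi n a * chi n b.
Proof.
have [->|a0] := eqVneq a 0; first by rewrite mul0r chi0 mul0r.
have [->|b0] := eqVneq b 0; first by rewrite mulr0 chi0 mulr0.
by rewrite !chiE ?mulf_neq0 // indM // mulrDr i_expD.
Qed.

Lemma chiD m n a : chi (m + n) a = chi m a * chi n a.
Proof.
by rewrite /chi; case: eqP => _; rewrite ?mulr0 // mulrDl i_expD.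
Qed.

Lemma chi_nontrivial n : n != 0 -> exists2 a, a != 0 & chi n a != 1.
Proof.
move=> n0; exists g => //; rewrite /chi (negPf g_neq0); apply/eqP => h.
have {}h := i_exp_eq1 i2 two_neq0 h.
move: n0 ind_g h; case: (Z4_cases n) => ->; case: (Z4_cases (ind g)) => -> //.
Qed.

(** The sum is invariant under multiplication by a nontrivial value of the character. *)
Lemma chi_sum n : n != 0 -> \sum_a chi n a = 0.
Proof.
move=> /chi_nontrivial [b b0 nb]; set S := \sum_a _.
have: chi n b * S = S.
  rewrite {2}/S (reindex_inj (mulfI b0)) /= mulr_sumr.
  by apply: eq_bigr => a _; rewrite chiM.
move/eqP; rewrite -subr_eq0 -{2}[S]mul1r -mulrBl mulf_eq0 subr_eq0.
by rewrite (negPf nb) => /eqP.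
Qed.

Lemma gauss_twist n b : b != 0 ->
  chi n b * (\sum_a chi n a * zpow (a * b)) = gauss n.
Proof.
move=> b0; rewrite /gauss [RHS](reindex_inj (mulIf b0)) /= mulr_sumr.
by apply: eq_bigr => a _; rewrite chiM; ring.
Qed.

(** Collect the terms with [a + b = s]: for [s = 0] they cancel because the
    product character is nontrivial, and for the others [s] can be scaled out. *)
Lemma gaussM m n : m + n != 0 -> gauss m * gauss n = jac_sum m n * gauss (m + n).
Proof.
move=> mn0; rewrite /gauss mulr_suml.
transitivity (\sum_a \sum_s chi m a * chi n (s - a) * zpow s).
  apply: eq_bigr => a _; rewrite mulr_sumr [RHS](reindex_inj (addIr a)) /=.
  by apply: eq_bigr => b _; rewrite addrK zpowD; ring.
rewrite exchange_big mulr_sumr /=; apply: eq_bigr => s _.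
rewrite -mulr_suml mulrA; congr (_ * _).
have [->|s0] := eqVneq s 0.
  rewrite chi0 mulr0.
  transitivity (chi n (-1) * \sum_a chi (m + n) a); last by rewrite chi_sum ?mulr0.
  rewrite mulr_sumr; apply: eq_bigr => a _; rewrite chiD sub0r -[- a]mulN1r chiM; ring.
rewrite (reindex_inj (mulfI s0)) /= /jac_sum mulr_suml; apply: eq_bigr => a _.
by rewrite -{2}[s]mulr1 -mulrBr !chiM chiD; ring.
Qed.

(** Absorbing the second character into the first sum by [gauss_twist], only the
    term [a = -1] survives the summation over [b]. *)
Lemma gauss_opp n : n != 0 -> gauss n * gauss (- n) = chi n (-1) * p%:R.
Proof.
move=> n0.
transitivity (\sum_b \sum_a chi n a * zpow (a * b) * zpow b).
  rewrite /gauss mulrC mulr_suml; apply: eq_bigr => b _.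
  have [->|b0] := eqVneq b 0.
    rewrite chi0 !mul0r; under eq_bigr do rewrite mulr0 zpow0 !mulr1.
    by rewrite chi_sum.
  rewrite -[X in _ * X]/(gauss n) -(gauss_twist n b0) -!mulr_suml.
  have e : chi (- n) b * chi n b = 1 by rewrite -chiD addNr /chi (negPf b0) mul0r.
  by transitivity ((chi (- n) b * chi n b) * (\sum_a chi n a * zpow (a * b)) * zpow b);
     [ring | rewrite e mul1r].
rewrite exchange_big /= (bigD1 (-1)) //= [X in _ + X]big1 ?addr0 => [|a a1].
  under eq_bigr do rewrite -mulrA -zpowD mulN1r addNr zpow0 mulr1.
  by rewrite sumr_const card_Fp // mulr_natr.
under eq_bigr => b _ do rewrite -mulrA -zpowD -{2}[b]mul1r -mulrDl mulrC.
rewrite -mulr_suml; under eq_bigr => b _ do rewrite mulrC.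
by rewrite zpow_sum ?mul0r // addr_eq0.
Qed.

Lemma ind_1 : ind 1 = 0.
Proof. by apply: (addrI (ind 1)); rewrite addr0 -indM ?oner_neq0 // mulr1. Qed.

Lemma chi2N1 : chi 2 (-1) = 1.
Proof.
rewrite /chi oppr_eq0 oner_eq0 mulr_natl mulr2n -indM ?oppr_eq0 ?oner_eq0 //.
by rewrite mulrNN mulr1 ind_1.
Qed.

(** The character of index 2 is its own inverse, and it is trivial at -1 since
    [ind (-1)] has order at most 2. *)
Lemma gauss2_sq : gauss 2 ^+ 2 = p%:R.
Proof.
have e : - 2 = 2 :> 'Z_4 by apply: val_inj.
by rewrite expr2 -{2}e gauss_opp // chi2N1 mul1r.
Qed.

Lemma gev_jacobi : gev i (jacobi ind) = jac_sum 1 1.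
Proof.
rewrite /jac_sum /gev /= !rmorph_sum /= mulr_suml -big_split /= big_mkcond /=.
apply: eq_bigr => a _; have [->|a0] := eqVneq a 0; first by rewrite chi0 mul0r.
have [->|a1] := eqVneq a 1; first by rewrite subrr chi0 mulr0.
rewrite (chiE _ a0) chiE ?subr_eq0 1?eq_sym // -i_expD // !mul1r.
exact: gev_pow4.
Qed.

Lemma gev_jacobi_conj : gev (- i) (jacobi ind) = jac_sum 3 3.
Proof.
rewrite /jac_sum /gev /= !rmorph_sum /= mulr_suml -big_split /= big_mkcond /=.
apply: eq_bigr => a _; have [->|a0] := eqVneq a 0; first by rewrite chi0 mul0r.
have [->|a1] := eqVneq a 1; first by rewrite subrr chi0 mulr0.
rewrite (chiE _ a0) chiE ?subr_eq0 1?eq_sym // -i_expD // -mulrDr.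
exact: gev_pow4N.
Qed.

Hypothesis p_neq0 : (p%:R : K) != 0.

(** Both [(gauss 1 * gauss 3) ^+ 2] and [gauss 1 ^+ 2 * gauss 3 ^+ 2] are known,
    the latter in terms of the two conjugate Jacobi sums. *)
Lemma jacobi_norm_in : (gnorm (jacobi ind))%:~R = p%:R :> K.
Proof.
have h1 : gauss 1 ^+ 2 = jac_sum 1 1 * gauss 2 by rewrite expr2 gaussM.
have e6 : 3 + 3 = 2 :> 'Z_4 by apply: val_inj.
have h3 : gauss 3 ^+ 2 = jac_sum 3 3 * gauss 2 by rewrite expr2 gaussM e6.
have e13 : - 1 = 3 :> 'Z_4 by apply: val_inj.
have hp : gauss 1 * gauss 3 = chi 1 (-1) * p%:R by rewrite -e13 gauss_opp.
have c2 : chi 1 (-1) ^+ 2 = 1 by rewrite expr2 -chiD chi2N1.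
have: p%:R ^+ 2 = (jac_sum 1 1 * jac_sum 3 3) * p%:R.
  have -> : p%:R ^+ 2 = (gauss 1 * gauss 3) ^+ 2 by rewrite hp exprMn c2 mul1r.
  by rewrite exprMn h1 h3 -gauss2_sq; ring.
by rewrite expr2 => /(mulIf p_neq0) ->; rewrite -(gev_norm i2) gev_jacobi gev_jacobi_conj.
Qed.

Lemma gauss1_exp4 : gauss 1 ^+ 4 = gev i (jacobi ind) ^+ 3 * gev (- i) (jacobi ind).
Proof.
have h1 : gauss 1 ^+ 2 = jac_sum 1 1 * gauss 2 by rewrite expr2 gaussM.
rewrite (exprM _ 2 2) h1 exprMn gauss2_sq -jacobi_norm_in -(gev_norm i2) gev_jacobi.
by rewrite mulrA -exprSr.
Qed.

Lemma gauss1_mul_gauss3 : gauss 1 * gauss 3 = i ^+ ind (-1) * p%:R.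
Proof.
have e13 : - 1 = 3 :> 'Z_4 by apply: val_inj.
by rewrite -e13 gauss_opp // /chi oppr_eq0 oner_eq0 mul1r.
Qed.

Section Frobenius.

Variable q : nat.
Hypothesis q_pr : prime q.
Hypothesis q_char : q \in [pchar K].
Hypothesis qp : (q%:R : 'F_p) != 0.

(** The Frobenius map multiplies the index of the character by [q] and the
    additive variable by [q]; undoing the latter produces the value at [q]. *)
Lemma gauss_frobenius n : gauss n ^+ q = i ^+ (- (n *+ q * ind q%:R))%R * gauss (n *+ q).
Proof.
rewrite -(gauss_twist (n *+ q) qp) mulrA {1}/chi (negPf qp) -i_expD // addNr expr0 mul1r.
rewrite -[LHS]/(pFrobenius_aut q_char _) rmorph_sum; apply: eq_bigr => a _.
rewrite rmorphM /= !pFrobenius_autE; congr (_ * _).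
  rewrite /chi; case: eqP => _; first by rewrite expr0n; case: (q) q_pr => [|[]].
  by rewrite -i_expMn // mulrnAl.
rewrite mulr_natr; elim: q => [|k IHk]; first by rewrite mulr0n.
by rewrite exprS IHk mulrS zpowD.
Qed.

End Frobenius.

End GaussSums.

Lemma Z4_int_eq0 (n : int) : (n%:~R == 0 :> 'Z_4) = (4 %| n)%Z.
Proof.
rewrite {1}(divz_eq n 4) rmorphD rmorphM /= (_ : 4%:~R = 0 :> 'Z_4) ?mulr0; last first.
  by apply: val_inj.
rewrite add0r; have := @ltz_pmod n 4 isT; have := @modz_ge0 n 4 isT.
rewrite [RHS](sameP dvdz_mod0P eqP).
by case: (n %% 4)%Z => [[|[|[|[|k]]]]|k].
Qed.

Lemma Z4_int_eq (m n : int) : (4 %| m - n)%Z -> m%:~R = n%:~R :> 'Z_4.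
Proof. by rewrite -Z4_int_eq0 rmorphB subr_eq0 => /eqP. Qed.

(** * The symbol of a Gaussian integer modulo a rational prime *)

(** A root of [1 + X + ... + X ^ (p - 1)] cannot be 1, where this polynomial
    takes the value [p]. *)
Lemma exists_pth_root (K : closedFieldType) (p : nat) :
  (p%:R : K) != 0 -> (1 < p)%N -> exists2 z : K, z ^+ p = 1 & z != 1.
Proof.
move=> p0 p1; have [|z] := @closed_rootP K (\poly_(j < p) 1) _.
  by rewrite size_poly_eq ?oner_neq0 // gtn_eqF.
rewrite /root horner_poly; under eq_bigr do rewrite mul1r.
move=> /eqP hz; exists z.
  by apply/eqP; rewrite -subr_eq0 subrX1 hz mulr0.
apply: contraNneq p0 => z1; rewrite -hz z1.
by under eq_bigr do rewrite expr1n; rewrite sumr_const card_ord.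
Qed.

(** One field of characteristic q containing a square root of -1 and, for every
    prime p other than q, the p-th roots of unity needed for Gauss sums. *)
Definition q_closure (q : nat) : countClosedFieldType :=
  projT1 (countable_algebraic_closure 'F_q).

Lemma q_closure_char q : prime q -> q \in [pchar (q_closure q)].
Proof.
rewrite /q_closure; case: (countable_algebraic_closure _) => K [f _] q_pr /=.
by rewrite (fmorph_pchar f) pchar_Fp.
Qed.

Definition sqrtm1 (q : nat) : q_closure q := sval (GRing.imaginary_exists (q_closure q)).

Lemma sqrtm1_sq q : sqrtm1 q ^+ 2 = -1.
Proof. by rewrite /sqrtm1; case: (GRing.imaginary_exists _). Qed.

Lemma q_closure_int q (n : int) : prime q -> ((n%:~R : q_closure q) == 0) = (q %| n)%Z.
Proof. by move=> /q_closure_char /dvdz_pcharf ->. Qed.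

Lemma q_closure_two q : prime q -> odd q -> (2 : q_closure q) != 0.
Proof.
move=> q_pr q_odd; rewrite -(dvdn_pcharf (q_closure_char q_pr)).
by rewrite dvdn_prime2 //; case: eqP q_odd => // ->.
Qed.

Definition conj_ratio q (z : int * int) : q_closure q :=
  gev (sqrtm1 q) z / gev (- sqrtm1 q) z.

(** The quartic residue of z modulo q is the product of [z ^ ((q - 1) / 4)] over
    the two prime factors of q when [q = 1 (mod 4)], and [z ^ ((q^2 - 1) / 4)]
    when [q = 3 (mod 4)], in which case [z ^ (q - 1)] is the quotient of the
    conjugate of z by z.  Both are the power of [z / conj z] of exponent
    [(q* - 1) / 4], where q* is the one of q and -q congruent to 1 modulo 4. *)
Definition psym_power q z : q_closure q :=
  if (q %% 4 == 1)%N then conj_ratio q z ^+ (q %/ 4) else (conj_ratio q z)^-1 ^+ (q %/ 4).+1.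

(** For odd m, the residue of [(m* - 1) / 4], where m* is the one of m and -m congruent to
    1 modulo 4. *)
Definition star4 (m : nat) : 'Z_4 :=
  if (m %% 4 == 1)%N then (m %/ 4)%:R else - (m %/ 4).+1%:R.

Definition psym q z : 'Z_4 := qidx (sqrtm1 q) (psym_power q z).

Section PrimeSymbol.

Variable q : nat.
Hypothesis q_pr : prime q.
Hypothesis q_odd : odd q.

Local Notation K := (q_closure q).
Local Notation i := (sqrtm1 q).
Let i2 : i ^+ 2 = -1 := sqrtm1_sq q.
Let two0 : (2 : K) != 0 := q_closure_two q_pr q_odd.
Let Ni2 : (- i) ^+ 2 = -1. Proof. by rewrite sqrrN. Qed.

Definition qunit (z : int * int) := ~~ (q %| gnorm z)%Z.

Lemma qunitP z : qunit z -> gev i z != 0 /\ gev (- i) z != 0.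
Proof.
rewrite /qunit -q_closure_int // -(gev_norm i2) mulf_eq0 negb_or.
by case/andP.
Qed.

Lemma frob_gev z : gev i z ^+ q = if (q %% 4 == 1)%N then gev i z else gev (- i) z.
Proof.
have qc := q_closure_char q_pr.
rewrite -[LHS]/(pFrobenius_aut qc _) /gev rmorphD rmorphM /= !rmorph_int.
rewrite pFrobenius_autE -(expr_mod q (i4 i2)).
have : odd (q %% 4) by rewrite odd_mod.
have: (q %% 4 < 4)%N by rewrite ltn_pmod.
case: (q %% 4)%N => [|[|[|[|?]]]] // _ _.
by rewrite exprSr i2 mulN1r.
Qed.

Lemma frob_gevN z : gev (- i) z ^+ q = if (q %% 4 == 1)%N then gev (- i) z else gev i z.
Proof.
rewrite -gev_conj // frob_gev !gev_conj //; case: ifP => // _.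
by rewrite opprK.
Qed.

Lemma psym_power4 z : qunit z -> psym_power q z ^+ 4 = 1.
Proof.
move=> /qunitP[z1 z2].
have e : q = (q %/ 4 * 4 + q %% 4)%N := divn_eq q 4.
have f1 := frob_gev z; have f2 := frob_gevN z.
rewrite /psym_power; case: ifP f1 f2 => [/eqP q1|q3] f1 f2.
  rewrite -exprM /conj_ratio expr_div_n.
  have cyc (x : K) : x != 0 -> x ^+ q = x -> x ^+ (q %/ 4 * 4) = 1.
    move=> x0; have -> : x ^+ q = x ^+ (q %/ 4 * 4).+1.
      by congr (x ^+ _); rewrite {1}e q1 addn1.
    by rewrite exprSr => h; apply: (mulIf x0); rewrite mul1r.
  by rewrite !cyc // invr1 mulr1.
have q3' : (q %% 4 = 3)%N.
  have : odd (q %% 4) by rewrite odd_mod.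
  have: (q %% 4 < 4)%N by rewrite ltn_pmod.
  by case: (q %% 4)%N q3 => [|[|[|[|?]]]].
have -> : (conj_ratio q z)^-1 ^+ (q %/ 4).+1 ^+ 4 = ((conj_ratio q z) ^+ q.+1)^-1.
  by rewrite -exprM exprVn; congr (_ ^+ _)^-1; lia.
by rewrite exprS /conj_ratio expr_div_n f1 f2 mulrC mulrA divfK // divff ?invr1.
Qed.

Lemma psym_exp z : qunit z -> i ^+ psym q z = psym_power q z.
Proof. by move=> /psym_power4 h; rewrite /psym qidxK. Qed.

Lemma qunitM z w : qunit z -> qunit w -> qunit (gmul z w).
Proof.
rewrite /qunit -!q_closure_int // -!(gev_norm i2) !gevM //.
rewrite !mulf_eq0 !negb_or => /andP[-> ->] /andP[-> ->] //.
Qed.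

Lemma psymM z w : qunit z -> qunit w -> psym q (gmul z w) = psym q z + psym q w.
Proof.
move=> hz hw; apply: (i_exp_inj i2 two0).
rewrite i_expD // !psym_exp ?qunitM // /psym_power.
have -> : conj_ratio q (gmul z w) = conj_ratio q z * conj_ratio q w.
  by rewrite /conj_ratio !gevM // invfM; ring.
by case: ifP => _; rewrite ?invfM exprMn.
Qed.

Lemma psym_congr z w : (z.1 = w.1 %[mod q])%Z -> (z.2 = w.2 %[mod q])%Z ->
  psym q z = psym q w.
Proof.
move=> /eqP; rewrite eqz_mod_dvd -q_closure_int // rmorphB subr_eq0 => /eqP h1.
move=> /eqP; rewrite eqz_mod_dvd -q_closure_int // rmorphB subr_eq0 => /eqP h2.
by rewrite /psym /psym_power /conj_ratio /gev h1 h2.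
Qed.

Lemma psym_rat (a : int) : ~~ (q %| a)%Z -> psym q (a, 0) = 0.
Proof.
rewrite -q_closure_int // => a0; rewrite /psym /psym_power /conj_ratio /gev /= !mul0r addr0.
by rewrite divff // invr1 !expr1n if_same -(expr0 i) (qidx_exp i2 two0 0).
Qed.

Lemma psym_conj z : qunit z -> psym q (gconj z) = - psym q z.
Proof.
move=> hz; have hz' : qunit (gconj z) by rewrite /qunit /gnorm /= sqrrN.
apply: (i_exp_inj i2 two0).
rewrite i_expN // !psym_exp // /psym_power.
have -> : conj_ratio q (gconj z) = (conj_ratio q z)^-1.
  by rewrite /conj_ratio !gev_conj // opprK invf_div.
by case: ifP => _; rewrite exprVn.
Qed.

Lemma gev_1i (j : K) : gev j (1, 1) = 1 + j.
Proof. by rewrite /gev /= mul1r. Qed.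

Lemma qunit_i : qunit (0, 1).
Proof. by rewrite /qunit /gnorm /= expr0n add0r expr1n -q_closure_int // oner_neq0. Qed.

Lemma qunit_1i : qunit (1, 1).
Proof. by rewrite /qunit /gnorm /= expr1n -q_closure_int. Qed.

(** The quotient of [1 + i] by its conjugate is [i]. *)
Lemma psym_1i : psym q (1, 1) = star4 q.
Proof.
have [/= a0 b0] := qunitP qunit_1i.
apply: (i_exp_inj i2 two0); rewrite psym_exp ?qunit_1i // /psym_power /star4.
have -> : conj_ratio q (1, 1) = i.
  rewrite !gev_1i in a0 b0; rewrite /conj_ratio !gev_1i.
  by apply: (mulIf b0); rewrite divfK // mulrDr mulrN -expr2 i2; ring.
by case: ifP => _; rewrite ?i_expN ?i_expn_mod4 ?exprVn.
Qed.

(** The quotient of [i] by its conjugate is the square of that of [1 + i]. *)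
Lemma psym_i : psym q (0, 1) = star4 q *+ 2.
Proof.
have [/= a0 b0] := qunitP qunit_i.
apply: (i_exp_inj i2 two0).
rewrite i_expMn // -psym_1i !psym_exp ?qunit_1i ?qunit_i // /psym_power.
have e : conj_ratio q (0, 1) = conj_ratio q (1, 1) ^+ 2.
  have [/= c0 d0] := qunitP qunit_1i.
  rewrite /conj_ratio expr_div_n !gev_1i in c0 d0 *.
  have -> : (1 + i) ^+ 2 = i *+ 2 by rewrite sqrrD i2; ring.
  have -> : (1 - i) ^+ 2 = - (i *+ 2) by rewrite sqrrB i2; ring.
  rewrite /gev /= !mul1r !add0r !invrN !mulrN !divff //; last exact: i_neq0 i2.
  by rewrite -mulr_natr mulf_neq0 // i_neq0.
by rewrite e; case: ifP => _; rewrite -?exprVn -!exprM mulnC.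
Qed.

End PrimeSymbol.

Lemma int_parity (n : int) : (exists m, n = 2 * m) \/ (exists m, n = 2 * m + 1).
Proof.
have [h|h] : (n %% 2 = 0)%Z \/ (n %% 2 = 1)%Z by lia.
- by left; exists (n %/ 2)%Z; lia.
- by right; exists (n %/ 2)%Z; lia.
Qed.

Lemma even_consec (n : int) : exists m, n * (n + 1) = 2 * m.
Proof.
case: (int_parity n) => [[m ->]|[m ->]].
- by exists (m * (2 * m + 1)); ring.
- by exists ((2 * m + 1) * (m + 1)); ring.
Qed.

(** * The quartic character of a prime field *)

Definition ind4 (p : nat) (j a : 'F_p) : 'Z_4 := qidx j (a ^+ (p %/ 4)).

Section PrimeField.

Variables (p : nat) (j : 'F_p).
Hypothesis p_pr : prime p.
Hypothesis p1 : (p %% 4 = 1)%N.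
Hypothesis j2 : j ^+ 2 = -1.

Local Notation k := (p %/ 4)%N.
Local Notation ind := (ind4 j).

Lemma p_eq4k : p = (4 * k).+1. Proof. lia. Qed.

Lemma k_gt0 : (0 < k)%N.
Proof. by have := prime_gt1 p_pr; lia. Qed.

Lemma Fp_two_neq0 : (2 : 'F_p) != 0.
Proof.
by rewrite -(dvdn_pcharf (pchar_Fp p_pr)) dvdn_prime2 //; apply/eqP; lia.
Qed.

Lemma Fp_exp (a : 'F_p) : a != 0 -> a ^+ (4 * k) = 1.
Proof.
move=> a0; apply: (mulIf a0); rewrite mul1r -exprSr.
have := expf_card a; rewrite card_Fp // => h.
by rewrite -p_eq4k.
Qed.

Lemma ind4_exp (a : 'F_p) : a != 0 -> j ^+ ind a = a ^+ k.
Proof. by move=> /Fp_exp h; rewrite /ind4 qidxK // -exprM mulnC. Qed.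

Lemma ind4M (a b : 'F_p) : a != 0 -> b != 0 -> ind (a * b) = ind a + ind b.
Proof.
move=> a0 b0; apply: (i_exp_inj j2 Fp_two_neq0).
by rewrite i_expD // !ind4_exp ?mulf_neq0 // exprMn.
Qed.

Lemma exists_exp_neq1 m : (0 < m < 4 * k)%N -> exists2 b : 'F_p, b != 0 & b ^+ m != 1.
Proof.
case/andP=> m0 mk.
have [/existsP[b /andP[]]|] := boolP [exists b : 'F_p, (b != 0) && (b ^+ m != 1)].
  by exists b.
rewrite negb_exists => /forallP h; exfalso.
have := @max_unity_roots _ m (enum (predC1 (0 : 'F_p))) m0 _ (enum_uniq _).
rewrite -cardE cardC1 card_Fp // leqNgt => /(_ _)/negP; apply; last first.
  by rewrite {1}p_eq4k.
apply/allP => b; rewrite mem_enum !inE => b0.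
by have := h b; rewrite b0 negbK unity_rootE.
Qed.

(** The sum is invariant under multiplication by some [b ^+ m] other than 1. *)
Lemma power_sum0 m : (m < 4 * k)%N -> \sum_(a : 'F_p) a ^+ m = 0.
Proof.
case: m => [|m] mk.
  rewrite (eq_bigr (fun=> 1)) => [|a _]; last by rewrite expr0.
  by rewrite sumr_const card_Fp // pchar_Fp_0.
have [b b0 bm] := @exists_exp_neq1 m.+1 mk.
set S := \sum_a _.
have: b ^+ m.+1 * S = S.
  rewrite {2}/S (reindex_inj (mulfI b0)) /= mulr_sumr.
  by apply: eq_bigr => a _; rewrite exprMn.
move/eqP; rewrite -subr_eq0 -{2}[S]mul1r -mulrBl mulf_eq0 subr_eq0.
by rewrite (negPf bm) => /eqP.
Qed.

Lemma horner_sum0 (P : {poly 'F_p}) : (size P <= 4 * k)%N -> \sum_a P.[a] = 0.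
Proof.
move=> sP; under eq_bigr do rewrite horner_coef.
rewrite exchange_big big1 //= => m _.
by rewrite -mulr_sumr power_sum0 ?mulr0 // (leq_trans _ sP).
Qed.

Local Notation J := (jacobi ind).

(** In the prime field itself the character is the power of exponent
    [(p - 1) / 4], so that the Jacobi sum is a sum over F_p of the values of a
    polynomial of degree less than [p - 1]. *)
Lemma jacobi_root : gev j J = 0.
Proof.
rewrite gev_jacobi // /jac_sum.
have e (a : 'F_p) : chi j ind 1 a = a ^+ k.
  have [->|a0] := eqVneq a 0; first by rewrite chi0 expr0n gtn_eqF ?k_gt0.
  by rewrite chiE // mul1r ind4_exp.
under eq_bigr do rewrite !e.
transitivity ((-1) ^+ k * \sum_(a : 'F_p) ('X^k * ('X - 1%:P) ^+ k).[a]).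
  rewrite mulr_sumr; apply: eq_bigr => a _.
  rewrite hornerM hornerXn horner_exp hornerXsubC mulrCA; congr (_ * _).
  by rewrite -exprMn mulN1r opprB.
rewrite horner_sum0 ?mulr0 //; apply: leq_trans (size_polyMleq _ _) _.
by rewrite size_polyXn size_exp_XsubC; have := k_gt0; lia.
Qed.

Lemma ind4_nontrivial : exists2 g : 'F_p, g != 0 & ind g *+ 2 != 0.
Proof.
have [|g g0 gk] := @exists_exp_neq1 (k * 2)%N; first by have := k_gt0; lia.
exists g => //; apply: contraNneq gk => h.
by rewrite exprM -ind4_exp // -i_expMn // h.
Qed.

(** The relation of [jacobi_norm_in] in a field of characteristic 0. *)
Lemma jacobi_norm : gnorm J = p.
Proof.
have [g g0 gk] := ind4_nontrivial.
have algC_p0 : (p%:R : algC) != 0 by rewrite pnatr_eq0 -lt0n prime_gt0.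
have [z zp z1] := exists_pth_root algC_p0 (prime_gt1 p_pr).
have two : (2 : algC) != 0 by rewrite pnatr_eq0.
have h := jacobi_norm_in p_pr (sqrCi _) two zp z1 ind4M g0 gk algC_p0.
by apply/eqP; rewrite -(eqr_int algC) h.
Qed.

(** Modulo 2 the imaginary part is the sum of the exponents [ind a] and
    [ind (1 - a)], and these two families agree up to order. *)
Lemma jacobi_im_even : (2 %| J.2)%Z.
Proof.
have e (n : 'Z_4) : (2 * im4 n)%:~R = n *+ 2.
  by case: (Z4_cases n) => ->; apply: val_inj.
have: (2 * J.2)%:~R = 0 :> 'Z_4.
  rewrite /jacobi /= mulr_sumr rmorph_sum /=.
  under eq_bigr do rewrite e mulrnDl.
  rewrite big_split /= [X in _ + X](reindex_inj (subrI 1)) /=.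
  rewrite [X in _ + X](eq_big (fun a => (a != 0) && (a != 1)) (fun a => ind a *+ 2)).
  - rewrite -big_split big1 //= => a _.
    by rewrite -mulrnDr; case: (Z4_cases (ind a)) => ->; apply: val_inj.
  - move=> a; rewrite subr_eq0 [1 == a]eq_sym andbC; congr (_ && _).
    by rewrite -[X in _ != X]subr0 (inj_eq (subrI 1)).
  - by move=> a _; rewrite subKr.
by move/eqP; rewrite Z4_int_eq0; lia.
Qed.

(** Both sides are 0 or 2; since [J.1 ^+ 2] is 1 modulo 8, the norm of J shows
    that [J.2 / 2] has the parity of [(p - 1) / 4]. *)
Lemma ind4_N1 : ind (-1) = J.2%:~R.
Proof.
have hn := jacobi_norm; have [e he] := dvdzP jacobi_im_even.
apply: (i_exp_inj j2 Fp_two_neq0); rewrite ind4_exp ?oppr_eq0 ?oner_neq0 //.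
have -> : J.2%:~R = (k * 2)%:R :> 'Z_4.
  rewrite pmulrn; apply: Z4_int_eq; rewrite he.
  have {hn} : J.1 ^+ 2 + (e * 2) ^+ 2 = (4 * k).+1 by rewrite -p_eq4k -he.
  move: (J.1) => a; case: (int_parity a) => [[b ->]|[b ->]] hn; first by lia.
  have [u hu] := even_consec b; have [v hv] := even_consec e.
  have : k = b * (b + 1) + e * (e + 1) - e :> int by lia.
  by rewrite hu hv; lia.
by rewrite i_expn_mod4 // mulnC exprM j2.
Qed.

Section Reciprocity.

Variable q : nat.
Hypothesis q_pr : prime q.
Hypothesis q_odd : odd q.
Hypothesis qp : q != p.

Lemma Fp_q_neq0 : (q%:R : 'F_p) != 0.
Proof. by rewrite -(dvdn_pcharf (pchar_Fp p_pr)) dvdn_prime2 // eq_sym. Qed.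

Lemma qunit_jacobi : qunit q J.
Proof. by rewrite /qunit jacobi_norm -[(_ %| _)%Z]/(q %| p)%N dvdn_prime2. Qed.

(** The Gauss sum is raised to the power [q] when [q = 1 (mod 4)], and to the
    power [q + 1] otherwise: by [gauss_frobenius] this involves the index of q,
    and by [gauss1_exp4] the quotient of J by its conjugate. *)
Lemma jacobi_reciprocity :
  psym q J = ind q%:R + (if (q %% 4 == 1)%N then 0 else ind (-1)).
Proof.
have N1 : (q %% 4 = 1)%N -> (q %/ 4 * 4).+1 = q by lia.
have N2 : (q %/ 4 + 3 * (q %/ 4) = q %/ 4 * 4)%N by lia.
have N3 : (q %% 4 == 1)%N = false -> (q %% 4 = 3)%N by lia.
have N4 : (q %% 4 = 3)%N -> (4 * (q %/ 4).+1 = q.+1)%N by lia.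
have N5 : (3 * (q %/ 4).+1 + (q %/ 4).+1 = 4 * (q %/ 4).+1)%N by lia.
have [g g0 gk] := ind4_nontrivial.
pose i := sqrtm1 q; have i2 : i ^+ 2 = -1 := sqrtm1_sq q.
have two : (2 : q_closure q) != 0 := q_closure_two q_pr q_odd.
have qc := q_closure_char q_pr.
have p0 : (p%:R : q_closure q) != 0 by rewrite -(dvdn_pcharf qc) dvdn_prime2.
have [z zp z1] := exists_pth_root p0 (prime_gt1 p_pr).
have G4 := gauss1_exp4 p_pr i2 two zp z1 ind4M g0 gk p0.
have G13 := gauss1_mul_gauss3 p_pr i2 two zp z1 ind4M g0 gk.
have GF := gauss_frobenius p_pr i2 zp ind4M q_pr qc Fp_q_neq0 1.
have NJ := jacobi_norm_in p_pr i2 two zp z1 ind4M g0 gk p0.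
rewrite -(gev_norm i2) in NJ.
have [E0 E0'] := qunitP q_pr qunit_jacobi.
have F1 := frob_gev q_pr q_odd J.
rewrite -/i in E0 E0' F1.
set E := gev i J in G4 NJ E0 F1; set E' := gev (- i) J in G4 NJ E0' F1.
set G1 := gauss _ _ _ 1 in G4 G13 GF; set G3 := gauss _ _ _ 3 in G13 GF.
have G0 : G1 != 0.
  apply/eqP => h; move/eqP: G4.
  by rewrite h expr0n eq_sym mulf_eq0 expf_eq0 /= (negPf E0) (negPf E0').
apply: (i_exp_inj i2 two); rewrite psym_exp ?qunit_jacobi // /psym_power /conj_ratio -/i
  -/E -/E'.
have qe := divn_eq q 4.
case: ifP F1 => [/eqP q1|q3] F1.
  rewrite addr0; have e1 : 1 *+ q = 1 :> 'Z_4.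
    by rewrite qe q1 addn1 mulrS mulnC mulrnA (_ : 1 *+ 4 = 0 :> 'Z_4) ?mul0rn ?addr0 //;
      apply: val_inj.
  have F : G1 ^+ (q %/ 4 * 4) = (i ^+ ind q%:R)^-1.
    apply: (mulIf G0); rewrite -exprSr -i_expN // -[RHS](_ : G1 ^+ q = _).
      by rewrite N1.
    by rewrite GF e1 mul1r.
  have E4 : E ^+ (q %/ 4 * 4) = 1.
    by apply: (mulIf E0); rewrite mul1r -exprSr -[RHS]F1 N1.
  rewrite -[RHS]invrK -F mulnC exprM G4 expr_div_n exprMn invfM -exprM.
  apply: (mulIf (expf_neq0 (q %/ 4) E0')); rewrite !divfK ?expf_neq0 //.
  apply: (mulIf (expf_neq0 (3 * (q %/ 4)) E0)); rewrite -exprD mulVf ?expf_neq0 //.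
  by rewrite N2 E4.
have q3' := N3 q3.
have e3 : 1 *+ q = 3 :> 'Z_4.
  rewrite qe q3' mulnC mulrnDr mulrnA (_ : 1 *+ 4 = 0 :> 'Z_4) ?mul0rn ?add0r //.
  by apply: val_inj.
have F : G1 ^+ (4 * (q %/ 4).+1) = i ^+ (ind q%:R + ind (-1))%R * p%:R.
  have -> : G1 ^+ (4 * (q %/ 4).+1) = G1 ^+ q * G1 by rewrite N4 // exprSr.
  rewrite GF e3 -/G3 -mulrA [G3 * G1]mulrC G13 mulrA i_expD //; congr (_ ^+ _ * _ * _).
  by case: (Z4_cases (ind q%:R)) => ->.
have E4 : E ^+ (4 * (q %/ 4).+1) = p%:R.
  by rewrite -NJ -F1 -exprS N4.
apply: (mulIf p0); rewrite -F exprM G4 -E4 invf_div.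
rewrite expr_div_n exprMn -exprM; apply/eqP.
rewrite mulrAC; apply/eqP; apply: (mulIf (expf_neq0 (q %/ 4).+1 E0)).
rewrite divfK ?expf_neq0 // [E' ^+ _ * _]mulrC mulrAC; congr (_ * _).
by rewrite -exprD N5.
Qed.

End Reciprocity.

End PrimeField.

(** * The symbol modulo an odd integer *)

Definition qsym (m : nat) (z : int * int) : 'Z_4 :=
  \sum_(0 <= q < m.+1) psym q z *+ logn q m.

Definition gcop (m : nat) (z : int * int) := coprime m `|gnorm z|.

Lemma prime_of_logn q m : (0 < logn q m)%N -> prime q /\ (q %| m)%N.
Proof. by rewrite logn_gt0 mem_primes => /and3P[]. Qed.

Lemma odd_dvd q m : odd m -> (q %| m)%N -> odd q.
Proof. by move=> om /dvdnP[k e]; move: om; rewrite e oddM => /andP[]. Qed.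

Lemma qsym_eqr m z (F : nat -> 'Z_4) :
  (forall q, prime q -> (q %| m)%N -> psym q z = F q) ->
  qsym m z = \sum_(0 <= q < m.+1) F q *+ logn q m.
Proof.
move=> h; apply: eq_bigr => q _.
have [e|/prime_of_logn[q_pr qm]] := posnP (logn q m); first by rewrite e.
by rewrite h.
Qed.

Lemma qsym_widen m z B : (0 < m < B)%N ->
  qsym m z = \sum_(0 <= q < B) psym q z *+ logn q m.
Proof.
case/andP=> m0 mB; rewrite /qsym (@big_cat_nat _ _ _ m.+1 0 B) //= [X in _ + X]big_nat [X
  in _ + X]big1 ?addr0 //.
move=> q /andP[mq _]; have [->//|/prime_of_logn[_ /dvdn_leq]] := posnP (logn q m).
by move=> /(_ m0); rewrite leqNgt mq.
Qed.

Lemma qsymMl m n z : (0 < m)%N -> (0 < n)%N -> qsym (m * n)%N z = qsym m z + qsym n z.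
Proof.
move=> m0 n0; rewrite (@qsym_widen m z (m * n)%N.+1) ?m0 ?ltnS ?leq_pmulr //.
rewrite (@qsym_widen n z (m * n)%N.+1) ?n0 ?ltnS ?leq_pmull //.
rewrite -big_split; apply: eq_bigr => q _ /=.
by rewrite -mulrnDr lognM.
Qed.

Lemma qsym1 z : qsym 1 z = 0.
Proof. by rewrite /qsym big1 // => q _; rewrite logn1. Qed.

Lemma qsym_prime q z : prime q -> qsym q z = psym q z.
Proof.
move=> q_pr; rewrite /qsym big_nat_recr //= logn_prime // eqxx mulr1n.
rewrite big_nat [X in X + _]big1 ?add0r // => r /andP[_ rq].
by rewrite logn_prime // ltn_eqF.
Qed.

Lemma odd_prime_ind (P : nat -> Prop) : P 1%N ->
  (forall q m, prime q -> odd q -> odd m -> P m -> P (q * m)%N) ->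
  forall m, odd m -> P m.
Proof.
move=> P1 Pq m; elim/ltn_ind: m => m IHm om.
have m0 : (0 < m)%N by case: m om {IHm}.
have [m1|m1] := leqP m 1; first by rewrite (_ : m = 1%N) //; lia.
have q_pr := pdiv_prime m1; have := pdiv_dvd m => /dvdnP[n e].
have on : odd n /\ odd (pdiv m) by apply/andP; rewrite -oddM -e.
have n0 : (0 < n)%N by case: (n) on => [[]|].
rewrite e mulnC; apply: Pq => //; try by case: on.
apply: IHm; last by case: on.
by rewrite e ltn_Pmulr // prime_gt1.
Qed.

Lemma gcop_qunit m z q : prime q -> (q %| m)%N -> gcop m z -> qunit q z.
Proof.
move=> q_pr qm; rewrite /gcop => /(coprime_dvdl qm).
by rewrite prime_coprime.
Qed.

Lemma qsymMr m z w : odd m -> gcop m z -> gcop m w -> qsym m (gmul z w) = qsym m z + qsym m w.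
Proof.
move=> om hz hw; rewrite -big_split (@qsym_eqr _ _ (fun q => psym q z + psym q w)).
  by apply: eq_bigr => q _; rewrite mulrnDl.
move=> q q_pr qm.
by apply: psymM => //; [exact: odd_dvd qm | exact: gcop_qunit hz | exact: gcop_qunit hw].
Qed.

Lemma qsym_congr (m : nat) z w : (z.1 = w.1 %[mod m])%Z -> (z.2 = w.2 %[mod m])%Z ->
  qsym m z = qsym m w.
Proof.
move=> /eqP; rewrite eqz_mod_dvd => h1 /eqP; rewrite eqz_mod_dvd => h2.
apply: qsym_eqr => q q_pr qm; have qm' : (q%:Z %| m%:Z)%Z by [].
by apply: psym_congr => //; apply/eqP; rewrite eqz_mod_dvd; apply: dvdz_trans qm' _.
Qed.

Lemma qsym_rat m (a : int) : odd m -> coprime m `|a| -> qsym m (a, 0) = 0.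
Proof.
move=> om ca; rewrite (@qsym_eqr _ _ (fun=> 0)).
  by rewrite big1 // => q _; rewrite mul0rn.
move=> q q_pr qm; apply: psym_rat => //; first exact: odd_dvd qm.
have := coprime_dvdl qm ca; by rewrite prime_coprime.
Qed.

Lemma qsym_conj m z : odd m -> gcop m z -> qsym m (gconj z) = - qsym m z.
Proof.
move=> om hz; rewrite -sumrN (@qsym_eqr _ _ (fun q => - psym q z)).
  by apply: eq_bigr => q _; rewrite mulNrn.
move=> q q_pr qm.
by apply: psym_conj => //; [exact: odd_dvd qm | exact: gcop_qunit hz].
Qed.

Lemma star4_int (m e : int) : m = 4 * e + 1 -> star4 `|m| = e%:~R.
Proof.
move=> h; rewrite /star4; case: ifP => h1.
  by rewrite pmulrn; apply: Z4_int_eq; lia.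
by rewrite pmulrn -rmorphN; apply: Z4_int_eq; lia.
Qed.

Lemma odd_star (m : int) : odd `|m| -> exists n e : int, n = 4 * e + 1 /\ (m = n \/ m = - n).
Proof.
move=> om; have [h|h] : (m %% 4 = 1)%Z \/ (m %% 4 = 3)%Z by lia.
- by exists m, (m %/ 4)%Z; split; [lia | left].
- by exists (- m), (- m %/ 4)%Z; split; [lia | right; lia].
Qed.

Lemma star4M m n : odd m -> odd n -> star4 (m * n)%N = star4 m + star4 n.
Proof.
move=> om on.
have [m' [e [he hm]]] := @odd_star m om; have [n' [f [hf hn]]] := @odd_star n on.
have -> : m = `|m'|%N by lia.
have -> : n = `|n'|%N by lia.
rewrite -abszM (star4_int he) (star4_int hf) -rmorphD.
rewrite (@star4_int _ (4 * e * f + e + f)); last by rewrite he hf; ring.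
by apply: Z4_int_eq; lia.
Qed.

Lemma star4_sq (m : int) : odd `|m| -> star4 `|m| *+ 2 = ((m ^+ 2 - 1) %/ 4)%Z%:~R.
Proof.
move=> /odd_star [n [e [he hm]]].
have -> : m ^+ 2 = (4 * (4 * e * e + 2 * e)) + 1 by case: hm => ->; rewrite ?sqrrN he; ring.
have -> : star4 `|m| = star4 `|n| by case: hm => ->; rewrite ?abszN.
rewrite (star4_int he) -rmorphMn; apply: Z4_int_eq.
by rewrite addrK mulKz //; lia.
Qed.

Lemma gnorm_1i : gnorm (1, 1) = 2. Proof. by []. Qed.

(** The additivity [star4M] reduces this to primes. *)
Lemma qsym_1i m : odd m -> qsym m (1, 1) = star4 m.
Proof.
move: m; apply: odd_prime_ind => [|q m q_pr oq om h]; first by rewrite qsym1.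
rewrite (qsymMl _ (prime_gt0 q_pr) (odd_gt0 om)) star4M // h qsym_prime // psym_1i //.
Qed.

Lemma qsym_i m : odd m -> qsym m (0, 1) = star4 m *+ 2.
Proof.
move: m; apply: odd_prime_ind => [|q m q_pr oq om h]; first by rewrite qsym1 (_ : star4 1 =
  0) ?mul0rn.
by rewrite (qsymMl _ (prime_gt0 q_pr) (odd_gt0 om)) star4M // mulrnDl h qsym_prime //
  (psym_i q_pr oq).
Qed.

Lemma gnormM z w : gnorm (gmul z w) = gnorm z * gnorm w.
Proof. by rewrite /gnorm /gmul /=; ring. Qed.

Lemma gcopM m z w : gcop m (gmul z w) = gcop m z && gcop m w.
Proof. by rewrite /gcop gnormM abszM coprimeMr. Qed.

Lemma gcop_rat m a : gcop m (a, 0) = coprime m `|a|.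
Proof. by rewrite /gcop /gnorm /= expr0n addr0 abszX coprime_pexpr. Qed.

(** * Periodicity of the symbol *)

(** The value predicted by reciprocity for the quartic symbol of [2 ^ e * m] over
    [z = a + b i], with m odd and b even: the symbol of z modulo m, corrected by
    the index [b] of -1 when [m = 3 (mod 4)], and by the index [a b / 2] of 2. *)
Definition recip_sym (e : nat) (m : int) (z : int * int) : 'Z_4 :=
  (z.1 * z.2 %/ 2)%Z%:~R *+ e + (z.2 * ((m - 1) %/ 2)%Z)%:~R + qsym `|m| z.

(** The terms for 2 and -1 are additive in z because [a ^+ 2] is 1 modulo 8 for
    the odd real parts, and because the imaginary parts are even. *)
Lemma recip_symM e m z w : odd `|m| -> gcop `|m| z -> gcop `|m| w ->
  odd `|z.1| -> odd `|w.1| -> (2 %| z.2)%Z -> (2 %| w.2)%Z ->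
  recip_sym e m (gmul z w) = recip_sym e m z + recip_sym e m w.
Proof.
move=> om hz hw oz ow /dvdzP[b hb] /dvdzP[d hd].
rewrite /recip_sym qsymMr //=.
have -> : ((z.1 * w.1 - z.2 * w.2) * (z.1 * w.2 + z.2 * w.1) %/ 2)%Z%:~R =
   (z.1 * z.2 %/ 2)%Z%:~R + (w.1 * w.2 %/ 2)%Z%:~R :> 'Z_4.
  rewrite -rmorphD; apply: Z4_int_eq.
  have [a [x [ha hz1]]] := odd_star oz; have [c [y [hc hw1]]] := odd_star ow.
  have hz2 : z.1 * z.1 = 1 + 8 * (2 * x * x + x) by case: hz1 => ->; rewrite ?mulrNN ha; ring.
  have hw2 : w.1 * w.1 = 1 + 8 * (2 * y * y + y) by case: hw1 => ->; rewrite ?mulrNN hc; ring.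
  have -> : z.1 * z.2 = (z.1 * b) * 2 by rewrite hb; ring.
  have -> : w.1 * w.2 = (w.1 * d) * 2 by rewrite hd; ring.
  have -> : (z.1 * w.1 - z.2 * w.2) * (z.1 * w.2 + z.2 * w.1) =
    (z.1 * z.1 * (w.1 * d) + w.1 * w.1 * (z.1 * b) -
      4 * (b * d * (z.1 * d + b * w.1))) * 2 by rewrite hb hd; ring.
  rewrite !mulzK // hz2 hw2; lia.
have -> : ((z.1 * w.2 + z.2 * w.1) * ((m - 1) %/ 2)%Z)%:~R =
   (z.2 * ((m - 1) %/ 2)%Z)%:~R + (w.2 * ((m - 1) %/ 2)%Z)%:~R :> 'Z_4.
  rewrite -rmorphD; apply: Z4_int_eq.
  have [a ha] : exists a, z.1 = 2 * a + 1 by exists (z.1 %/ 2)%Z; lia.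
  have [c hc] : exists c, w.1 = 2 * c + 1 by exists (w.1 %/ 2)%Z; lia.
  by move: ((m - 1) %/ 2)%Z => u; rewrite ha hb hc hd; lia.
by rewrite mulrnDl; ring.
Qed.

Lemma gcop_congr (m : nat) z w : (z.1 = w.1 %[mod m])%Z -> (z.2 = w.2 %[mod m])%Z ->
  gcop m z -> gcop m w.
Proof.
move=> /eqP; rewrite eqz_mod_dvd => /dvdzP[k h1] /eqP; rewrite eqz_mod_dvd => /dvdzP[l h2].
rewrite /gcop -[coprime _ _]/(coprimez m (gnorm z)) -[coprime m `|gnorm w|]/(coprimez m
  (gnorm w)).
have -> : gnorm z = (k * (z.1 + w.1) + l * (z.2 + w.2)) * m + gnorm w.
  transitivity ((z.1 - w.1) * (z.1 + w.1) + (z.2 - w.2) * (z.2 + w.2) + gnorm w).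
    by rewrite /gnorm; ring.
  by rewrite h1 h2; ring.
by rewrite /coprimez gcdzMDl.
Qed.

Lemma gcop_i m : gcop m (0, 1).
Proof. by rewrite /gcop coprimen1. Qed.

Lemma gcop_nz m a : gcop m (a, 0) -> coprime m `|a|.
Proof. by rewrite gcop_rat. Qed.

(** Rational factors are invisible to the symbol, so this is the symbol of
    the imaginary unit. *)
Lemma qsym_imag (m : nat) (a : int) : odd m -> gcop m (0, a) -> qsym m (0, a) = star4 m *+ 2.
Proof.
move=> om; have -> : (0, a) = gmul (0, 1) (a, 0) by rewrite /gmul /=; congr (_, _); ring.
rewrite gcopM => /andP[h1 h2].
by rewrite qsymMr // qsym_i // qsym_rat ?addr0 // gcop_nz.
Qed.

Lemma Z4_mul4 (n : 'Z_4) : n *+ 4 = 0.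
Proof. by case: (Z4_cases n) => ->; apply: val_inj. Qed.

Lemma absz_dvd (n : int) : (`|n|%N%:Z %| n)%Z.
Proof. by rewrite dvdzE. Qed.

Lemma eqz_modP (m : nat) (a b : int) : (m %| a - b)%Z -> (a = b %[mod m])%Z.
Proof. by rewrite -eqz_mod_dvd => /eqP. Qed.

(** Modulo its real part, z is a rational multiple of [i]. *)
Lemma qsym_re z : odd `|z.1| -> gcop `|z.1| z -> qsym `|z.1| z *+ 2 = 0.
Proof.
case: z => a b /= oa h; have c : (a = 0 %[mod `|a|])%Z.
  by apply: eqz_modP; rewrite subr0 absz_dvd.
rewrite (@qsym_congr _ _ (0, b)) // qsym_imag // -?mulrnA ?Z4_mul4 //.
exact: gcop_congr h.
Qed.

(** Modulo [z.1 + z.2], z is a rational multiple of [i (1 + i)]. *)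
Lemma qsym_re_im z : odd `|z.1 + z.2| -> gcop `|z.1 + z.2| z ->
  qsym `|z.1 + z.2| z *+ 2 = (((z.1 + z.2) ^+ 2 - 1) %/ 4)%Z%:~R.
Proof.
case: z => a b /= oa h; pose w := gmul (gmul (0, 1) (1, 1)) (b, 0).
have ew : w = (- b, b) by rewrite /w /gmul /=; congr (_, _); ring.
have c : (a = w.1 %[mod `|a + b|])%Z.
  by apply: eqz_modP; rewrite ew opprK absz_dvd.
have c2 : (b = w.2 %[mod `|a + b|])%Z by rewrite ew.
have := @gcop_congr _ (a, b) w c c2 h; rewrite !gcopM -andbA => /and3P[g1 g2 g3].
rewrite (@qsym_congr _ (a, b) w) // !qsymMr ?gcopM ?g1 // qsym_i // qsym_1i // qsym_rat
  ?gcop_nz // addr0.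
by rewrite -mulrSr -mulrnA -[(3 * 2)%N]/(4 + 2)%N mulrnDr Z4_mul4 add0r star4_sq.
Qed.

Section JacobiSymbol.

Variables (p : nat) (j : 'F_p).
Hypothesis p_pr : prime p.
Hypothesis p1 : (p %% 4 = 1)%N.
Hypothesis j2 : j ^+ 2 = -1.

Local Notation ind := (ind4 j).
Local Notation J := (jacobi ind).

Lemma jacobi_re_odd : odd `|J.1|.
Proof.
have h := jacobi_norm p_pr p1 j2; have [b hb] := dvdzP (jacobi_im_even j p_pr p1).
rewrite /gnorm hb in h; move: (J.1) h => a h.
have [//|o] := boolP (odd `|a|).
have [c ha] : exists c, a = 2 * c by exists (a %/ 2)%Z; lia.
by move: h; rewrite ha; lia.
Qed.

Lemma gcop_jacobi m : gcop m J = ~~ (p %| m)%N.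
Proof. by rewrite /gcop (jacobi_norm p_pr p1 j2) coprime_sym prime_coprime. Qed.

Lemma Fp_nat0 m : ((m%:R : 'F_p) == 0) = (p %| m)%N.
Proof. by rewrite -(dvdn_pcharf (pchar_Fp p_pr)). Qed.

(** Reciprocity for primes, extended by multiplicativity; the index of -1 is even,
    so only the class of m modulo 4 matters for its coefficient. *)
Lemma ind4_odd_nat m : odd m -> gcop m J ->
  ind m%:R = (J.2 * ((m%:Z - 1) %/ 2)%Z)%:~R + qsym m J.
Proof.
have [b hb] := dvdzP (jacobi_im_even j p_pr p1).
move: m; apply: odd_prime_ind => [|q m q_pr oq om IHm].
  by rewrite subrr div0z mulr0 qsym1 addr0 (ind_1 (ind4M p_pr p1 j2)).
rewrite gcop_jacobi Euclid_dvdM // negb_or => /andP[hq hm].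
rewrite gcop_jacobi hm in IHm.
rewrite natrM (ind4M p_pr p1 j2) ?Fp_nat0 // IHm // qsymMl ?odd_gt0 // (qsym_prime _ q_pr).
have qp : q != p by apply: contraNneq hq => ->.
rewrite (jacobi_reciprocity p_pr p1 j2 q_pr oq qp) (ind4_N1 p_pr p1 j2).
have [x hx] : exists x : int, m = 2 * x + 1 :> int by exists (m %/ 2)%N; lia.
have e1 : (m%:Z - 1 = x * 2) by lia.
case: ifP => q1; rewrite hb e1.
  have [y hy] : exists y : int, q = 4 * y + 1 :> int by exists (q %/ 4)%N; lia.
  have e2 : ((q * m)%N%:Z - 1 = (4 * y * x + x + 2 * y) * 2) by rewrite PoszM hx hy; ring.
  have e3 : (b * 2 * (4 * y * x + x + 2 * y))%:~R = (b * 2 * x)%:~R :> 'Z_4.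
    by apply: Z4_int_eq; lia.
  by rewrite e2 !mulzK // e3; ring.
have [y hy] : exists y : int, q = 4 * y + 3 :> int by exists (q %/ 4)%N; lia.
have e2 : ((q * m)%N%:Z - 1 = (4 * y * x + 3 * x + 2 * y + 1) * 2) by rewrite PoszM hx hy;
  ring.
have e3 : (b * 2 * (4 * y * x + 3 * x + 2 * y + 1))%:~R = (b * 2 * x)%:~R - (b * 2)%:~R :>
  'Z_4.
  by rewrite -rmorphB; apply: Z4_int_eq; lia.
by rewrite e2 !mulzK // e3; ring.
Qed.

Lemma Fp_int0 (m : int) : ((m%:~R : 'F_p) == 0) = (p %| `|m|)%N.
Proof. by rewrite -(dvdz_pcharf (pchar_Fp p_pr)). Qed.

Lemma ind4_odd (m : int) : odd `|m| -> gcop `|m| J ->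
  ind m%:~R = (J.2 * ((m - 1) %/ 2)%Z)%:~R + qsym `|m| J.
Proof.
have [b hb] := dvdzP (jacobi_im_even j p_pr p1).
move=> om cm; have h := ind4_odd_nat om cm; rewrite hb in h *.
case: (intP m) om cm h => [|n|n] // om cm h.
rewrite abszN in om cm h *; rewrite rmorphN /= -mulN1r.
have n0 : ((n.+1)%:~R : 'F_p) != 0 by rewrite Fp_int0; rewrite gcop_jacobi in cm.
rewrite (ind4M p_pr p1 j2) ?oppr_eq0 ?oner_neq0 // (ind4_N1 p_pr p1 j2) hb {}h addrA.
have [x hx] : exists x : int, n.+1 = 2 * x + 1 :> int by exists (n.+1 %/ 2)%N; lia.
have -> : ((n.+1%:Z - 1) %/ 2)%Z = x by lia.
have -> : ((- n.+1%:Z - 1) %/ 2)%Z = - x - 1 by lia.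
congr (_ + _); rewrite -rmorphD; apply: Z4_int_eq; lia.
Qed.

Lemma gev_root_re : gev j J = 0 -> J.1%:~R = - (J.2%:~R * j) :> 'F_p.
Proof. by move/eqP; rewrite /gev addr_eq0 => /eqP. Qed.

(** As J vanishes at [j], [(J.1 + J.2) ^+ 2 = 2 * J.1 ^+ 2 * j] in F_p.  The indices
    of [J.1 + J.2] and [J.1] are given by reciprocity, modulo integers for which
    J is explicit up to a rational factor. *)
Lemma ind4_2 : ind 2 = (J.1 * J.2 %/ 2)%Z%:~R.
Proof.
have hn := jacobi_norm p_pr p1 j2.
have [b hb] := dvdzP (jacobi_im_even j p_pr p1).
have oA := jacobi_re_odd.
have [a ha] : exists a, J.1 = 2 * a + 1 by exists (J.1 %/ 2)%Z; lia.
have hA := gev_root_re (jacobi_root p_pr p1 j2).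
have oAB : odd `|J.1 + J.2| by lia.
have A0 : ~~ (p %| `|J.1|)%N.
  apply/negP => /dvdnP[c hc]; have : J.1 ^+ 2 = (c%:Z ^+ 2 * p%:Z) * p%:Z.
    have -> : J.1 ^+ 2 = `|J.1|%N%:Z ^+ 2 by lia.
    by rewrite hc PoszM; ring.
  have : J.1 ^+ 2 <= p by rewrite -hn /gnorm lerDl sqr_ge0.
  move=> + hh; rewrite {}hh; have := prime_gt1 p_pr.
  have [c0|c0] := posnP c; first by move: hc oA; rewrite c0 => ->.
  by nia.
have F2 := Fp_two_neq0 p_pr p1.
have nA : (J.1%:~R : 'F_p) != 0 by rewrite Fp_int0.
have j0 := i_neq0 j2.
have sq : ((J.1 + J.2)%:~R : 'F_p) ^+ 2 = 2 * (J.1%:~R ^+ 2 * j).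
  rewrite intrD hA; move: (J.2%:~R : 'F_p) => B.
  have -> : (- (B * j) + B) ^+ 2 = B ^+ 2 * (1 - 2 * j + j ^+ 2) by ring.
  have -> : 2 * ((- (B * j)) ^+ 2 * j) = 2 * (B ^+ 2 * j ^+ 2 * j) by ring.
  by rewrite j2; ring.
have nAB : ((J.1 + J.2)%:~R : 'F_p) != 0.
  by rewrite -sqrf_eq0 sq !mulf_neq0 // expf_neq0.
have : ind ((J.1 + J.2)%:~R) *+ 2 = ind 2 + (ind J.1%:~R *+ 2 + ind j).
  rewrite mulr2n -(ind4M p_pr p1 j2) // -expr2 sq.
  by rewrite !(ind4M p_pr p1 j2) ?mulf_neq0 ?expf_neq0 // mulr2n.
have -> : ind j = (p %/ 4)%:R.
  by apply: (i_exp_inj j2 F2); rewrite (ind4_exp p_pr p1 j2) // i_expn_mod4.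
have even0 (x : int) : (b * 2 * x)%:~R *+ 2 = 0 :> 'Z_4.
  by rewrite -rmorphMn -[RHS]/(0%:~R); apply: Z4_int_eq; lia.
have -> : ind J.1%:~R *+ 2 = 0.
  have gJ : gcop `|J.1| J by rewrite gcop_jacobi.
  by rewrite ind4_odd // mulrnDl {1}hb even0 add0r qsym_re.
have -> : ind (J.1 + J.2)%:~R *+ 2 = (((J.1 + J.2) ^+ 2 - 1) %/ 4)%Z%:~R.
  have gJ : gcop `|J.1 + J.2| J by rewrite gcop_jacobi -Fp_int0.
  by rewrite ind4_odd // mulrnDl {1}hb even0 add0r qsym_re_im.
rewrite add0r => h; apply: (addIr (p %/ 4)%:R); rewrite -h [(p %/ 4)%:R]pmulrn -intrD.
have e : (J.1 + J.2) ^+ 2 = p%:Z + 2 * (J.1 * J.2) by rewrite -hn /gnorm; ring.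
apply: Z4_int_eq; rewrite e; have -> : J.1 * J.2 = J.1 * b * 2 by rewrite hb; ring.
by move: (J.1 * b) => u; lia.
Qed.

End JacobiSymbol.

Section PrimeModulus.

Variables (p : nat) (j : 'F_p).
Hypothesis p_pr : prime p.
Hypothesis p1 : (p %% 4 = 1)%N.
Hypothesis j2 : j ^+ 2 = -1.

Local Notation ind := (ind4 j).
Local Notation J := (jacobi ind).

Lemma ind4_recip_sym e m : odd `|m| -> gcop `|m| J -> ind (2 ^+ e * m%:~R) = recip_sym e m J.
Proof.
move=> om cm; have F2 := Fp_two_neq0 p_pr p1.
have m0 : (m%:~R : 'F_p) != 0 by rewrite Fp_int0 // -(gcop_jacobi p_pr p1 j2).
rewrite (ind4M p_pr p1 j2) ?expf_neq0 // ind4_odd // addrA; congr (_ + _ + _).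
elim: e => [|e IHe]; first by rewrite expr0 (ind_1 (ind4M p_pr p1 j2)).
by rewrite exprS (ind4M p_pr p1 j2) ?expf_neq0 // IHe ind4_2 // [RHS]mulrS.
Qed.

(** The product of z by the conjugate of J vanishes at both square roots of -1,
    so its coordinates are divisible by p, which is the norm of J. *)
Lemma jacobi_dvd z : gev j z = 0 -> (2 %| z.2)%Z ->
  exists2 w, z = gmul J w & (2 %| w.2)%Z.
Proof.
have jJ := jacobi_root p_pr p1 j2; have nJ := jacobi_norm p_pr p1 j2.
have [b hb] := dvdzP (jacobi_im_even j p_pr p1).
move: jJ nJ b hb; move: J => [A B] /= jJ nJ b hb jz /dvdzP[c hc].
have p0 : (p : int) != 0 by rewrite -[0]/(0%N%:Z) eqz_nat -lt0n prime_gt0.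
have root (u v : int) : gev j (u, v) = 0 -> u%:~R = - (v%:~R * j) :> 'F_p.
  by move/eqP; rewrite /gev addr_eq0 => /eqP.
have rJ := root _ _ jJ.
have rz : z.1%:~R = - (z.2%:~R * j) :> 'F_p by apply: root; case: (z) jz.
have dvd_p (u : int) : u%:~R = 0 :> 'F_p -> exists v : int, u = v * p%:Z.
  by move/eqP; rewrite Fp_int0 // => h; have h' : (p%:Z %| u)%Z := h; exact/dvdzP.
have [u hu] : exists u : int, z.1 * A + z.2 * B = u * p%:Z.
  apply: dvd_p; rewrite intrD !intrM rJ rz.
  have -> : - (z.2%:~R * j) * - (B%:~R * j) = z.2%:~R * B%:~R * j ^+ 2 :> 'F_p by ring.
  by rewrite j2; ring.
have [v hv] : exists v : int, z.2 * A - z.1 * B = v * p%:Z.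
  by apply: dvd_p; rewrite intrB !intrM rJ rz; ring.
rewrite /gnorm /= in nJ.
exists (u, v).
  rewrite /gmul /=; case: z hu hv {jz rz hc} => x y /= hu hv; congr (_, _); apply: (mulIf p0).
    transitivity (A * (u * p%:Z) - B * (v * p%:Z)); last by ring.
    by rewrite -hu -hv -nJ; ring.
  transitivity (A * (v * p%:Z) + B * (u * p%:Z)); last by ring.
  by rewrite -hu -hv -nJ; ring.
move: hv; rewrite /= hc hb => hv.
have op : exists k : int, p = 4 * k + 1 :> int by exists (p %/ 4)%N; lia.
case: op => k hk; rewrite hk in hv.
have e : v = (c * A - z.1 * b - v * 2 * k) * 2 by move: hv; lia.
by rewrite e dvdz_mull.
Qed.

End PrimeModulus.

Lemma Euclid_z (r : nat) (a b : int) : prime r -> (r %| a * b)%Z = (r %| a)%Z || (r %| b)%Z.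
Proof. by move=> r_pr; rewrite !dvdzE abszM Euclid_dvdM. Qed.

Lemma Euclid_sq (r : nat) (a : int) : prime r -> (r %| a ^+ 2)%Z = (r %| a)%Z.
Proof. by move=> r_pr; rewrite expr2 Euclid_z // orbb. Qed.

(** The quotient [j = - z.1 / z.2] is a square root of -1 modulo q; then [q = 3
    (mod 4)] is impossible, as [j ^+ q] would be [- j]. *)
Lemma split_prime z (q : nat) : ~~ (q %| z.2)%Z -> prime q -> odd q -> (q %| gnorm z)%Z ->
  (q %% 4 = 1)%N /\ exists2 j : 'F_q, j ^+ 2 = -1 & gev j z = 0.
Proof.
move=> qz2 q_pr oq qz; have qc := pchar_Fp q_pr.
have z2 : (z.2%:~R : 'F_q) != 0 by rewrite -(dvdz_pcharf qc).
pose j : 'F_q := - (z.1%:~R / z.2%:~R).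
have j2 : j ^+ 2 = -1.
  rewrite /j sqrrN expr_div_n; apply: (mulIf (expf_neq0 2 z2)).
  rewrite divfK ?expf_neq0 // mulN1r; apply/eqP; rewrite -addr_eq0.
  by rewrite -!rmorphXn -intrD -(dvdz_pcharf qc).
split; last by exists j; rewrite // /gev /j mulrN mulrC divfK // subrr.
have [//|q3] : (q %% 4 = 1)%N \/ (q %% 4 = 3)%N by lia.
have e : q = ((q %/ 4 * 4) + 3)%N by lia.
have jq : j ^+ q = j by have := expf_card j; rewrite card_Fp.
have : j ^+ (q %/ 4 * 4 + 3) = j by rewrite -e.
rewrite exprD mulnC exprM (i4 j2) expr1n mul1r exprSr j2 mulN1r => h.
exfalso; have : (2 : 'F_q) * j == 0 by rewrite mulr_natl mulr2n -{1}h addNr.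
rewrite mulf_eq0 (negPf (i_neq0 j2)) orbF -(dvdn_pcharf qc) dvdn_prime2 //.
by move/eqP => q2; rewrite q2 in oq.
Qed.

Lemma recip_sym_unit e m z : odd `|m| -> gnorm z = 1 -> (2 %| z.2)%Z -> recip_sym e m z = 0.
Proof.
case: z => a b om; rewrite /gnorm /= => h b2.
have b0 : b = 0.
  case/dvdzP: b2 => c bc; rewrite bc in h *.
  have [->|c0] := eqVneq c 0; first by rewrite mul0r.
  have : 0 <= a ^+ 2 by rewrite sqr_ge0.
  by move: c0 h; nia.
have a1 : `|a|%N = 1%N by rewrite b0 in h; nia.
rewrite /recip_sym b0 /= mulr0 div0z mul0r mul0rn !add0r qsym_rat //.
by rewrite a1 coprimen1.
Qed.

Lemma primitive_odd z : (2 %| z.2)%Z -> gcdz z.1 z.2 = 1 -> odd `|z.1|.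
Proof.
move=> ez cz; have [//|o] := boolP (odd `|z.1|).
have : (2 %| gcdz z.1 z.2)%Z by rewrite dvdz_gcd ez andbT; lia.
by rewrite cz.
Qed.

(** For a Jacobi sum J of norm q the symbol is the quartic character of the
    residue field F_q, hence periodic modulo q.  A prime divisor q of the norm of
    z provides such a J dividing z, and the norm decreases until z is a unit. *)
Theorem recip_sym_periodic z e f m n :
  (2 %| z.2)%Z -> gcdz z.1 z.2 = 1 -> odd `|m| -> odd `|n| ->
  gcop `|m| z -> gcop `|n| z -> (gnorm z %| 2 ^+ e * m - 2 ^+ f * n)%Z ->
  recip_sym e m z = recip_sym f n z.
Proof.
move=> + + om on; have [N] := ubnP `|gnorm z|.
elim: N z => // N IHN z hN ez cz mz nz hz.
have oz1 := primitive_odd ez cz.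
have norm0 : 0 <= gnorm z by rewrite addr_ge0 // sqr_ge0.
have oN : odd `|gnorm z|.
  case/dvdzP: ez => c hc; have [a ha] : exists a, z.1 = 2 * a + 1 by exists (z.1 %/ 2)%Z; lia.
  by rewrite /gnorm ha hc; lia.
have [n1|n1] := leqP `|gnorm z|%N 1.
  have z1 : gnorm z = 1 by lia.
  by rewrite !recip_sym_unit.
have q_pr := pdiv_prime n1; set q := pdiv _ in q_pr.
have qz : (q %| gnorm z)%Z by exact: pdiv_dvd.
have oq : odd q by exact: odd_dvd oN _.
have qz2 : ~~ (q %| z.2)%Z.
  apply/negP => q2; move: qz; rewrite /gnorm rpredDr ?Euclid_sq // => q1.
  have : (q %| gcdz z.1 z.2)%Z by rewrite dvdz_gcd q1.
  by rewrite cz dvdz1 /= => /eqP e1; rewrite e1 in q_pr.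
have [q1 [j j2 jz]] := split_prime qz2 q_pr oq qz.
have [w zw ew] := jacobi_dvd q_pr q1 j2 jz ez.
have nzw : gnorm z = q%:Z * gnorm w by rewrite zw gnormM (jacobi_norm q_pr q1 j2).
have cw : gcdz w.1 w.2 = 1.
  have d1 : (gcdz w.1 w.2 %| gcdz z.1 z.2)%Z.
    rewrite dvdz_gcd zw /=; apply/andP; split.
      by rewrite rpredB // dvdz_mull // ?dvdz_gcdl ?dvdz_gcdr.
    by rewrite rpredD // dvdz_mull // ?dvdz_gcdl ?dvdz_gcdr.
  by move: d1; rewrite cz dvdz1 => /eqP h; rewrite -[LHS]gez0_abs ?h.
have [mJ mw] : gcop `|m| (jacobi (ind4 j)) /\ gcop `|m| w.
  by apply/andP; rewrite -gcopM -zw.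
have [nJ nw] : gcop `|n| (jacobi (ind4 j)) /\ gcop `|n| w.
  by apply/andP; rewrite -gcopM -zw.
have oJ := jacobi_re_odd q_pr q1 j2.
have eJ := jacobi_im_even j q_pr q1.
have ow1 := primitive_odd ew cw.
rewrite zw !recip_symM //; congr (_ + _).
  rewrite -(ind4_recip_sym q_pr q1 j2 _ om mJ) -(ind4_recip_sym q_pr q1 j2 _ on nJ).
  congr (ind4 j _).
  apply/eqP; rewrite -subr_eq0.
  have -> : 2 ^+ e * m%:~R - 2 ^+ f * n%:~R = (2 ^+ e * m - 2 ^+ f * n)%:~R :> 'F_q.
    by rewrite intrB !intrM !rmorphXn.
  by rewrite -(dvdz_pcharf (pchar_Fp q_pr)); apply: dvdz_trans hz.
apply: IHN => //.
  have e1 : `|gnorm z|%N = (q * `|gnorm w|)%N by rewrite nzw abszM.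
  have w0 : (0 < `|gnorm w|)%N by move: n1; rewrite e1; case: `|_|%N => [|//]; rewrite muln0.
  by rewrite -ltnS; apply: leq_trans hN; rewrite ltnS e1 ltn_Pmull // prime_gt1.
by apply: dvdz_trans hz; rewrite nzw dvdz_mull.
Qed.

(** The quotient of [c + d i] by the Jacobi sum vanishing at the same [j] is a unit. *)
Lemma ind4_value (p : nat) (c d : int) e (m : int) :
  prime p -> (p %% 4 = 1)%N -> p%:Z = c ^+ 2 + d ^+ 2 -> (2 %| d)%Z ->
  odd `|m| -> ~~ (p %| m)%Z ->
  (2 ^+ e * m%:~R : 'F_p) ^+ (p %/ 4) = (d%:~R / c%:~R) ^+ recip_sym e m (c, d).
Proof.
move=> p_pr p1 pcd ed om pm; have qc := pchar_Fp p_pr.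
have F2 := Fp_two_neq0 p_pr p1.
have cd0 : (c%:~R : 'F_p) ^+ 2 + d%:~R ^+ 2 = 0.
  rewrite -!rmorphXn -intrD -pcd; exact: pchar_Fp_0.
have c0 : (c%:~R : 'F_p) != 0.
  apply/negP => c0; have d0 : (d%:~R : 'F_p) == 0.
    by rewrite -sqrf_eq0 -cd0 (eqP c0) expr0n add0r.
  move: c0 d0; rewrite -!(dvdz_pcharf qc) => /dvdzP[a ha] /dvdzP[b hb].
  move: pcd; rewrite ha hb.
  have p0 : (p : int) != 0 by rewrite -[0]/(0%N%:Z) eqz_nat -lt0n prime_gt0.
  have -> : (a * p) ^+ 2 + (b * p) ^+ 2 = ((a ^+ 2 + b ^+ 2) * p) * p by ring.
  rewrite -[LHS]mul1r => /(mulIf p0) h.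
  have : (p%:Z %| 1%R)%Z by rewrite h dvdz_mull.
  by rewrite dvdz1 => /eqP p11; move: p_pr; rewrite -[p]/(`|p%:Z|%N) p11.
set j := (_ / _).
have j2 : j ^+ 2 = -1.
  rewrite /j expr_div_n; apply: (mulIf (expf_neq0 2 c0)); rewrite divfK ?expf_neq0 //.
  by rewrite mulN1r; apply/eqP; rewrite -addr_eq0 addrC cd0.
have jz : gev j (c, d) = 0.
  transitivity ((c%:~R ^+ 2 + d%:~R ^+ 2) / c%:~R : 'F_p); last by rewrite cd0 mul0r.
  by rewrite /gev /= /j; field.
have [w zw ew] := jacobi_dvd p_pr p1 j2 jz ed.
have gn : gnorm (c, d) = p by rewrite /gnorm pcd.
have nJ := jacobi_norm p_pr p1 j2.
have nw : gnorm w = 1.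
  have := gn; rewrite zw gnormM nJ -[RHS]mulr1 => /mulfI; apply.
  by rewrite -[0]/(0%N%:Z) eqz_nat -lt0n prime_gt0.
have gm : gcop `|m| (c, d) by rewrite /gcop gn coprime_sym prime_coprime.
have [gJ gw] : gcop `|m| (jacobi (ind4 j)) /\ gcop `|m| w.
  by apply/andP; rewrite -gcopM -zw.
have eJ := jacobi_im_even j p_pr p1.
have ow : odd `|w.1|.
  case/dvdzP: ew nw => k hk; rewrite /gnorm hk.
  have [//|o] := boolP (odd `|w.1|); have [l ->] : exists l, w.1 = 2 * l by exists (w.1 %/
    2)%Z; lia.
  by lia.
rewrite zw recip_symM ?jacobi_re_odd // (recip_sym_unit _ om nw ew) addr0.
rewrite -(ind4_recip_sym p_pr p1 j2 e om gJ) (ind4_exp p_pr p1 j2) // mulf_neq0 ?expf_neq0 //.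
by rewrite -(dvdz_pcharf qc).
Qed.

(** * Two rational integers with sum the norm of a Gaussian integer *)

Lemma odd_prime_dvd2 (r : nat) : prime r -> odd r -> (r %| 2)%Z = false.
Proof.
move=> r_pr r_odd; rewrite dvdzE /= dvdn_prime2 //.
by apply/eqP => r2; rewrite r2 in r_odd.
Qed.

Lemma coprime_primes (m n : nat) : (0 < m)%N ->
  (forall r, prime r -> (r %| m)%N -> (r %| n)%N -> False) -> coprime m n.
Proof.
move=> m0 h; rewrite /coprime; apply/eqP.
have g0 : (0 < gcdn m n)%N by rewrite gcdn_gt0 m0.
have [g1|g1] := leqP (gcdn m n) 1; first by apply/eqP; rewrite eqn_leq g1.
have := pdiv_dvd (gcdn m n); rewrite dvdn_gcd => /andP[h1 h2].
by case: (h _ (pdiv_prime g1) h1 h2).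
Qed.

Lemma gcop_primes (m : int) z : odd `|m| ->
  (forall r : nat, prime r -> odd r -> (r %| m)%Z -> (r %| gnorm z)%Z -> False) -> gcop `|m| z.
Proof.
move=> om h; apply: coprime_primes; first exact: odd_gt0.
by move=> r r_pr rm; apply: h => //; exact: odd_dvd om rm.
Qed.

(** -1 is not a square modulo 11. *)
Lemma eleven_sum2 (u v : int) : (11 %| u ^+ 2 + v ^+ 2)%Z -> (11 %| u)%Z && (11 %| v)%Z.
Proof.
move=> h; have p11 : prime 11 by [].
have [v11|v11] := boolP (11 %| v)%Z; last by have [] := @split_prime (u, v) 11 v11 p11 isT h.
by move: h; rewrite rpredDr ?(@Euclid_sq 11) // => ->.
Qed.

Lemma odd_sq (n : int) : odd `|n| -> exists k, n ^+ 2 = 8 * k + 1.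
Proof.
move=> /odd_star [m [t [-> hn]]]; exists (2 * t ^+ 2 + t).
by case: hn => ->; ring.
Qed.

Lemma odd_int (n : int) : odd `|n| -> exists k, n = 2 * k + 1.
Proof. by move=> on; exists (n %/ 2)%Z; lia. Qed.

(** Here and in [Z4_sign], [Z4_sq], [Z4_half_diff], [Z4_sign_diff]: the terms
    coming from 2 and -1 do not change when an odd common factor of the
    coordinates of z is removed, since odd squares are 1 modulo 8. *)
Lemma Z4_half_mul (g a b : int) : odd `|g| -> (2 %| b)%Z ->
  (a * b %/ 2)%Z%:~R = (g * a * (g * b) %/ 2)%Z%:~R :> 'Z_4.
Proof.
move=> /odd_sq[k hk] /dvdzP[c ->].
have -> : g * a * (g * (c * 2)) = (g ^+ 2 * a * c) * 2 by ring.
by rewrite mulrA !mulzK // hk; apply: Z4_int_eq; lia.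
Qed.

Lemma Z4_sign (g e b n : int) : odd `|g| -> odd `|e| -> odd `|n| -> (2 %| b)%Z ->
  (b * ((n - 1) %/ 2)%Z)%:~R = ((g * b %/ 2)%Z * (e ^+ 2 * n - 1))%:~R :> 'Z_4.
Proof.
move=> /odd_int[k ->] /odd_sq[l ->] /odd_int[u ->] /dvdzP[c ->].
have -> : (2 * k + 1) * (c * 2) = ((2 * k + 1) * c) * 2 by ring.
rewrite mulzK // addrK mulKz //; apply: Z4_int_eq.
apply/dvdzP; exists (- k * c * u - 2 * (2 * k + 1) * c * l * (2 * u + 1)); ring.
Qed.

Lemma Z4_sq (e n : int) : odd `|e| -> odd `|n| ->
  ((n ^+ 2 - 1) %/ 4)%Z%:~R = (((e ^+ 2 * n) ^+ 2 - 1) %/ 4)%Z%:~R :> 'Z_4.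
Proof.
move=> /odd_sq[l hl] /odd_sq[m hm]; rewrite exprMn hl hm.
have -> : (8 * l + 1) ^+ 2 * (8 * m + 1) - 1 =
  (2 * m + 4 * (4 * l ^+ 2 + l) * (8 * m + 1)) * 4 by ring.
have -> : 8 * m + 1 - 1 = (2 * m) * 4 by ring.
by rewrite !mulzK //; apply: Z4_int_eq; lia.
Qed.

Lemma Z4_sign11 (b y : int) : odd `|y| -> (2 %| b)%Z ->
  (b * ((- (11 * y ^+ 2) - 1) %/ 2)%Z)%:~R = 0 :> 'Z_4.
Proof.
move=> /odd_sq[n ->] /dvdzP[c ->].
have -> : - (11 * (8 * n + 1)) - 1 = (- 44 * n - 6) * 2 by ring.
by rewrite mulzK //; apply: (Z4_int_eq (n := 0)); lia.
Qed.

Lemma Z4_half_diff (g a t : int) : odd `|g| ->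
  ((a + 2 * t) * (2 * t) %/ 2)%Z%:~R =
  (((g * (a + 4 * t)) ^+ 2 - (g * a) ^+ 2) %/ 8)%Z%:~R :> 'Z_4.
Proof.
move=> /odd_sq[k hk].
have -> : (g * (a + 4 * t)) ^+ 2 - (g * a) ^+ 2 = (g ^+ 2 * (t * (a + 2 * t))) * 8 by ring.
have -> : (a + 2 * t) * (2 * t) = (t * (a + 2 * t)) * 2 by ring.
by rewrite !mulzK // hk; apply: Z4_int_eq; lia.
Qed.

Lemma Z4_sign_diff (g e a t n : int) : odd `|g| -> odd `|e| -> odd `|n| ->
  (2 * t * ((n - 1) %/ 2)%Z)%:~R =
  (((g * (a + 4 * t) - g * a) %/ 2)%Z * ((e ^+ 2 * n - 1) %/ 2)%Z)%:~R :> 'Z_4.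
Proof.
move=> /odd_int[k ->] /odd_sq[l ->] /odd_int[u ->].
have -> : (2 * k + 1) * (a + 4 * t) - (2 * k + 1) * a = ((2 * k + 1) * (2 * t)) * 2 by ring.
have -> : (8 * l + 1) * (2 * u + 1) - 1 = (8 * l * u + 4 * l + u) * 2 by ring.
rewrite addrK mulKz // !mulzK //; apply: Z4_int_eq; apply/dvdzP.
exists (- t * k * u - 2 * t * (2 * k + 1) * (2 * l * u + l)); ring.
Qed.

Section SumOfTwo.

Variables X Y U V : int.
Local Notation A := (X + U).
Hypothesis sq_free : forall r : nat, prime r -> odd r ->
  (r%:Z ^+ 2 %| U ^+ 2 + V ^+ 2)%Z -> False.
Hypothesis UV_XY : U ^+ 2 + V ^+ 2 = X ^+ 2 + 11 * Y ^+ 2.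
Hypothesis X_odd : odd `|X|.
Hypothesis A_odd : odd `|A|.
Hypothesis not11 : ~~ ((11 %| A) && (11 %| V))%Z.

Let g := gcdz A V.
Let e := gcdz g Y.

Lemma dvd_sq (r : nat) (a b : int) : (r %| a)%Z -> (r %| b)%Z -> (r%:Z ^+ 2 %| a ^+ 2 + b
  ^+ 2)%Z.
Proof.
by move=> /dvdzP[k ->] /dvdzP[l ->]; rewrite !exprMn -mulrDl dvdz_mull.
Qed.

Lemma not_dvd_UV (r : nat) : prime r -> odd r -> (r %| U)%Z -> (r %| V)%Z -> False.
Proof. by move=> r_pr r_odd rU rV; apply: (sq_free r_pr r_odd); exact: dvd_sq. Qed.

Lemma not_dvd_XY (r : nat) : prime r -> odd r -> (r %| X)%Z -> (r %| Y)%Z -> False.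
Proof.
move=> r_pr r_odd /dvdzP[k hk] /dvdzP[l hl]; apply: (sq_free r_pr r_odd).
rewrite UV_XY hk hl; apply/dvdzP; exists (k ^+ 2 + 11 * l ^+ 2); ring.
Qed.

(** The integer [z = A + V i] need not be primitive.  Let g be the gcd of its
    coordinates and [e = gcd(g, Y)], [g = e f].  From
    [11 Y^2 = V^2 - A^2 + 2 U A] the square of e divides A, because e is prime
    to [2 U]; and [A' = A / e^2] is prime to f, because a common prime factor
    would divide [11 Y'^2].  Dividing by [e^2] gives
    [2 X A' + 11 Y'^2 = f^2 (a^2 + b^2)], which replaces the equation for N(z). *)
Lemma gcd_removal : exists e f a b A' Y' : int,
  [/\ A = e * f * a, V = e * f * b, A = e ^+ 2 * A', Y = e * Y' & (A' %| a)%Z] /\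
  [/\ gcdz a b = 1, odd `|e * f|, coprimez f Y' & ~~ (11 %| e * f)%Z].
Proof.
have A0 : A != 0 by apply: contraTneq A_odd => ->.
have g0 : g != 0 by rewrite /g gcdz_eq0 (negPf A0).
have og : odd `|g|.
  by have /dvdzP[k hk] : (g %| A)%Z by [exact: dvdz_gcdl]; move: A_odd; rewrite hk abszM
    oddM => /andP[].
have [f hf] : exists f, g = f * e by apply/dvdzP; exact: dvdz_gcdl.
have [Y' hY] : exists Y', Y = Y' * e by apply/dvdzP; exact: dvdz_gcdr.
have [a ha] : exists a, A = a * g by apply/dvdzP; exact: dvdz_gcdl.
have [b hb] : exists b, V = b * g by apply/dvdzP; exact: dvdz_gcdr.
have ef : e * f = g by rewrite hf mulrC.
have e0 : e != 0 by apply: contraNneq g0 => e0; rewrite hf e0 mulr0.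
have g11 : ~~ (11 %| g)%Z by rewrite dvdz_gcd.
have coef (s t u : int) : u != 0 -> `|u|%N = u :> int ->
    u = gcdz (s * u) (t * u) -> gcdz s t = 1.
  rewrite -mulz_gcdl => u0 eu; rewrite eu -{1}[u]mul1r => h.
  by symmetry; exact: mulIf u0 _ _ h.
have eg : `|g|%N = g :> int by [].
have ee : `|e|%N = e :> int by [].
have cab : gcdz a b = 1 by apply: (coef _ _ g); rewrite // -ha -hb.
have cfY : coprimez f Y'.
  by rewrite /coprimez; apply/eqP; apply: (coef _ _ e); rewrite // -hf -hY.
have g_dvd (r : nat) : (r %| g)%Z -> prime r -> [/\ odd r, (r %| A)%Z & (r %| V)%Z].
  by rewrite dvdz_gcd => /andP[h1 h2]; split => //; exact: odd_dvd A_odd _.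
have eU : coprimez (e ^+ 2) (2 * U).
  apply: coprimezXl; apply: coprime_primes => [|r r_pr re r2U].
    by rewrite absz_gt0.
  have [|ro rA rV] := g_dvd r _ r_pr.
    by apply: (@dvdz_trans e r g re); exact: dvdz_gcdl.
  have : (r %| 2 * U)%Z by []; rewrite Euclid_z // => /orP[r2|rU].
    by rewrite odd_prime_dvd2 in r2.
  exact: not_dvd_UV rU rV.
have eqA : 2 * U * A = 11 * Y ^+ 2 - V ^+ 2 + A ^+ 2.
  have -> : 11 * Y ^+ 2 = U ^+ 2 + V ^+ 2 - X ^+ 2 by rewrite UV_XY; ring.
  by ring.
have [A' hA] : exists A', A = A' * e ^+ 2.
  apply/dvdzP; rewrite -(Gauss_dvdzr _ eU) eqA.
  rewrite hY hb ha hf; apply/dvdzP.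
  by exists (11 * Y' ^+ 2 - b ^+ 2 * f ^+ 2 + a ^+ 2 * f ^+ 2); ring.
have eq' : 11 * Y' ^+ 2 = 2 * U * A' + (b ^+ 2 * f - a ^+ 2 * f) * f.
  apply: (mulIf (expf_neq0 2 e0)).
  transitivity (11 * Y ^+ 2); first by rewrite hY; ring.
  transitivity (2 * U * (A' * e ^+ 2) + V ^+ 2 - A ^+ 2); first by rewrite -hA eqA; ring.
  by rewrite hb ha hf; ring.
have f0 : f != 0 by apply: contraNneq g0 => f0; rewrite hf f0 mul0r.
have cAf : coprimez A' f.
  rewrite coprimez_sym; apply: coprime_primes => [|r r_pr rf rA]; first by rewrite absz_gt0.
  have rf' : (r %| f)%Z := rf; have rA' : (r %| A')%Z := rA.
  have : (r %| 11 * Y' ^+ 2)%Z by rewrite eq' rpredD // dvdz_mull.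
  rewrite Euclid_z // expr2 Euclid_z // orbb => /orP[r11|rY].
    have er : r = 11%N by apply/eqP; rewrite -dvdn_prime2.
    by move: g11; rewrite hf dvdz_mulr //; move: rf'; rewrite er.
  have : (r %| gcdz f Y')%Z by rewrite dvdz_gcd rf' rY.
  by rewrite (eqP cfY) dvdz1 /= => /eqP r1; rewrite r1 in r_pr.
have Aa : (A' %| a)%Z.
  rewrite -(Gauss_dvdzl _ cAf); apply/dvdzP; exists e; apply: (mulIf e0).
  by rewrite -mulrA -hf -ha hA; ring.
exists e, f, a, b, A', Y'.
by split; split; rewrite ?ef // mulrC.
Qed.

Lemma gcop_X_UV : gcop `|X| (U, V).
Proof.
apply: gcop_primes => // r r_pr r_odd rX; rewrite /gnorm /= => rM.
have : (r %| 11 * Y ^+ 2)%Z.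
  have -> : 11 * Y ^+ 2 = (U ^+ 2 + V ^+ 2) - X ^+ 2 by rewrite UV_XY; ring.
  by rewrite rpredB // Euclid_sq.
rewrite Euclid_z // Euclid_sq // => /orP[r11|rY]; last exact: not_dvd_XY rX rY.
have er : r = 11%N by apply/eqP; rewrite -dvdn_prime2.
by move: rM; rewrite er => /eleven_sum2 /andP[]; exact: (@not_dvd_UV 11).
Qed.

(** The symbols of the primitive part [a + b i] of z are expressed by those of
    [W = U + V i]. *)
Section Reduced.

Variables e' f a b A' Y' : int.
Hypotheses (hA : A = e' * f * a) (hV : V = e' * f * b) (hA2 : A = e' ^+ 2 * A').
Hypotheses (hY : Y = e' * Y') (Aa : (A' %| a)%Z) (cab : gcdz a b = 1).
Hypotheses (oef : odd `|e' * f|) (cfY : coprimez f Y') (ef11 : ~~ (11 %| e' * f)%Z).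

Lemma odd_e' : odd `|e'|. Proof. by move: oef; rewrite abszM oddM => /andP[]. Qed.
Lemma odd_A' : odd `|A'|.
Proof. by move: A_odd; rewrite hA2 abszM oddM => /andP[]. Qed.

Lemma e'_neq0 : e' != 0. Proof. by apply: contraTneq odd_e' => ->. Qed.

Lemma reduced_norm : 2 * X * A' + 11 * Y' ^+ 2 = f ^+ 2 * gnorm (a, b).
Proof.
apply: (mulIf (expf_neq0 2 e'_neq0)).
transitivity (2 * X * A + 11 * Y ^+ 2); first by rewrite hY hA2; ring.
transitivity (A ^+ 2 + V ^+ 2); last by rewrite hA hV /gnorm /=; ring.
have -> : 11 * Y ^+ 2 = U ^+ 2 + V ^+ 2 - X ^+ 2 by rewrite UV_XY; ring.
by ring.
Qed.

Lemma ab_prime (r : nat) : prime r -> (r %| a)%Z -> (r %| gnorm (a, b))%Z -> False.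
Proof.
move=> r_pr ra; rewrite /gnorm /= rpredDl ?Euclid_sq // => rb.
have : (r %| gcdz a b)%Z by rewrite dvdz_gcd ra.
by rewrite cab dvdz1 /= => /eqP r1; rewrite r1 in r_pr.
Qed.

Lemma AV_mul : (A, V) = gmul (e' * f, 0) (a, b).
Proof. by rewrite /gmul /= hV; congr (_, _); rewrite ?hA; ring. Qed.

Lemma X_transfer : gcop `|X| (a, b) /\ qsym `|X| (a, b) = qsym `|X| (U, V).
Proof.
have c1 : (U = (A, V).1 %[mod `|X|])%Z.
  apply: eqz_modP; rewrite /= opprD addrCA subrr addr0.
  by rewrite dvdzE /= abszN.
have gAV := @gcop_congr _ (U, V) (A, V) c1 erefl gcop_X_UV.
rewrite (@qsym_congr _ (U, V) (A, V) c1) // AV_mul in gAV *.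
move: gAV; rewrite gcopM => /andP[h1 h2]; split => //.
by rewrite qsymMr // qsym_rat ?add0r // gcop_nz.
Qed.

(** Modulo [A'], which divides a, the integer [a + b i] is purely imaginary. *)
Lemma A'_transfer : gcop `|A'| (a, b) /\ qsym `|A'| (a, b) = star4 `|A'| *+ 2.
Proof.
have gA : gcop `|A'| (a, b).
  apply: gcop_primes => [|r r_pr _ rA]; first exact: odd_A'.
  by apply: ab_prime => //; exact: dvdz_trans Aa.
have c1 : (a = 0 %[mod `|A'|])%Z.
  by apply: eqz_modP; rewrite subr0; apply: dvdz_trans Aa; rewrite dvdzE.
split=> //; rewrite (@qsym_congr _ (a, b) (0, b)) // qsym_imag ?odd_A' //.
exact: (@gcop_congr _ (a, b)).
Qed.

Lemma Y'_gcop (n : int) : odd `|n| -> (n %| Y')%Z -> gcop `|n| (a, b).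
Proof.
move=> on nY; apply: gcop_primes => // r r_pr r_odd rn rN.
have rY : (r %| Y')%Z := dvdz_trans rn nY.
have : (r %| 2 * X * A')%Z.
  have -> : 2 * X * A' = f ^+ 2 * gnorm (a, b) - 11 * Y' * Y' by rewrite -reduced_norm; ring.
  by rewrite rpredB // dvdz_mull.
rewrite !Euclid_z // odd_prime_dvd2 //= => /orP[rX|rA].
  by apply: (not_dvd_XY r_pr r_odd rX); rewrite hY dvdz_mull.
by apply: (ab_prime r_pr _ rN); exact: dvdz_trans Aa.
Qed.

(** The identity [z^2 = 2 A W - 11 Y^2] divided by [e'^2] reads
    [f^2 (a + b i)^2 = 2 A' W - 11 Y'^2]. *)
Lemma Y'_transfer (n : int) : odd `|n| -> (n %| Y')%Z ->
  qsym `|n| (a, b) *+ 2 = qsym `|n| (U, V).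
Proof.
move=> on nY; have gn := Y'_gcop on nY.
pose z := gmul (f ^+ 2, 0) (gmul (a, b) (a, b)); pose w := gmul (2 * A', 0) (U, V).
have e2 := expf_neq0 2 e'_neq0.
have h1 : z.1 - w.1 = - (11 * Y' * Y').
  apply: (mulIf e2); rewrite /z /w /=.
  transitivity (A ^+ 2 - V ^+ 2 - 2 * A * U).
    by rewrite hV {1}hA hA2; ring.
  transitivity (- (11 * Y ^+ 2)); last by rewrite hY; ring.
  have -> : 11 * Y ^+ 2 = U ^+ 2 + V ^+ 2 - X ^+ 2 by rewrite UV_XY; ring.
  by ring.
have h2 : z.2 = w.2.
  apply: (mulIf e2); rewrite /z /w /=.
  transitivity (2 * A * V); first by rewrite hV hA; ring.
  by rewrite hA2; ring.
have c1 : (z.1 = w.1 %[mod `|n|])%Z.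
  apply: eqz_modP; rewrite h1 dvdzE abszN; change ((n %| 11 * Y' * Y')%Z).
  by rewrite dvdz_mull.
have c2 : (z.2 = w.2 %[mod `|n|])%Z by rewrite h2.
have gf : gcop `|n| (f ^+ 2, 0).
  rewrite gcop_rat; change (coprimez n (f ^+ 2)); apply: coprimezXr.
  by rewrite coprimez_sym; apply: coprimez_dvdr cfY; rewrite dvdzE in nY.
have gz : gcop `|n| z by rewrite !gcopM gf gn.
have := gcop_congr c1 c2 gz; rewrite gcopM => /andP[gA gU].
have := qsym_congr c1 c2; rewrite !qsymMr ?gcopM ?gn //.
by rewrite !qsym_rat ?gcop_nz // !add0r mulr2n.
Qed.

(** Modulo [e'], which divides V, the integer [W] is rational. *)
Lemma e'_transfer : qsym `|e'| (U, V) = 0.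
Proof.
have c2 : (V = 0 %[mod `|e'|])%Z.
  by apply: eqz_modP; rewrite subr0 hV -mulrA dvdz_mulr // dvdzE.
rewrite (@qsym_congr _ (U, V) (U, 0)) // qsym_rat ?odd_e' //.
apply: coprime_primes => [|r r_pr re rU]; first by rewrite absz_gt0 e'_neq0.
apply: (@not_dvd_UV r r_pr _ rU); first exact: odd_dvd odd_e' re.
by rewrite hV -mulrA; apply: dvdz_mulr.
Qed.

Lemma eleven_transfer : gcop 11 (a, b) /\ qsym 11 (a, b) = qsym 11 (A, V).
Proof.
have g11 : gcop 11 (a, b).
  rewrite /gcop prime_coprime //; apply/negP => h.
  have /andP[h1 h2] := @eleven_sum2 a b h.
  exact: (@ab_prime 11 _ h1 h).
split=> //; rewrite AV_mul qsymMr // ?gcop_rat ?prime_coprime //.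
by rewrite qsym_rat ?add0r // prime_coprime.
Qed.

End Reduced.

Lemma qsym_absM (m n : int) z : odd `|m| -> odd `|n| ->
  qsym `|m * n| z = qsym `|m| z + qsym `|n| z.
Proof. by move=> om on; rewrite abszM qsymMl ?odd_gt0. Qed.

Lemma qsym_11sq (y : int) z : odd `|y| -> qsym `|- (11 * y ^+ 2)| z = qsym 11 z + qsym `|y|
  z *+ 2.
Proof.
by move=> oy; rewrite abszN qsym_absM ?expr2 ?qsym_absM ?mulr2n // abszM oddM oy.
Qed.

(** Periodicity over [a + b i] for [2 X A'] and [- 11 Y'^2], where both X and Y are odd
    and V is even. *)
Lemma qsym_diff_odd : (2 %| V)%Z -> odd `|Y| ->
  qsym `|X| (U, V) - qsym `|Y| (U, V) =
  qsym 11 (A, V) - (A * V %/ 2)%Z%:~R - ((V %/ 2)%Z * (X * A - 1))%:~R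
    - ((A ^+ 2 - 1) %/ 4)%Z%:~R.
Proof.
move=> V_even Y_odd.
have [e' [f [a [b [A' [Y' [[hA hV hA2 hY Aa] [cab oef cfY ef11]]]]]]]] := gcd_removal.
have oe := odd_e' oef; have oA := odd_A' hA2.
have oY : odd `|Y'| by move: Y_odd; rewrite hY abszM oddM => /andP[].
have eb : (2 %| b)%Z.
  by move: V_even; rewrite hV Euclid_z // => /orP[|//]; move: oef; clear; lia.
have [gX qX] := X_transfer hA hV.
have [gA qA] := A'_transfer hA2 Aa cab.
have gY := Y'_gcop hA hV hA2 hY Aa cab oef oY (dvdzz _).
have qY := Y'_transfer hA hV hA2 hY Aa cab oef cfY oY (dvdzz _).
have qe := e'_transfer hV oef.
have [g11 q11] := eleven_transfer hA hV cab ef11.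
have nE := reduced_norm hA hV hA2 hY oef.
have oXA : odd `|X * A'| by rewrite abszM oddM X_odd.
have oY2 : odd `|- (11 * Y' ^+ 2)| by rewrite abszN abszM abszX oddM oddX oY.
have gXA : gcop `|X * A'| (a, b) by rewrite /gcop abszM coprimeMl; apply/andP.
have gY2 : gcop `|- (11 * Y' ^+ 2)| (a, b).
  by rewrite abszN abszM abszX /gcop coprimeMl coprimeXl // andbT.
have dN : (gnorm (a, b) %| 2 ^+ 1 * (X * A') - 2 ^+ 0 * - (11 * Y' ^+ 2))%Z.
  have -> : 2 ^+ 1 * (X * A') - 2 ^+ 0 * - (11 * Y' ^+ 2) = 2 * X * A' + 11 * Y' ^+ 2 by ring.
  by rewrite nE dvdz_mull.
have h := @recip_sym_periodic (a, b) 1 0 _ _ eb cab oXA oY2 gXA gY2 dN.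
move: h; rewrite /recip_sym qsym_absM // qsym_11sq // qX qA qY q11 mulr1n mulr0n add0r /=.
have -> : qsym `|Y| (U, V) = qsym `|Y'| (U, V) by rewrite hY qsym_absM // qe add0r.
rewrite (Z4_half_mul a oef eb) -hA -hV (Z4_sign oef oe oXA eb) -hV.
have -> : e' ^+ 2 * (X * A') = X * A by rewrite hA2; ring.
rewrite star4_sq // (Z4_sq oe oA) -hA2 Z4_sign11 //.
move=> h.
set x := qsym `|X| _ in h *; set q := qsym 11 _ in h *; set y := qsym `|Y'| _ in h *.
set s := (_ %/ 2)%Z%:~R in h *; set t := (_ * _)%:~R in h *; set r := (_ %/ 4)%Z%:~R in h *.
transitivity ((s + t + (x + r)) - s - t - r - y); first by ring.
by rewrite h; ring.
Qed.

(** Here A and V are odd, and [a + b i = (1 + i) z] with [z.2] even because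
    [V = A (mod 4)].  Periodicity is used over z, whose norm is half that of
    [a + b i]. *)
Lemma qsym_diff_even (T : nat) (y0 : int) : Y = 2 ^+ T.+1 * y0 -> odd `|y0| ->
  odd `|V| -> (4 %| V - A)%Z ->
  qsym `|X| (U, V) - qsym `|y0| (U, V) =
  qsym 11 (A, V) - star4 11 + ((V ^+ 2 - A ^+ 2) %/ 8)%Z%:~R *+ T.*2.+1
    - (((V - A) %/ 2)%Z * ((X * A - 1) %/ 2)%Z)%:~R
    + star4 `|X| - star4 `|A| - star4 `|y0| *+ 2.
Proof.
move=> Y_y0 y0_odd V_odd VA4.
have [e' [f [a [b [A' [Y' [[hA hV hA2 hY Aa] [cab oef cfY ef11]]]]]]]] := gcd_removal.
have oe := odd_e' oef; have oA := odd_A' hA2.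
have [y1 hy1] : exists y1, Y' = y1 * 2 ^+ T.+1.
  apply/dvdzP; have c2 : coprimez (2 ^+ T.+1) e'.
    by apply: coprimezXl; rewrite coprimezE coprime2n.
  by rewrite -(Gauss_dvdzr _ c2) -hY Y_y0 dvdz_mulr.
have ey : y0 = e' * y1.
  apply: (mulfI (expf_neq0 T.+1 (isT : (2 : int) != 0))).
  by rewrite -Y_y0 hY hy1; ring.
have oy1 : odd `|y1| by move: y0_odd; rewrite ey abszM oddM => /andP[].
have y1Y : (y1 %| Y')%Z by rewrite hy1 dvdz_mulr.
have [t ht] : exists t, b = a + 4 * t.
  have : (4 %| e' * f * (b - a))%Z by rewrite mulrBr -hA -hV.
  rewrite Gauss_dvdzr => [/dvdzP[t ht]|]; last first.
    by rewrite coprimezE; change (coprime (2 ^ 2) `|e' * f|); apply: coprimeXl; rewrite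
      coprime2n.
  by exists t; rewrite [4 * t]mulrC -ht addrC subrK.
pose z := (a + 2 * t, 2 * t).
have abz : (a, b) = gmul (1, 1) z by rewrite /gmul /z /= ht; congr (_, _); ring.
have ez : (2 %| z.2)%Z by rewrite dvdz_mulr.
have cz : gcdz z.1 z.2 = 1.
  have d1 : (gcdz z.1 z.2 %| gcdz a b)%Z.
    rewrite dvdz_gcd; have [-> ->] : a = z.1 - z.2 /\ b = z.1 + z.2.
      by rewrite ht /z /=; split; ring.
    by apply/andP; split; [apply: rpredB | apply: rpredD]; rewrite ?dvdz_gcdl ?dvdz_gcdr.
  by move: d1; rewrite cab dvdz1 => /eqP h; rewrite -[LHS]gez0_abs ?h.
have [gX qX] := X_transfer hA hV.
have [gA qA] := A'_transfer hA2 Aa cab.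
have gY := Y'_gcop hA hV hA2 hY Aa cab oef oy1 y1Y.
have qY := Y'_transfer hA hV hA2 hY Aa cab oef cfY oy1 y1Y.
have qe := e'_transfer hV oef.
have [g11 q11] := eleven_transfer hA hV cab ef11.
have nE := reduced_norm hA hV hA2 hY oef.
have down (m : nat) : odd m -> gcop m (a, b) -> gcop m z /\ qsym m (a, b) = star4 m + qsym m z.
  by move=> om; rewrite abz gcopM => /andP[h1 h2]; rewrite qsymMr // qsym_1i.
have {gX}[gX dX] := down _ X_odd gX; have {gA}[gA dA] := down _ oA gA.
have {gY}[gY dY] := down _ oy1 gY; have {g11}[g11 d11] := down 11 isT g11.
have oXA : odd `|X * A'| by rewrite abszM oddM X_odd.
have oY2 : odd `|- (11 * y1 ^+ 2)| by rewrite abszN abszM abszX oddM oddX oy1.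
have gXA : gcop `|X * A'| z by rewrite /gcop abszM coprimeMl; apply/andP.
have gY2 : gcop `|- (11 * y1 ^+ 2)| z.
  by rewrite abszN abszM abszX /gcop coprimeMl coprimeXl // andbT.
have dN : (gnorm z %| 2 ^+ 0 * (X * A') - 2 ^+ T.*2.+1 * - (11 * y1 ^+ 2))%Z.
  have -> : 2 ^+ 0 * (X * A') - 2 ^+ T.*2.+1 * - (11 * y1 ^+ 2) = f ^+ 2 * gnorm z.
    apply: (mulfI (isT : (2 : int) != 0)).
    transitivity (f ^+ 2 * gnorm (a, b)); last by rewrite abz gnormM gnorm_1i; ring.
    by rewrite -nE hy1 exprMn -exprM muln2 doubleS !exprS; ring.
  by rewrite dvdz_mull.
have h := @recip_sym_periodic z 0 T.*2.+1 _ _ ez cz oXA oY2 gXA gY2 dN.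
move: h; rewrite /recip_sym qsym_absM // qsym_11sq // mulr0n add0r.
rewrite (Z4_sign11 oy1 ez) addr0 (Z4_half_diff a t oef) -ht -hA -hV.
rewrite (Z4_sign_diff a t oef oe oXA) -ht -hA -hV.
have -> : e' ^+ 2 * (X * A') = X * A by rewrite hA2; ring.
have -> : qsym `|X| z = qsym `|X| (U, V) - star4 `|X| by rewrite -qX dX; ring.
have -> : qsym `|A'| z = star4 `|A'|.
  by apply: (addrI (star4 `|A'|)); rewrite -dA qA mulr2n.
have -> : qsym 11 z = qsym 11 (A, V) - star4 11 by rewrite -q11 d11; ring.
have -> : qsym `|y1| z *+ 2 = qsym `|y0| (U, V) - star4 `|y1| *+ 2.
  by rewrite ey qsym_absM // qe add0r -qY dY mulrnDl; ring.
have -> : star4 `|A| = star4 `|A'| + star4 `|e'| *+ 2.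
  by rewrite hA2 expr2 abszM star4M // ?abszM ?oddM ?oe // star4M // mulr2n addrC.
have -> : star4 `|y0| *+ 2 = star4 `|y1| *+ 2 + star4 `|e'| *+ 2.
  by rewrite ey abszM star4M // mulrnDl addrC.
move=> h.
have e4 := Z4_mul4 (star4 `|e'|).
set x := qsym `|X| _ in h *; set q := qsym 11 _ in h *; set y := qsym `|y0| _ in h *.
set s := (_ * _)%:~R in h *; set w := (_ %/ 8)%Z%:~R *+ _ in h *.
set sA := star4 `|A'| in h *; set sX := star4 `|X| in h *; set se := star4 `|e'| in e4 *.
set sy := star4 `|y1| in h *; set s11 := star4 11 in h *.
transitivity ((s + (x - sX + sA)) - s + sX - sA - y - se *+ 4); last first.
  by rewrite h; ring.
by rewrite e4; ring.
Qed.

End SumOfTwo.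

(** * The symbol modulo 11 *)

Definition cube_re (z : int * int) : int := z.1 ^+ 3 - 3 * z.1 * z.2 ^+ 2.
Definition cube_im (z : int * int) : int := z.2 ^+ 3 - 3 * z.1 ^+ 2 * z.2.

(** For 11 the exponent [(q* - 1) / 4] is -3, so the symbol is read off from the
    cube of z. *)
Lemma psym11_eq z (n : 'Z_4) : qunit 11 z ->
  gev (sqrtm1 11) (cube_re z, cube_im z) =
    sqrtm1 11 ^+ n * gev (- sqrtm1 11) (cube_re z, cube_im z) ->
  qsym 11 z = n.
Proof.
move=> hz h; have p11 : prime 11 by [].
have i2 := sqrtm1_sq 11; have two := q_closure_two p11 isT.
rewrite qsym_prime //; apply: (i_exp_inj i2 two); rewrite psym_exp // /psym_power /conj_ratio.
have [E0 E0'] := qunitP p11 hz.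
have cube (j : q_closure 11) : j ^+ 2 = -1 ->
    gev j z ^+ 3 = gev (- j) (cube_re z, cube_im z).
  move=> j2; rewrite /gev /cube_re /cube_im /= !(intrD, rmorphN, intrM, rmorphXn) /=.
  set a := z.1%:~R; set b := z.2%:~R.
  transitivity (a ^+ 3 + 3 * a ^+ 2 * b * j + 3 * a * b ^+ 2 * j ^+ 2 + b ^+ 3 * j ^+ 2 * j).
    by ring.
  by rewrite j2; ring.
rewrite -[(11 %% 4 == 1)%N]/false -[(11 %/ 4).+1]/3%N invf_div expr_div_n.
rewrite (cube _ i2) (cube (- sqrtm1 11)) ?sqrrN // opprK h.
by rewrite -(cube _ i2) mulfK // expf_neq0.
Qed.

Lemma qsym11_cases z : ~~ (11 %| gnorm z)%Z ->
  [/\ (11 %| cube_im z)%Z -> qsym 11 z = 0,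
      (11 %| cube_re z - cube_im z)%Z -> qsym 11 z = 1,
      (11 %| cube_re z)%Z -> qsym 11 z = 2
    & (11 %| cube_re z + cube_im z)%Z -> qsym 11 z = 3].
Proof.
move=> hz; have p11 : prime 11 by []; have i2 := sqrtm1_sq 11.
have [e1 e2 e3] := i_exp_Z4 i2.
split; rewrite -q_closure_int // => h; apply: psym11_eq => //; rewrite ?e1 ?e2 ?e3 /gev /=.
- by rewrite (eqP h) expr0; ring.
- move: h; rewrite rmorphB subr_eq0 => /eqP /= ->.
  set b := (cube_im z)%:~R; set i := sqrtm1 11 in i2 *.
  by transitivity (b * i - b * i ^+ 2); [rewrite i2; ring | ring].
- by rewrite (eqP h); ring.
- move: h; rewrite intrD addr_eq0 => /eqP ->.
  set b := (cube_im z)%:~R; set i := sqrtm1 11 in i2 *.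
  by transitivity (b * i + b * i ^+ 2); [rewrite i2; ring | ring].
Qed.

(** Modulo 11 only the ratio of the coordinates matters. *)
Lemma qsym11_scale (t a b a' b' : int) : ~~ (11 %| t)%Z -> ~~ (11 %| gnorm (a', b'))%Z ->
  (11 %| a - t * a')%Z -> (11 %| b - t * b')%Z -> qsym 11 (a, b) = qsym 11 (a', b').
Proof.
move=> t11 g11 ha hb; pose w := gmul (t, 0) (a', b').
have c1 : ((a, b).1 = w.1 %[mod 11%N])%Z.
  by apply: eqz_modP; rewrite /w /= mul0r subr0.
have c2 : ((a, b).2 = w.2 %[mod 11%N])%Z.
  by apply: eqz_modP; rewrite /w /= mul0r addr0.
by rewrite (qsym_congr c1 c2) qsymMr ?gcop_rat /gcop ?prime_coprime // qsym_rat ?add0r //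
  prime_coprime.
Qed.

Lemma mod11_cond_dvd s x u : mod11_cond s x u ->
  (11 %| x - s * (4 * u))%Z \/ (11 %| x - s * (9 * u))%Z.
Proof. by case=> /eqP h; [left | right]; rewrite -eqz_mod_dvd. Qed.

Section ModEleven.

Variables (s c d x y : int).
Hypothesis hs : s = 1 \/ s = -1.
Hypothesis norm_eq : 4 * (c ^+ 2 + d ^+ 2) = x ^+ 2 + 11 * y ^+ 2.
Hypothesis prim11 : ~~ (11 %| c ^+ 2 + d ^+ 2)%Z.

Lemma dvd11_ex (a : int) : (exists k, a = 11 * k) -> (11 %| a)%Z.
Proof. by move=> [k ->]; exact: dvdz_mulr. Qed.

Lemma dvd11_mul (a b : int) : (11 %| a * b)%Z = (11 %| a)%Z || (11 %| b)%Z.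
Proof. exact: (@Euclid_z 11). Qed.

Lemma dvd11_norm : (11 %| x ^+ 2 - 4 * c ^+ 2 - 4 * d ^+ 2)%Z.
Proof.
apply: dvd11_ex; exists (- y ^+ 2).
transitivity (x ^+ 2 - (4 * (c ^+ 2 + d ^+ 2))); first by ring.
by rewrite norm_eq; ring.
Qed.

Lemma s_sq : s ^+ 2 = 1. Proof. by case: hs => ->. Qed.

(** Stated for a pair (u, v) because it is used both for (c, d) and for (d, c). *)
Lemma mod11_four (u v : int) : (11 %| x ^+ 2 - 4 * u ^+ 2 - 4 * v ^+ 2)%Z ->
  (11 %| x - s * (4 * u))%Z -> ((11 %| v - 5 * u) || (11 %| v + 5 * u))%Z.
Proof.
move=> h /dvdzP[k hk]; have hx : x = s * (4 * u) + k * 11 by rewrite -hk; ring.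
rewrite -dvd11_mul; have : (11 %| 4 * ((v - 5 * u) * (v + 5 * u)))%Z; last by rewrite
  dvd11_mul.
have -> : 4 * ((v - 5 * u) * (v + 5 * u)) =
    11 * (k * (2 * s * (4 * u) + k * 11) + (s ^+ 2 - 1) * u ^+ 2 - 8 * u ^+ 2)
    - (x ^+ 2 - 4 * u ^+ 2 - 4 * v ^+ 2) + 5 * (s ^+ 2 - 1) * u ^+ 2.
  by rewrite hx; ring.
by rewrite s_sq subrr mulr0 mul0r addr0 rpredB // dvdz_mulr.
Qed.

Lemma mod11_nine (u v : int) : (11 %| x ^+ 2 - 4 * u ^+ 2 - 4 * v ^+ 2)%Z ->
  (11 %| x - s * (9 * u))%Z -> (11 %| v)%Z.
Proof.
move=> h /dvdzP[k hk]; have hx : x = s * (9 * u) + k * 11 by rewrite -hk; ring.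
have : (11 %| 4 * (v * v))%Z; last by rewrite !dvd11_mul orbb.
have -> : 4 * (v * v) =
    11 * (k * (2 * s * (9 * u) + k * 11) + 7 * u ^+ 2)
    - (x ^+ 2 - 4 * u ^+ 2 - 4 * v ^+ 2) + 81 * (s ^+ 2 - 1) * u ^+ 2.
  by rewrite hx; ring.
by rewrite s_sq subrr mulr0 mul0r addr0 rpredB // dvdz_mulr.
Qed.

Lemma not11_c (k : int) : (11 %| x - k * c)%Z -> ~~ (11 %| c)%Z.
Proof.
move=> hx; apply: contra prim11 => hc; have x11 : (11 %| x)%Z.
  by rewrite -[x](subrK (k * c)) rpredD // dvdz_mull.
have : (11 %| 4 * (d * d))%Z.
  have -> : 4 * (d * d) = x * x - 4 * (c * c) - (x ^+ 2 - 4 * c ^+ 2 - 4 * d ^+ 2) by ring.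
  apply: rpredB; last exact: dvd11_norm.
  by apply: rpredB; [exact: dvdz_mulr | apply: dvdz_mull; exact: dvdz_mulr].
by rewrite !dvd11_mul orbb /= => hd; rewrite !expr2 rpredD // dvdz_mulr.
Qed.

Lemma not11_d (k : int) : (11 %| x - k * d)%Z -> ~~ (11 %| d)%Z.
Proof.
move=> hx; apply: contra prim11 => hc; have x11 : (11 %| x)%Z.
  by rewrite -[x](subrK (k * d)) rpredD // dvdz_mull.
have : (11 %| 4 * (c * c))%Z.
  have -> : 4 * (c * c) = x * x - 4 * (d * d) - (x ^+ 2 - 4 * c ^+ 2 - 4 * d ^+ 2) by ring.
  apply: rpredB; last exact: dvd11_norm.
  by apply: rpredB; [exact: dvdz_mulr | apply: dvdz_mull; exact: dvdz_mulr].
by rewrite !dvd11_mul orbb /= => hd; rewrite !expr2 rpredD // dvdz_mulr.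
Qed.

End ModEleven.

Lemma qsym11_values :
  [/\ [/\ qsym 11 (3, 2) = 3, qsym 11 (5, 2) = 3 & qsym 11 (-2, 2) = 3],
      [/\ qsym 11 (6, 2) = 1, qsym 11 (-3, 2) = 1 & qsym 11 (2, 2) = 1],
      qsym 11 (6, -1) = 2 /\ qsym 11 (6, 1) = 2
    & [/\ qsym 11 (-2, -1) = 0, qsym 11 (-2, 1) = 0 & qsym 11 (4, 0) = 0]].
Proof.
split; split; match goal with |- qsym 11 ?z = _ =>
  have [h0 h1 h2 h3] := @qsym11_cases z isT end;
  first [exact: h0 isT | exact: h1 isT | exact: h2 isT | exact: h3 isT].
Qed.

Section ModElevenValues.

Variables (s c d x y : int).
Hypothesis hs : s = 1 \/ s = -1.
Hypothesis norm_eq : 4 * (c ^+ 2 + d ^+ 2) = x ^+ 2 + 11 * y ^+ 2.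
Hypothesis prim11 : ~~ (11 %| c ^+ 2 + d ^+ 2)%Z.

(** If [x = 4 s c] then [d = 5 c] or [d = - 5 c] modulo 11, and if [x = 9 s c] then
    11 divides d; in each case the ratio of the coordinates is known. *)
Lemma qsym11_c : mod11_cond s x c -> qsym 11 (x + 2 * d, 2 * c) = (2 + s)%:~R.
Proof.
have [[v1 v2 v3] [w1 w2 w3] _ _] := qsym11_values.
have h0 := dvd11_norm norm_eq.
have sc : (11 %| 2 * c - c * 2)%Z by rewrite mulrC subrr.
move=> /mod11_cond_dvd [] hx.
  have c11 : ~~ (11 %| c)%Z by apply: (not11_c norm_eq prim11 (k := s * 4)); rewrite -mulrA.
  have /orP[] := mod11_four hs h0 hx; move: hx => /dvdzP[k hk] /dvdzP[l hl];
    case: hs hk => -> hk.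
  - rewrite (@qsym11_scale c _ _ 3 2) // ?v1.
    apply: dvd11_ex; exists (k + 2 * l + c).
    by transitivity ((x - 1 * (4 * c)) + 2 * (d - 5 * c) + 11 * c); [ring | rewrite hk hl;
      ring].
  - rewrite (@qsym11_scale c _ _ 6 2) // ?w1.
    apply: dvd11_ex; exists (k + 2 * l).
    by transitivity ((x - -1 * (4 * c)) + 2 * (d - 5 * c)); [ring | rewrite hk hl; ring].
  - rewrite (@qsym11_scale c _ _ 5 2) // ?v2.
    apply: dvd11_ex; exists (k + 2 * l - c).
    by transitivity ((x - 1 * (4 * c)) + 2 * (d + 5 * c) - 11 * c); [ring | rewrite hk hl;
      ring].
  - rewrite (@qsym11_scale c _ _ (-3) 2) // ?w2.
    apply: dvd11_ex; exists (k + 2 * l - c).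
    by transitivity ((x - -1 * (4 * c)) + 2 * (d + 5 * c) - 11 * c); [ring | rewrite hk hl;
      ring].
have c11 : ~~ (11 %| c)%Z by apply: (not11_c norm_eq prim11 (k := s * 9)); rewrite -mulrA.
have := mod11_nine hs h0 hx; move: hx => /dvdzP[k hk] /dvdzP[l hl]; case: hs hk => -> hk.
- rewrite (@qsym11_scale c _ _ (-2) 2) // ?v3.
  apply: dvd11_ex; exists (k + 2 * l + c).
  by transitivity ((x - 1 * (9 * c)) + 2 * d + 11 * c); [ring | rewrite hk hl; ring].
- rewrite (@qsym11_scale c _ _ 2 2) // ?w3.
  apply: dvd11_ex; exists (k + 2 * l - c).
  by transitivity ((x - -1 * (9 * c)) + 2 * d - 11 * c); [ring | rewrite hk hl; ring].
Qed.

(** As for [qsym11_c] with c and d exchanged; the excluded case, where z vanishes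
    modulo 11, is [x = 9 d = - 2 d] with 11 dividing c. *)
Lemma qsym11_d : mod11_cond s x d -> ~~ ((11 %| x + 2 * d) && (11 %| 2 * c))%Z ->
  qsym 11 (x + 2 * d, 2 * c) = (1 + s)%:~R.
Proof.
have [_ _ [v1 v2] [w1 w2 w3]] := qsym11_values.
have h0 := dvd11_norm norm_eq.
have h0' : (11 %| x ^+ 2 - 4 * d ^+ 2 - 4 * c ^+ 2)%Z by rewrite addrAC.
move=> /mod11_cond_dvd [] hx.
  have d11 : ~~ (11 %| d)%Z by apply: (not11_d norm_eq prim11 (k := s * 4)); rewrite -mulrA.
  have /orP[] := mod11_four hs h0' hx; move: hx => /dvdzP[k hk] /dvdzP[l hl] _;
    case: hs hk => -> hk.
  - rewrite (@qsym11_scale d _ _ 6 (-1)) // ?v1.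
    + apply: dvd11_ex; exists k.
      by transitivity (x - 1 * (4 * d)); [ring | rewrite hk; ring].
    + apply: dvd11_ex; exists (2 * l + d).
      by transitivity (2 * (c - 5 * d) + 11 * d); [ring | rewrite hl; ring].
  - rewrite (@qsym11_scale d _ _ (-2) (-1)) // ?w1.
    + apply: dvd11_ex; exists k.
      by transitivity (x - -1 * (4 * d)); [ring | rewrite hk; ring].
    + apply: dvd11_ex; exists (2 * l + d).
      by transitivity (2 * (c - 5 * d) + 11 * d); [ring | rewrite hl; ring].
  - rewrite (@qsym11_scale d _ _ 6 1) // ?v2.
    + apply: dvd11_ex; exists k.
      by transitivity (x - 1 * (4 * d)); [ring | rewrite hk; ring].
    + apply: dvd11_ex; exists (2 * l - d).
      by transitivity (2 * (c + 5 * d) - 11 * d); [ring | rewrite hl; ring].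
  - rewrite (@qsym11_scale d _ _ (-2) 1) // ?w2.
    + apply: dvd11_ex; exists k.
      by transitivity (x - -1 * (4 * d)); [ring | rewrite hk; ring].
    + apply: dvd11_ex; exists (2 * l - d).
      by transitivity (2 * (c + 5 * d) - 11 * d); [ring | rewrite hl; ring].
have d11 : ~~ (11 %| d)%Z by apply: (not11_d norm_eq prim11 (k := s * 9)); rewrite -mulrA.
have := mod11_nine hs h0' hx; move: hx => /dvdzP[k hk] c11; case: hs hk => -> hk.
  rewrite (dvdz_mull 2 c11) andbT; case/negP; apply: dvd11_ex; exists (k + d).
  by transitivity ((x - 1 * (9 * d)) + 11 * d); [ring | rewrite hk; ring].
move=> _; rewrite (@qsym11_scale d _ _ 4 0) // ?w3 ?mulr0 ?subr0 ?dvdz_mull //.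
apply: dvd11_ex; exists (k - d).
by transitivity ((x - -1 * (9 * d)) - 11 * d); [ring | rewrite hk; ring].
Qed.

End ModElevenValues.

(** * The exponents modulo 4 *)

(** The total exponent of [d / c] in [power_odd]: the contributions of x and y
    from reciprocity over [c + d i] and from passing to W, those of [qsym_diff_odd] apart
      from the
    symbol modulo 11, and 1 for a further factor [d / c]. *)
Definition odd_exponent (c d x y : int) : int :=
  1 + d * ((x - 1) %/ 2)%Z - d * ((y - 1) %/ 2)%Z
  + ((x ^+ 2 - 1) %/ 4)%Z - ((y ^+ 2 - 1) %/ 4)%Z
  + ((x + 2 * d) * (2 * c) %/ 2)%Z
  + (2 * c %/ 2)%Z * (x * (x + 2 * d) - 1) + (((x + 2 * d) ^+ 2 - 1) %/ 4)%Z.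

Lemma odd_exponent_mod (g dl xi eta a : int) : xi * (xi + 1) = 2 * a ->
  (4 %| odd_exponent (4 * g + 1) (2 * dl) (2 * xi + 1) (4 * eta + 1)
        - (2 * dl * xi + 2 * dl + 2 * xi + 2 - 2 * eta))%Z.
Proof.
move=> ha; rewrite /odd_exponent.
have xx : xi * xi = 2 * a - xi by rewrite -ha; ring.
have -> : (2 * xi + 1) ^+ 2 - 1 = 4 * (2 * a) by rewrite -ha; ring.
have -> : (4 * eta + 1) ^+ 2 - 1 = 4 * (4 * eta ^+ 2 + 2 * eta) by ring.
have -> : 2 * xi + 1 - 1 = 2 * xi by ring.
have -> : 4 * eta + 1 - 1 = 2 * (2 * eta) by ring.
have -> : (2 * xi + 1 + 2 * (2 * dl)) * (2 * (4 * g + 1)) =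
  2 * ((2 * xi + 1 + 4 * dl) * (4 * g + 1)) by ring.
have -> : (2 * xi + 1 + 2 * (2 * dl)) ^+ 2 - 1 =
  4 * (2 * a + (2 * xi + 1) * (2 * dl) + 4 * dl ^+ 2).
  by transitivity (4 * (xi * (xi + 1)) + 4 * ((2 * xi + 1) * (2 * dl) + 4 * dl ^+ 2));
    [ring | rewrite ha; ring].
rewrite !mulKz //.
have -> : (2 * xi + 1) * (2 * xi + 1 + 2 * (2 * dl)) - 1 =
   8 * a + 4 * dl * (2 * xi + 1).
  by transitivity (4 * (xi * (xi + 1)) + 4 * dl * (2 * xi + 1)); [ring | rewrite ha; ring].
apply/dvdzP; exists (- dl * eta + a - eta ^+ 2 + g * (2 * xi + 1 + 4 * dl) + dl
  + (4 * g + 1) * (2 * a + dl * (2 * xi + 1)) + dl * xi + dl ^+ 2).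
ring.
Qed.

Lemma mod4_one (n : int) : (n = 1 %[mod 4])%Z -> exists k, n = 4 * k + 1.
Proof. by move=> h; exists (n %/ 4)%Z; lia. Qed.

Lemma odd_exponent_aux1 (E g dl xi eta a m : int) : xi * (xi + 1) = 2 * a ->
  8 * m + 1 = (4 * g + 1) ^+ 2 + (2 * dl) ^+ 2 ->
  4 * (8 * m + 1) = (2 * xi + 1) ^+ 2 + 11 * (4 * eta + 1) ^+ 2 ->
  (4 %| E - (2 * dl * xi + 2 * dl + 2 * xi + 2 - 2 * eta))%Z ->
  (4 %| E - 2 * ((2 * xi + 1) %/ 4)%Z)%Z.
Proof.
move=> ha e1 e2 hE.
have e3 : a + 22 * (eta * eta) + 11 * eta = 4 * m - 1.
  have : 4 * (xi * (xi + 1)) + 1 + 11 * (16 * (eta * eta) + 8 * eta + 1) = 4 * (8 * m + 1).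
    by rewrite e2; ring.
  by rewrite ha; lia.
have {e1}[u hu] : exists u, dl = 2 * u.
  have [//|[u hu]] := int_parity dl; exfalso; move: e1; rewrite hu.
  have -> : (4 * g + 1) ^+ 2 + (2 * (2 * u + 1)) ^+ 2 = 8 * (2 * g ^+ 2 + g + 2 * u ^+ 2 +
    2 * u) + 5 by ring.
  by move: (2 * g ^+ 2 + g + 2 * u ^+ 2 + 2 * u); clear; lia.
have [[t ht]|[t ht]] := int_parity xi.
  have q : ((2 * xi + 1) %/ 4)%Z = t by rewrite ht; clear; lia.
  have a1 : a = 2 * (t * t) + t.
    by apply: (mulfI (isT : (2 : int) != 0)); rewrite -ha ht; ring.
  have l1 : 2 * dl * xi = 4 * (u * xi) by rewrite hu; ring.
  rewrite q; move: hE; rewrite l1 hu; move: e3; rewrite a1 ht.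
  move: (t * t) (eta * eta) (u * (2 * t)); clear; lia.
have q : ((2 * xi + 1) %/ 4)%Z = t by rewrite ht; clear; lia.
have a1 : a = 2 * (t * t) + 3 * t + 1.
  by apply: (mulfI (isT : (2 : int) != 0)); rewrite -ha ht; ring.
have l1 : 2 * dl * xi = 4 * (u * xi) by rewrite hu; ring.
rewrite q; move: hE; rewrite l1 hu; move: e3; rewrite a1 ht.
move: (t * t) (eta * eta) (u * (2 * t + 1)); clear; lia.
Qed.

Lemma odd_exponent_aux5 (E g dl xi eta a m : int) : xi * (xi + 1) = 2 * a ->
  8 * m + 5 = (4 * g + 1) ^+ 2 + (2 * dl) ^+ 2 ->
  4 * (8 * m + 5) = (2 * xi + 1) ^+ 2 + 11 * (4 * eta + 1) ^+ 2 ->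
  (4 %| E - (2 * dl * xi + 2 * dl + 2 * xi + 2 - 2 * eta))%Z ->
  (4 %| E - 2 * (1 + (((2 * xi + 1) ^+ 2 - 1) %/ 8)%Z))%Z.
Proof.
move=> ha e1 e2 hE.
have e3 : a + 22 * (eta * eta) + 11 * eta = 4 * m + 1.
  have : 4 * (xi * (xi + 1)) + 1 + 11 * (16 * (eta * eta) + 8 * eta + 1) = 4 * (8 * m + 5).
    by rewrite e2; ring.
  by rewrite ha; lia.
have {e1}[u hu] : exists u, dl = 2 * u + 1.
  have [[u hu]|//] := int_parity dl; exfalso; move: e1; rewrite hu.
  have -> : (4 * g + 1) ^+ 2 + (2 * (2 * u)) ^+ 2 = 8 * (2 * g ^+ 2 + g + 2 * u ^+ 2) + 1
    by ring.
  by move: (2 * g ^+ 2 + g + 2 * u ^+ 2); clear; lia.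
have -> : (2 * xi + 1) ^+ 2 - 1 = 8 * a.
  by transitivity (4 * (xi * (xi + 1))); [ring | rewrite ha; ring].
rewrite mulKz //.
have l1 : 2 * dl * xi = 4 * (u * xi) + 2 * xi by rewrite hu; ring.
move: hE; rewrite l1 hu; move: e3.
move: (eta * eta) (u * xi); clear; lia.
Qed.

Section OddExponent.

Variables (p : nat) (c d x y : int).
Hypothesis p_cd : p%:Z = c ^+ 2 + d ^+ 2.
Hypothesis p_xy : 4 * p%:Z = x ^+ 2 + 11 * y ^+ 2.
Hypothesis c_mod4 : (c = 1 %[mod 4])%Z.
Hypothesis y_mod4 : (y = 1 %[mod 4])%Z.
Hypothesis d_is_even : (2 %| d)%Z.
Hypothesis x_odd : odd `|x|.

Lemma odd_exponent_1 : (p %% 8 = 1)%N ->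
  (odd_exponent c d x y)%:~R = (2 * (x %/ 4)%Z)%:~R :> 'Z_4.
Proof.
move=> p8; apply: Z4_int_eq.
have [m hm] : exists m : int, p = 8 * m + 1 :> int by exists (p %/ 8)%N; move: p8; clear; lia.
have [g hg] := mod4_one c_mod4; have [eta he] := mod4_one y_mod4.
have [dl hd] := dvdzP d_is_even; have [xi hx] := odd_int x_odd; have [a ha] := even_consec xi.
rewrite mulrC in hd; have := odd_exponent_mod g dl eta ha.
move: p_cd p_xy; rewrite hg hd he hx hm; exact: odd_exponent_aux1 ha.
Qed.

Lemma odd_exponent_5 : (p %% 8 = 5)%N ->
  (odd_exponent c d x y)%:~R = (2 * (1 + ((x ^+ 2 - 1) %/ 8)%Z))%:~R :> 'Z_4.
Proof.
move=> p8; apply: Z4_int_eq.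
have [m hm] : exists m : int, p = 8 * m + 5 :> int by exists (p %/ 8)%N; move: p8; clear; lia.
have [g hg] := mod4_one c_mod4; have [eta he] := mod4_one y_mod4.
have [dl hd] := dvdzP d_is_even; have [xi hx] := odd_int x_odd; have [a ha] := even_consec xi.
rewrite mulrC in hd; have := odd_exponent_mod g dl eta ha.
move: p_cd p_xy; rewrite hg hd he hx hm; exact: odd_exponent_aux5 ha.
Qed.

End OddExponent.

(** The analogue for even x, where x stands for half of it, [A = x + d], and
    the sign v is chosen so that [v * c = A (mod 4)]; [sx] and [sA] are the values
    of [star4] at x and A, and [2 ^ (T + 1)] is the exact power of 2 in half of y. *)
Definition even_exponent (c d x A v sx sA T : int) : int :=
  d * ((x - 1) %/ 2)%Z - (c * d %/ 2)%Z * (T + 1) + v * (sx + sA)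
  - ((c ^+ 2 - A ^+ 2) %/ 8)%Z * (2 * T + 1) * v
  + ((v * c - A) %/ 2)%Z * ((x * A - 1) %/ 2)%Z * v + (v + 1).

Lemma divz_eq_mul (q m n : int) : q != 0 -> m = q * n -> (m %/ q)%Z = n.
Proof. by move=> q0 ->; rewrite mulKz. Qed.

Lemma even_exponent_aux1 (g dl xi m T : int) :
  (4 * g + 1) ^+ 2 + (4 * dl) ^+ 2 = (4 * xi + 1) ^+ 2 + 11 * (4 * m) ^+ 2 ->
  (4 %| even_exponent (4 * g + 1) (4 * dl) (4 * xi + 1) (4 * (xi + dl) + 1) 1 xi (xi + dl) T
     - 2 * (1 + (xi + m)))%Z.
Proof.
move=> h; rewrite /even_exponent.
have [b hb] := even_consec m.
rewrite (@divz_eq_mul 2 _ (2 * xi)) //; last by ring.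
rewrite (@divz_eq_mul 2 _ ((4 * g + 1) * (2 * dl))) //; last by ring.
rewrite (@divz_eq_mul 8 _ (22 * m ^+ 2 - 4 * dl ^+ 2 - (4 * xi + 1) * dl)) //; last first.
  transitivity ((4 * g + 1) ^+ 2 + (4 * dl) ^+ 2 - (4 * dl) ^+ 2 - (4 * (xi + dl) + 1) ^+ 2).
    by ring.
  by rewrite h; ring.
rewrite (@divz_eq_mul 2 _ (2 * (g - xi - dl))) //; last by ring.
rewrite (@divz_eq_mul 2 _ (2 * (4 * xi * (xi + dl) + 2 * xi + dl))) //; last by ring.
have mm : m ^+ 2 = 2 * b - m by rewrite -hb; ring.
rewrite mm.
apply/dvdzP; exists (2 * dl * xi - 2 * g * dl * (T + 1) - 11 * b * (2 * T + 1) + 5 * m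
  + 11 * m * T + (2 * T + 1) * (dl ^+ 2 + xi * dl)
  + (g - xi - dl) * (4 * xi * (xi + dl) + 2 * xi + dl)).
ring.
Qed.

Lemma even_exponent_aux1N (g dl xi m T : int) :
  (4 * g + 1) ^+ 2 + (4 * dl) ^+ 2 = (4 * xi - 1) ^+ 2 + 11 * (4 * m) ^+ 2 ->
  (4 %| even_exponent (4 * g + 1) (4 * dl) (4 * xi - 1) (4 * (xi + dl) - 1) (-1) (- xi) (-
    xi - dl) T
     - 2 * (1 + (xi - 1 + m)))%Z.
Proof.
move=> h; rewrite /even_exponent.
have [b hb] := even_consec m.
rewrite (@divz_eq_mul 2 _ (2 * xi - 1)) //; last by ring.
rewrite (@divz_eq_mul 2 _ ((4 * g + 1) * (2 * dl))) //; last by ring.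
rewrite (@divz_eq_mul 8 _ (22 * m ^+ 2 - 4 * dl ^+ 2 - (4 * xi - 1) * dl)) //; last first.
  transitivity ((4 * g + 1) ^+ 2 + (4 * dl) ^+ 2 - (4 * dl) ^+ 2 - (4 * (xi + dl) - 1) ^+ 2).
    by ring.
  by rewrite h; ring.
rewrite (@divz_eq_mul 2 _ (- 2 * (g + xi + dl))) //; last by ring.
rewrite (@divz_eq_mul 2 _ (2 * (4 * xi * (xi + dl) - 2 * xi - dl))) //; last by ring.
have mm : m ^+ 2 = 2 * b - m by rewrite -hb; ring.
rewrite mm; clear; lia.
Qed.

Lemma even_exponent_aux5 (g al xi eta : int) :
  (4 * g + 1) ^+ 2 + (4 * al + 1 - (4 * xi - 1)) ^+ 2 =
    (4 * xi - 1) ^+ 2 + 11 * (2 * (4 * eta + 1)) ^+ 2 ->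
  (4 %| even_exponent (4 * g + 1) (4 * al + 1 - (4 * xi - 1)) (4 * xi - 1) (4 * al + 1) 1
    (- xi) al 0
     - 2 * (1 + (((4 * g + 1) ^+ 2 + (4 * al + 1 - (4 * xi - 1)) ^+ 2 - 5) %/ 8)%Z))%Z.
Proof.
move=> h; rewrite /even_exponent.
rewrite (@divz_eq_mul 2 _ (2 * xi - 1)) //; last by ring.
rewrite (@divz_eq_mul 2 _ ((4 * g + 1) * (2 * al - 2 * xi + 1))) //; last by ring.
rewrite (@divz_eq_mul 8 _ (2 * g ^+ 2 + g - 2 * al ^+ 2 - al)) //; last by ring.
rewrite (@divz_eq_mul 2 _ (2 * (g - al))) //; last by ring.
rewrite (@divz_eq_mul 2 _ (8 * xi * al + 2 * xi - 2 * al - 1)) //; last by ring.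
rewrite (@divz_eq_mul 8 _ (2 * g ^+ 2 + g + 2 * ((al - xi) * (al - xi + 1)))) //; last by ring.
have [b hb] := even_consec (al - xi); have [a ha] := even_consec g.
have [e he] := even_consec xi; have [f hf] := even_consec al.
have gg : g ^+ 2 = 2 * a - g by rewrite -ha; ring.
have xx : xi ^+ 2 = 2 * e - xi by rewrite -he; ring.
have aa : al ^+ 2 = 2 * f - al by rewrite -hf; ring.
have h8 : 2 * xi ^+ 2 - xi + 44 * (2 * eta ^+ 2 + eta) + 5 = 2 * g ^+ 2 + g + 2 * (2 * b).
  rewrite -hb; apply: (mulfI (isT : (8 : int) != 0)).
  transitivity ((4 * xi - 1) ^+ 2 + 11 * (2 * (4 * eta + 1)) ^+ 2 - 5); first by ring.
  by rewrite -h; ring.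
rewrite hb aa gg; rewrite xx gg in h8; move: h8; clear; lia.
Qed.

Lemma even_exponent_aux5N (g al xi eta : int) :
  (4 * g + 1) ^+ 2 + (4 * al - 1 - (4 * xi + 1)) ^+ 2 =
    (4 * xi + 1) ^+ 2 + 11 * (2 * (4 * eta + 1)) ^+ 2 ->
  (4 %| even_exponent (4 * g + 1) (4 * al - 1 - (4 * xi + 1)) (4 * xi + 1) (4 * al - 1)
    (-1) xi (- al) 0
     - 2 * (1 + (((4 * g + 1) ^+ 2 + (4 * al - 1 - (4 * xi + 1)) ^+ 2 - 5) %/ 8)%Z))%Z.
Proof.
move=> h; rewrite /even_exponent.
rewrite (@divz_eq_mul 2 _ (2 * xi)) //; last by ring.
rewrite (@divz_eq_mul 2 _ ((4 * g + 1) * (2 * al - 2 * xi - 1))) //; last by ring.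
rewrite (@divz_eq_mul 8 _ (2 * g ^+ 2 + g - 2 * al ^+ 2 + al)) //; last by ring.
rewrite (@divz_eq_mul 2 _ (- 2 * (g + al))) //; last by ring.
rewrite (@divz_eq_mul 2 _ (8 * xi * al - 2 * xi + 2 * al - 1)) //; last by ring.
rewrite (@divz_eq_mul 8 _ (2 * g ^+ 2 + g + 2 * ((al - xi - 1) * (al - xi - 1 + 1)))) //;
  last by ring.
have [b hb] := even_consec (al - xi - 1); have [a ha] := even_consec g.
have [e he] := even_consec xi; have [f hf] := even_consec al.
have gg : g ^+ 2 = 2 * a - g by rewrite -ha; ring.
have xx : xi ^+ 2 = 2 * e - xi by rewrite -he; ring.
have aa : al ^+ 2 = 2 * f - al by rewrite -hf; ring.
have h8 : 2 * xi ^+ 2 + xi + 44 * (2 * eta ^+ 2 + eta) + 5 = 2 * g ^+ 2 + g + 2 * (2 * b).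
  rewrite -hb; apply: (mulfI (isT : (8 : int) != 0)).
  transitivity ((4 * xi + 1) ^+ 2 + 11 * (2 * (4 * eta + 1)) ^+ 2 - 5); first by ring.
  by rewrite -h; ring.
rewrite hb aa gg; rewrite xx gg in h8; move: h8; clear; lia.
Qed.

Lemma star4_opp (m e : int) : - m = 4 * e + 1 -> star4 `|m| = e%:~R.
Proof. by move=> h; rewrite -abszN; exact: star4_int. Qed.

Section EvenExponent.

Variables (p : nat) (c d x y : int).
Hypothesis p_cd : p%:Z = c ^+ 2 + d ^+ 2.
Hypothesis p_xy : p%:Z = x ^+ 2 + 11 * y ^+ 2.
Hypothesis c_mod4 : (c = 1 %[mod 4])%Z.
Hypothesis d_is_even : (2 %| d)%Z.
Hypothesis x_odd : odd `|x|.

Lemma even_exponent_1 : (p %% 8 = 1)%N -> (2 %| y)%Z ->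
  exists v sx sA : int,
  [/\ v = 1 \/ v = -1, (4 %| v * c - (x + d))%Z,
      star4 `|x| = sx%:~R /\ star4 `|x + d| = sA%:~R
    & forall T : int, (even_exponent c d x (x + d) v sx sA T)%:~R =
        (2 * (1 + ((2 * x %/ 8)%Z + (2 * y %/ 8)%Z)))%:~R :> 'Z_4].
Proof.
move=> p8 /dvdzP[u hu].
have [g hg] := mod4_one c_mod4; have [k hk] := odd_sq x_odd.
have [m hm] : exists m : int, p = 8 * m + 1 :> int by exists (p %/ 8)%N; move: p8; clear; lia.
have [dl hd] : exists dl, d = 4 * dl.
  have [b hb] := dvdzP d_is_even; have [[l hl]|[l hl]] := int_parity b.
    by exists l; rewrite hb hl; ring.
  exfalso; move: p_cd; rewrite hm hg hb hl.
  have -> : (4 * g + 1) ^+ 2 + ((2 * l + 1) * 2) ^+ 2 = 8 * (2 * g ^+ 2 + g + 2 * l ^+ 2 +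
    2 * l) + 5 by ring.
  by move: (2 * g ^+ 2 + g + 2 * l ^+ 2 + 2 * l); clear; lia.
have [w hw] : exists w, y = 4 * w.
  have [[l hl]|[l hl]] := int_parity u; first by exists l; rewrite hu hl; ring.
  exfalso; move: p_xy; rewrite hm hk hu hl.
  have -> : 8 * k + 1 + 11 * ((2 * l + 1) * 2) ^+ 2 = 8 * (k + 22 * l ^+ 2 + 22 * l + 5) +
    5 by ring.
  by move: (k + 22 * l ^+ 2 + 22 * l + 5); clear; lia.
have yw : (2 * y %/ 8)%Z = w by rewrite hw; clear; lia.
have E := p_cd; rewrite p_xy hg hd hw in E; move/esym in E.
have [xi [hx|hx]] : exists xi, x = 4 * xi + 1 \/ x = 4 * xi - 1.
  have [h|h] : (x %% 4 = 1)%Z \/ (x %% 4 = 3)%Z by move: x_odd; clear; lia.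
    by exists (x %/ 4)%Z; left; move: h; clear; lia.
  by exists ((x %/ 4)%Z + 1); right; move: h; clear; lia.
- have hA : x + d = 4 * (xi + dl) + 1 by rewrite hx hd; ring.
  exists 1, xi, (xi + dl); split; first by left.
  + by apply/dvdzP; exists (g - xi - dl); rewrite hA hg; ring.
  + by rewrite (star4_int hx) (star4_int hA).
  + move=> T; apply: Z4_int_eq; rewrite yw hA hg hd hx.
    have -> : (2 * (4 * xi + 1) %/ 8)%Z = xi by clear; lia.
    by apply: even_exponent_aux1; rewrite E hx.
- have hA : x + d = 4 * (xi + dl) - 1 by rewrite hx hd; ring.
  exists (-1), (- xi), (- xi - dl); split; first by right.
  + by apply/dvdzP; exists (- g - xi - dl); rewrite hA hg; ring.
  + by rewrite (@star4_opp x (- xi)) ?(@star4_opp (x + d) (- xi - dl)) // ?hA ?hx; ring.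
  + move=> T; apply: Z4_int_eq; rewrite yw hA hg hd hx.
    have -> : (2 * (4 * xi - 1) %/ 8)%Z = xi - 1 by clear; lia.
    by apply: even_exponent_aux1N; rewrite E hx.
Qed.

Lemma even_exponent_5 (y0 : int) : (p %% 8 = 5)%N -> y = 2 * y0 -> (y0 = 1 %[mod 4])%Z ->
  exists v sx sA : int,
  [/\ v = 1 \/ v = -1, (4 %| v * c - (x + d))%Z,
      star4 `|x| = sx%:~R /\ star4 `|x + d| = sA%:~R
    & (even_exponent c d x (x + d) v sx sA 0)%:~R =
        (2 * (1 + ((p%:Z - 5) %/ 8)%Z))%:~R :> 'Z_4].
Proof.
move=> p8 hy /mod4_one[eta he].
have [g hg] := mod4_one c_mod4.
have [m hm] : exists m : int, p = 8 * m + 5 :> int by exists (p %/ 8)%N; move: p8; clear; lia.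
have [dl hd] : exists dl, d = 4 * dl + 2.
  have [b hb] := dvdzP d_is_even; have [[l hl]|[l hl]] := int_parity b; last first.
    by exists l; rewrite hb hl; ring.
  exfalso; move: p_cd; rewrite hm hg hb hl.
  have -> : (4 * g + 1) ^+ 2 + (2 * l * 2) ^+ 2 = 8 * (2 * g ^+ 2 + g + 2 * l ^+ 2) + 1 by
    ring.
  by move: (2 * g ^+ 2 + g + 2 * l ^+ 2); clear; lia.
have E := p_cd; rewrite p_xy hg hy he in E; move/esym in E.
have [xi [hx|hx]] : exists xi, x = 4 * xi + 1 \/ x = 4 * xi - 1.
  have [h|h] : (x %% 4 = 1)%Z \/ (x %% 4 = 3)%Z by move: x_odd; clear; lia.
    by exists (x %/ 4)%Z; left; move: h; clear; lia.
  by exists ((x %/ 4)%Z + 1); right; move: h; clear; lia.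
- have hA : x + d = 4 * (xi + dl + 1) - 1 by rewrite hx hd; ring.
  have hd' : d = 4 * (xi + dl + 1) - 1 - (4 * xi + 1) by rewrite hd; ring.
  exists (-1), xi, (- (xi + dl + 1)); split; first by right.
  + by apply/dvdzP; exists (- g - xi - dl - 1); rewrite hA hg; ring.
  + by rewrite (star4_int hx) (@star4_opp (x + d) (- (xi + dl + 1))) // hA; ring.
  + apply: Z4_int_eq; rewrite p_cd hA hg hd' hx.
    by apply: (even_exponent_aux5N (eta := eta)); rewrite -hd' E hx.
- have hA : x + d = 4 * (xi + dl) + 1 by rewrite hx hd; ring.
  have hd' : d = 4 * (xi + dl) + 1 - (4 * xi - 1) by rewrite hd; ring.
  exists 1, (- xi), (xi + dl); split; first by left.
  + by apply/dvdzP; exists (g - xi - dl); rewrite hA hg; ring.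
  + by rewrite (@star4_opp x (- xi)) ?(star4_int hA) // hx; ring.
  + apply: Z4_int_eq; rewrite p_cd hA hg hd' hx.
    by apply: (even_exponent_aux5 (eta := eta)); rewrite -hd' E hx.
Qed.

End EvenExponent.

(** * The quartic character of x / y *)

Lemma i_exp_sign (K : fieldType) (i : K) (N : int) : i ^+ 2 = -1 ->
  i ^+ ((2 * N)%:~R : 'Z_4)%R = (-1) ^ N.
Proof.
move=> i2; have m0 : (-1 : K) != 0 by rewrite oppr_eq0 oner_neq0.
have [e1 e2 e3] := i_exp_Z4 i2.
case: (int_parity N) => [[k ->]|[k ->]].
  rewrite (@Z4_int_eq _ 0); last by clear; lia.
  by rewrite -exprz_exp -exprnP sqrrN expr1n exp1rz.
rewrite (@Z4_int_eq _ 2); last by clear; lia.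
rewrite expfzDr // -exprz_exp -exprnP sqrrN expr1n exp1rz mul1r expr1z.
exact: e2.
Qed.

(** p is an odd prime, so 2 is the only prime whose square divides 4 p. *)
Lemma square_free4 (p : nat) : prime p -> (p %% 4 = 1)%N ->
  forall r : nat, prime r -> odd r -> (r%:Z ^+ 2 %| 4 * p%:Z)%Z -> False.
Proof.
move=> p_pr p1 r r_pr r_odd h.
have r4p : (r %| 4 * p%:Z)%Z by apply: dvdz_trans h; rewrite expr2 dvdz_mulr.
have r4 : (r %| 4)%Z = false.
  by rewrite (_ : 4 = 2 * 2 :> int) // Euclid_z // odd_prime_dvd2.
rewrite Euclid_z // r4 /= in r4p.
have er : r = p by apply/eqP; rewrite -dvdn_prime2.
have p0 : (p : int) != 0 by rewrite -[0]/(0%N%:Z) eqz_nat -lt0n prime_gt0.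
move: h; rewrite er expr2 dvdz_mul2r //.
by rewrite -er r4.
Qed.

Lemma gcop_Y_UV (X Y U V n : int) :
  (forall r : nat, prime r -> odd r -> (r%:Z ^+ 2 %| U ^+ 2 + V ^+ 2)%Z -> False) ->
  U ^+ 2 + V ^+ 2 = X ^+ 2 + 11 * Y ^+ 2 -> odd `|n| -> (n %| Y)%Z -> gcop `|n| (U, V).
Proof.
move=> sqf UV on nY; apply: gcop_primes => // r r_pr r_odd rn rM.
have rY : (r %| Y)%Z := dvdz_trans rn nY.
apply: (not_dvd_XY sqf UV r_pr r_odd _ rY); rewrite -(Euclid_sq _ r_pr).
have -> : X ^+ 2 = (U ^+ 2 + V ^+ 2) - 11 * Y * Y by rewrite UV; ring.
by rewrite rpredB // dvdz_mull.
Qed.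

Lemma prime_ndvd_XY (p : nat) (X Y U V : int) : prime p -> (p %% 4 = 1)%N ->
  (forall r : nat, prime r -> odd r -> (r%:Z ^+ 2 %| U ^+ 2 + V ^+ 2)%Z -> False) ->
  U ^+ 2 + V ^+ 2 = X ^+ 2 + 11 * Y ^+ 2 -> (p %| U ^+ 2 + V ^+ 2)%Z ->
  ~~ (p %| X)%Z /\ ~~ (p %| Y)%Z.
Proof.
move=> p_pr p1 sqf UV pM; have p_odd : odd p by move: p1; clear; lia.
have nXY := not_dvd_XY sqf UV p_pr p_odd.
have YX : (p %| Y)%Z -> (p %| X)%Z.
  move=> pY; rewrite -(Euclid_sq _ p_pr).
  have -> : X ^+ 2 = (U ^+ 2 + V ^+ 2) - 11 * Y * Y by rewrite UV; ring.
  by rewrite rpredB // dvdz_mull.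
have XY : (p %| X)%Z -> (p %| Y)%Z.
  move=> pX; have : (p %| 11 * Y ^+ 2)%Z.
    have -> : 11 * Y ^+ 2 = (U ^+ 2 + V ^+ 2) - X * X by rewrite UV; ring.
    by rewrite rpredB // dvdz_mull.
  rewrite Euclid_z // Euclid_sq // => /orP[p11|//].
  by have e : p = 11%N by [apply/eqP; rewrite -dvdn_prime2]; move: p1; rewrite e.
split; apply/negP => h; first exact: nXY h (XY h).
exact: nXY (YX h) h.
Qed.

Section Values.

Variables (p : nat) (c d : int).
Hypothesis p_pr : prime p.
Hypothesis p1 : (p %% 4 = 1)%N.
Hypothesis p_cd : p%:Z = c ^+ 2 + d ^+ 2.
Hypothesis c_mod4 : (c = 1 %[mod 4])%Z.

Local Notation j := (d%:~R / c%:~R : 'F_p).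

Lemma d_is_even : (2 %| d)%Z.
Proof.
have [g hg] := mod4_one c_mod4.
have [[k ->]|[k hk]] := int_parity d; first by rewrite dvdz_mulr.
exfalso; have [m hm] : exists m : int, p = 4 * m + 1 :> int.
  by exists (p %/ 4)%N; move: p1; clear; lia.
move: p_cd; rewrite hm hg hk.
have -> : (4 * g + 1) ^+ 2 + (2 * k + 1) ^+ 2 = 4 * (4 * g ^+ 2 + 2 * g + k ^+ 2 + k) + 2
  by ring.
by move: (4 * g ^+ 2 + 2 * g + k ^+ 2 + k); clear; lia.
Qed.

Lemma c_neq0 : (c%:~R : 'F_p) != 0.
Proof.
rewrite -(dvdz_pcharf (pchar_Fp p_pr)); apply/negP => pc.
have pd : (p %| d)%Z.
  rewrite -(Euclid_sq _ p_pr); have -> : d ^+ 2 = p%:Z - c * c by rewrite p_cd; ring.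
  by rewrite rpredB // dvdz_mulr.
have p_odd : odd p by move: p1; clear; lia.
apply: (square_free4 p_pr p1 p_pr p_odd).
have -> : 4 * p%:Z = 4 * (c ^+ 2 + d ^+ 2) by rewrite p_cd.
by apply: dvdz_mull; exact: dvd_sq pc pd.
Qed.

Lemma j_sq : j ^+ 2 = -1.
Proof.
have c0 := c_neq0; have F : (c%:~R : 'F_p) ^+ 2 + d%:~R ^+ 2 = 0.
  by rewrite -!rmorphXn -intrD -p_cd; exact: pchar_Fp_0.
rewrite expr_div_n; apply: (mulIf (expf_neq0 2 c0)); rewrite divfK ?expf_neq0 //.
by rewrite mulN1r; apply/eqP; rewrite -addr_eq0 addrC F.
Qed.

(** [d + c i] is [i] times the conjugate of [c + d i]. *)
Lemma qsym_i_conj (m : nat) (U V s : int) : odd m -> gcop m (U, V) -> coprime m `|s| ->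
  U = s * d -> V = s * c -> qsym m (c, d) = star4 m *+ 2 - qsym m (U, V).
Proof.
move=> om + cs hU hV.
have -> : (U, V) = gmul (gmul (s, 0) (0, 1)) (gconj (c, d)).
  by rewrite hU hV /gmul /gconj /=; congr (_, _); ring.
rewrite !gcopM => /andP[/andP[h1 h2] h3].
rewrite !qsymMr ?gcopM ?h1 // qsym_rat // qsym_i // qsym_conj //.
  by rewrite add0r opprD addrA subrr sub0r opprK.
by move: h3; rewrite /gcop /gnorm /= sqrrN.
Qed.

(** [d - c i] is [- i] times [c + d i]. *)
Lemma qsym_Ni (m : nat) : odd m -> gcop m (c, d) ->
  qsym m (c, d) = qsym m (d, - c) - star4 m *+ 2.
Proof.
move=> om h.
have -> : (d, - c) = gmul (gmul (-1, 0) (0, 1)) (c, d).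
  by rewrite /gmul /=; congr (_, _); ring.
have h1 : gcop m (-1, 0) by rewrite gcop_rat coprimen1.
rewrite !qsymMr ?gcopM ?h1 ?gcop_i // qsym_rat ?coprimen1 // qsym_i //.
by rewrite add0r addrC addKr.
Qed.

Section Odd.

Variables x y : int.
Hypothesis p_xy : 4 * p%:Z = x ^+ 2 + 11 * y ^+ 2.
Hypothesis x_odd : odd `|x|.
Hypothesis y_mod4 : (y = 1 %[mod 4])%Z.
Hypothesis nondeg : ~~ ((11 %| x + 2 * d) && (11 %| 2 * c))%Z.

Lemma power_odd :
  (x%:~R / y%:~R : 'F_p) ^+ (p %/ 4) * j ^+ qsym 11 (x + 2 * d, 2 * c) * j =
  j ^+ ((odd_exponent c d x y)%:~R : 'Z_4)%R.
Proof.
have de := d_is_even; have j2 := j_sq.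
have y_odd : odd `|y| by move: y_mod4; clear; lia.
have sqf (r : nat) : prime r -> odd r -> (r%:Z ^+ 2 %| (2 * d) ^+ 2 + (2 * c) ^+ 2)%Z -> False.
  have -> : (2 * d) ^+ 2 + (2 * c) ^+ 2 = 4 * p%:Z by rewrite p_cd; ring.
  exact: square_free4.
have UV_XY : (2 * d) ^+ 2 + (2 * c) ^+ 2 = x ^+ 2 + 11 * y ^+ 2.
  by rewrite -p_xy p_cd; ring.
have A_odd : odd `|x + 2 * d| by move: x_odd; clear; lia.
have ev : (2 %| 2 * c)%Z by rewrite dvdz_mulr.
have hQ := qsym_diff_odd sqf UV_XY x_odd A_odd nondeg ev y_odd.
have [px py] : ~~ (p %| x)%Z /\ ~~ (p %| y)%Z.
  apply: (prime_ndvd_XY p_pr p1 sqf UV_XY).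
  have -> : (2 * d) ^+ 2 + (2 * c) ^+ 2 = 4 * p%:Z by rewrite p_cd; ring.
  exact: dvdz_mull.
have gx := gcop_X_UV sqf UV_XY x_odd.
have gy := gcop_Y_UV sqf UV_XY y_odd (dvdzz y).
have vx := ind4_value 0 p_pr p1 p_cd de x_odd px.
have vy := ind4_value 0 p_pr p1 p_cd de y_odd py.
rewrite !mul1r in vx vy.
rewrite expr_div_n vx vy -i_expN // -i_expD // -i_expD //.
have [e1 _ _] := i_exp_Z4 j2.
rewrite -[X in _ * X = _]e1 -i_expD //; apply: (congr1 (fun n : 'Z_4 => j ^+ n)).
rewrite /recip_sym !mulr0n !add0r.
have c2 (m : nat) : odd m -> coprime m `|2%:Z| by move=> om; rewrite coprimen2.
rewrite (qsym_i_conj x_odd gx (c2 _ x_odd)) // (qsym_i_conj y_odd gy (c2 _ y_odd)) //.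
rewrite !star4_sq //; move: hQ.
rewrite /odd_exponent !(intrD, mulrNz).
set qx := qsym `|x| _; set qy := qsym `|y| _; set R := qsym 11 _ => hQ.
have -> : qx = qy + (qx - qy) by ring.
by rewrite hQ; ring.
Qed.

End Odd.

Section Even.

Variables (x y y0 v sx sA : int) (T : nat).
Hypothesis p_xy : p%:Z = x ^+ 2 + 11 * y ^+ 2.
Hypothesis x_odd : odd `|x|.
Hypothesis y_y0 : y = 2 ^+ T.+1 * y0.
Hypothesis y0_mod4 : (y0 = 1 %[mod 4])%Z.
Hypothesis v_sign : v = 1 \/ v = -1.
Hypothesis v_mod4 : (4 %| v * c - (x + d))%Z.
Hypothesis star_x : star4 `|x| = sx%:~R.
Hypothesis star_A : star4 `|x + d| = sA%:~R.
Hypothesis nondeg : ~~ ((11 %| x + d) && (11 %| c))%Z.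

Lemma intr_muln (a : int) (n : nat) : (a * n%:Z)%:~R = a%:~R *+ n :> 'Z_4.
Proof. by rewrite intrM -pmulrn mulr_natr. Qed.

Lemma power_even :
  (x%:~R / y%:~R : 'F_p) ^+ (p %/ 4) * j ^+ qsym 11 (x + d, c) * j =
  j ^+ ((even_exponent c d x (x + d) v sx sA T)%:~R : 'Z_4)%R.
Proof.
have de := d_is_even; have j2 := j_sq.
have y0_odd : odd `|y0| by move: y0_mod4; clear; lia.
have c_odd : odd `|c| by move: c_mod4; clear; lia.
have v2 : v ^+ 2 = 1 by case: v_sign => ->.
have pUV : d ^+ 2 + (v * c) ^+ 2 = p by rewrite exprMn v2 mul1r addrC p_cd.
have sqf (r : nat) : prime r -> odd r -> (r%:Z ^+ 2 %| d ^+ 2 + (v * c) ^+ 2)%Z -> False.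
  rewrite pUV => r_pr r_odd h; apply: (square_free4 p_pr p1 r_pr r_odd).
  exact: dvdz_mull.
have UV_XY : d ^+ 2 + (v * c) ^+ 2 = x ^+ 2 + 11 * y ^+ 2 by rewrite pUV.
have A_odd : odd `|x + d| by move: x_odd de; clear; lia.
have V_odd : odd `|v * c| by rewrite abszM oddM c_odd andbT; case: v_sign => ->.
have nd : ~~ ((11 %| x + d) && (11 %| v * c))%Z.
  by apply: contra nondeg; case: v_sign => ->; rewrite ?mul1r ?mulN1r ?dvdzE ?abszN.
have hQ := qsym_diff_even sqf UV_XY x_odd A_odd nd y_y0 y0_odd V_odd v_mod4.
have [px py] : ~~ (p %| x)%Z /\ ~~ (p %| y)%Z.
  by apply: (prime_ndvd_XY p_pr p1 sqf UV_XY); rewrite pUV.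
have py0 : ~~ (p %| y0)%Z by apply: contra py => h; rewrite y_y0 dvdz_mull.
have gx := gcop_X_UV sqf UV_XY x_odd.
have y0y : (y0 %| y)%Z by rewrite y_y0 dvdz_mull.
have gy := gcop_Y_UV sqf UV_XY y0_odd y0y.
have vx := ind4_value 0 p_pr p1 p_cd de x_odd px.
have vy := ind4_value T.+1 p_pr p1 p_cd de y0_odd py0.
rewrite mul1r in vx.
have ey : y%:~R = 2 ^+ T.+1 * y0%:~R :> 'F_p by rewrite y_y0 intrM rmorphXn.
rewrite expr_div_n ey vx vy -i_expN // -i_expD // -i_expD //.
have [e1 _ _] := i_exp_Z4 j2.
rewrite -[X in _ * X = _]e1 -i_expD //; apply: (congr1 (fun n : 'Z_4 => j ^+ n)).
rewrite /recip_sym mulr0n add0r.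
have -> : (d * ((y0 - 1) %/ 2)%Z)%:~R = 0 :> 'Z_4.
  have [k hk] := dvdzP de; have [l hl] := mod4_one y0_mod4.
  have -> : y0 - 1 = 2 * (2 * l) by rewrite hl; ring.
  by apply: (Z4_int_eq (n := 0)); rewrite mulKz // hk; clear; lia.
have s11 : star4 11 = 1 by apply: val_inj.
rewrite s11 star_x star_A in hQ.
have eT1 : (T : int) + 1 = T.+1%:Z by clear; lia.
have eT2 : 2 * (T : int) + 1 = T.*2.+1%:Z by clear; lia.
rewrite /even_exponent eT1 eT2.
case: v_sign => hv; rewrite hv ?mul1r ?mulN1r in hQ gx gy *.
- rewrite (@qsym_i_conj _ d c 1) ?mul1r ?coprimen1 //.
  rewrite (@qsym_i_conj `|y0| d c 1) ?mul1r ?coprimen1 //.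
  rewrite !mulr1 !(intrD, mulrNz, intr_muln) star_x.
  set qx := qsym `|x| _ in hQ *; set qy := qsym `|y0| _ in hQ *; set R := qsym 11 _ in hQ *.
  have -> : qx = qy + (qx - qy) by ring.
  rewrite hQ; set D := _ *+ T.*2.+1; set C := _ *+ T.+1.
  by ring.
have g11 : gcop 11 (x + d, c).
  rewrite /gcop prime_coprime //; apply/negP => h.
  by have := @eleven_sum2 (x + d) c h; rewrite (negPf nondeg).
have R11 : qsym 11 (x + d, - c) = - qsym 11 (x + d, c) := @qsym_conj 11 (x + d, c) isT g11.
have swap (m : nat) : gcop m (d, - c) -> gcop m (c, d).
  by rewrite /gcop /gnorm /= sqrrN addrC.
rewrite (qsym_Ni x_odd (swap _ gx)) (qsym_Ni y0_odd (swap _ gy)).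
rewrite star_x !mulrN1; rewrite R11 sqrrN in hQ.
rewrite !(intrD, mulrNz, intr_muln).
set qx := qsym `|x| _ in hQ *; set qy := qsym `|y0| _ in hQ *; set R := qsym 11 _ in hQ *.
have -> : qx = qy + (qx - qy) by ring.
rewrite hQ; set D := _ *+ T.*2.+1; set C := _ *+ T.+1.
by ring.
Qed.

End Even.

End Values.

(** * Powers of -11 *)

Section Conclusion.

Variables (p : nat) (c d x y : int).
Hypothesis p_pr : prime p.
Hypothesis p1 : (p %% 4 = 1)%N.
Hypothesis p_cd : p%:Z = c ^+ 2 + d ^+ 2.
Hypothesis p_xy : 4 * p%:Z = x ^+ 2 + 11 * y ^+ 2.
Hypothesis c_mod4 : (c = 1 %[mod 4])%Z.

Lemma xy_ndvd : ~~ (p %| x)%Z /\ ~~ (p %| y)%Z.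
Proof.
have UV : (2 * c) ^+ 2 + (2 * d) ^+ 2 = x ^+ 2 + 11 * y ^+ 2.
  by rewrite -p_xy p_cd; ring.
have UV4 : (2 * c) ^+ 2 + (2 * d) ^+ 2 = 4 * p%:Z by rewrite UV p_xy.
have sqf := square_free4 p_pr p1; rewrite -UV4 in sqf.
by apply: (prime_ndvd_XY p_pr p1 sqf UV); rewrite UV4 dvdz_mull.
Qed.

Lemma y_neq0 : (y%:~R : 'F_p) != 0.
Proof. by rewrite -(dvdz_pcharf (pchar_Fp p_pr)); case: xy_ndvd. Qed.

Lemma x_neq0 : (x%:~R : 'F_p) != 0.
Proof. by rewrite -(dvdz_pcharf (pchar_Fp p_pr)); case: xy_ndvd. Qed.

Lemma xy_sq : (x%:~R / y%:~R : 'F_p) ^+ 2 = -11.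
Proof.
have y0 := y_neq0.
have F : (x%:~R : 'F_p) ^+ 2 + 11 * y%:~R ^+ 2 = 0.
  have -> : 11 * y%:~R ^+ 2 = (11 * y ^+ 2)%:~R :> 'F_p by rewrite intrM rmorphXn.
  by rewrite -rmorphXn -intrD -p_xy intrM -[(p%:Z)%:~R]/(p%:R) pchar_Fp_0 ?mulr0.
rewrite expr_div_n; apply: (mulIf (expf_neq0 2 y0)); rewrite divfK ?expf_neq0 //.
by rewrite mulNr; apply/eqP; rewrite -addr_eq0 F.
Qed.

Lemma pow_neg11_1mod8 : (p %% 8 = 1)%N ->
  (-11 : 'F_p) ^+ (p %/ 8) = (x%:~R / y%:~R) ^+ (p %/ 4).
Proof.
move=> p8; have -> : (p %/ 4 = 2 * (p %/ 8))%N by move: p8; clear; lia.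
by rewrite exprM xy_sq.
Qed.

Lemma pow_neg11_5mod8 : (p %% 8 = 5)%N ->
  (-11 : 'F_p) ^+ (p %/ 8) = (x%:~R / y%:~R) ^+ (p %/ 4) * (y%:~R / x%:~R).
Proof.
move=> p8; have -> : (p %/ 4 = (2 * (p %/ 8)).+1)%N by move: p8; clear; lia.
rewrite exprSr exprM xy_sq -mulrA [_ / _ * _]mulrA divfK ?y_neq0 //.
by rewrite divff ?mulr1 // x_neq0.
Qed.

Lemma cd_norm : 4 * (c ^+ 2 + d ^+ 2) = x ^+ 2 + 11 * y ^+ 2.
Proof. by rewrite -p_cd. Qed.

Lemma cd_not11 : ~~ (11 %| c ^+ 2 + d ^+ 2)%Z.
Proof.
rewrite -p_cd; apply/negP => h; have : (11 %| p)%N by [].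
by rewrite dvdn_prime2 // => /eqP e; move: p1; rewrite -e.
Qed.

(** The value of the symbol modulo 11 turns the exponent into the sign s.  When
    z vanishes modulo 11, where [x = 9 d] and s = 1, the sign of d is changed: then
    [x = - 9 (- d)], which belongs to s = -1 and is not degenerate, while both
    [d / c] and s change sign in the conclusion. *)
Lemma power_of_qsym11 (X : 'F_p) (N s : int) : s = 1 \/ s = -1 ->
  (forall e : int, e = d \/ e = - d -> ~~ ((11 %| x + 2 * e) && (11 %| 2 * c))%Z ->
    X * (e%:~R / c%:~R) ^+ qsym 11 (x + 2 * e, 2 * c) * (e%:~R / c%:~R) = (-1) ^ N) ->
  (mod11_cond s x c -> X = s%:~R * (-1) ^ N) /\
  (mod11_cond s x d -> X = s%:~R * (-1) ^ N * (d%:~R / c%:~R)).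
Proof.
move=> hs h; have j2 := j_sq p_pr p1 p_cd.
have [e1 e2 e3] := i_exp_Z4 j2.
split=> hc.
  have c11 : ~~ (11 %| 2 * c)%Z.
    rewrite dvd11_mul negb_or; apply/andP; split=> //.
    case: (mod11_cond_dvd hc) => h11.
      by apply: (not11_c cd_norm cd_not11 (k := s * 4)); rewrite -mulrA.
    by apply: (not11_c cd_norm cd_not11 (k := s * 9)); rewrite -mulrA.
  have nd : ~~ ((11 %| x + 2 * d) && (11 %| 2 * c))%Z by rewrite (negPf c11) andbF.
  have := h d (or_introl erefl) nd; rewrite (qsym11_c hs cd_norm cd_not11 hc) => <-.
  case: hs => ->.
    rewrite (_ : (2 + 1)%:~R = 3 :> 'Z_4) // e3.
    by rewrite mulrN mulNr -mulrA -expr2 j2; ring.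
  rewrite (_ : (2 + -1)%:~R = 1 :> 'Z_4) // e1.
  by rewrite -mulrA -expr2 j2; ring.
have jN : (- d)%:~R / c%:~R = - (d%:~R / c%:~R) :> 'F_p by rewrite mulrNz mulNr.
have [nd|] := boolP (~~ ((11 %| x + 2 * d) && (11 %| 2 * c))%Z).
  have := h d (or_introl erefl) nd; rewrite (qsym11_d hs cd_norm cd_not11 hc nd) => <-.
  case: hs => ->.
    rewrite (_ : (1 + 1)%:~R = 2 :> 'Z_4) // e2.
    by rewrite mulrN1 mulNr mul1r mulNr -mulrA -expr2 j2; ring.
  rewrite (_ : (1 + -1)%:~R = 0 :> 'Z_4) // expr0 mulr1.
  by rewrite mulN1r mulNr -mulrA -expr2 j2; ring.
rewrite negbK => /andP[xd c11].
have d11 : ~~ (11 %| d)%Z.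
  case: (mod11_cond_dvd hc) => h11.
    by apply: (not11_d cd_norm cd_not11 (k := s * 4)); rewrite -mulrA.
  by apply: (not11_d cd_norm cd_not11 (k := s * 9)); rewrite -mulrA.
have nd : ~~ ((11 %| x + 2 * - d) && (11 %| 2 * c))%Z.
  rewrite c11 andbT; apply: contra d11 => h11.
  have : (11 %| 4 * d)%Z.
    have -> : 4 * d = x + 2 * d - (x + 2 * - d) by ring.
    exact: rpredB xd h11.
  by rewrite dvd11_mul.
have s1 : s = 1.
  case: hs => // hs1; move: hc; rewrite hs1 => /mod11_cond_dvd [] h11; exfalso;
    move/negP: d11; apply.
    have : (11 %| 2 * d)%Z.
      have -> : 2 * d = (x - -1 * (4 * d)) - (x + 2 * d) by ring.
      exact: rpredB h11 xd.
    by rewrite dvd11_mul.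
  have : (11 %| 7 * d)%Z.
    have -> : 7 * d = (x - -1 * (9 * d)) - (x + 2 * d) by ring.
    exact: rpredB h11 xd.
  by rewrite dvd11_mul.
have hc' : mod11_cond (-1) x (- d).
  by move: hc; rewrite s1 /mod11_cond !mulrN !mulN1r !opprK !mul1r.
have norm4' : 4 * (c ^+ 2 + (- d) ^+ 2) = x ^+ 2 + 11 * y ^+ 2 by rewrite sqrrN cd_norm.
have cd' : ~~ (11 %| c ^+ 2 + (- d) ^+ 2)%Z by rewrite sqrrN cd_not11.
have := h (- d) (or_intror erefl) nd.
rewrite (qsym11_d (or_intror erefl) norm4' cd' hc' nd) => <-.
rewrite (_ : (1 + -1)%:~R = 0 :> 'Z_4) // expr0 mulr1 jN s1.
by rewrite mul1r mulrN mulNr -mulrA -expr2 j2; ring.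
Qed.

(** The equation modulo 4 and 16, with [p = 1 (mod 4)], forces [x = 2 (mod 4)] and [4 | y]. *)
Lemma even_x_shape (y0 : int) (t : nat) : (2 %| x)%Z -> y = 2 ^+ t * y0 ->
  (y0 = 1 %[mod 4])%Z -> exists x1 y1 T,
  [/\ x = 2 * x1, y = 2 * y1, odd `|x1| & y1 = 2 ^+ T.+1 * y0].
Proof.
move=> /dvdzP[x1 hx] hy /mod4_one[eta hy0].
have [m hm] : exists m : int, p = 4 * m + 1 :> int by exists (p %/ 4)%N; move: p1; clear; lia.
move: p_xy; rewrite hm hx => E.
have [[y1 hy1]|[k hk]] := int_parity y; last first.
  exfalso; move: E; rewrite hk.
  have -> : (x1 * 2) ^+ 2 + 11 * (2 * k + 1) ^+ 2 = 4 * (x1 ^+ 2 + 11 * k ^+ 2 + 11 * k +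
    2) + 3 by ring.
  by move: (x1 ^+ 2 + 11 * k ^+ 2 + 11 * k + 2); clear; lia.
have {}E : 4 * m + 1 = x1 ^+ 2 + 11 * y1 ^+ 2.
  by apply: (mulfI (isT : (4 : int) != 0)); rewrite E hy1; ring.
have [[a ha]|[a ha]] := int_parity x1; have [[b hb]|[b hb]] := int_parity y1; rewrite ha hb
  in E.
- exfalso; move: E; have -> : (2 * a) ^+ 2 + 11 * (2 * b) ^+ 2 = 4 * (a ^+ 2 + 11 * b ^+ 2)
  by ring.
  by move: (a ^+ 2 + 11 * b ^+ 2); clear; lia.
- exfalso; move: E.
  have -> : (2 * a) ^+ 2 + 11 * (2 * b + 1) ^+ 2 = 4 * (a ^+ 2 + 11 * b ^+ 2 + 11 * b + 2)
    + 3 by ring.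
  by move: (a ^+ 2 + 11 * b ^+ 2 + 11 * b + 2); clear; lia.
- exists x1, y1; case: t hy => [|[|T]] hy.
  + by exfalso; move: hy; rewrite expr0 mul1r hy1 hb hy0; clear; lia.
  + by exfalso; move: hy; rewrite expr1 hy1 hb hy0; clear; lia.
  exists T; split=> //.
  + by rewrite mulrC.
  + by rewrite ha; clear; lia.
  + by apply: (mulfI (isT : (2 : int) != 0)); rewrite -hy1 hy exprS mulrA.
- exfalso; move: E.
  have -> : (2 * a + 1) ^+ 2 + 11 * (2 * b + 1) ^+ 2 = 4 * (a ^+ 2 + a + 11 * b ^+ 2 + 11 *
    b + 3) by ring.
  by move: (a ^+ 2 + a + 11 * b ^+ 2 + 11 * b + 3); clear; lia.
Qed.

Lemma odd_x_shape (y0 : int) (t : nat) : ~~ (2 %| x)%Z -> y = 2 ^+ t * y0 ->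
  (y0 = 1 %[mod 4])%Z -> odd `|x| /\ (y = 1 %[mod 4])%Z.
Proof.
move=> x2 hy hy0; have x_odd : odd `|x| by move: x2; clear; lia.
split=> //; case: t hy => [|T] hy; first by rewrite hy expr0 mul1r.
exfalso; have [k hk] := odd_sq x_odd; move: p_xy.
have -> : y = 2 * (2 ^+ T * y0) by rewrite hy exprS; ring.
have -> : 11 * (2 * (2 ^+ T * y0)) ^+ 2 = 4 * (11 * (2 ^+ T * y0) ^+ 2) by ring.
by rewrite hk; move: (11 * (2 ^+ T * y0) ^+ 2); clear; lia.
Qed.

Section OddX.

Hypothesis x_odd : odd `|x|.
Hypothesis y_mod4 : (y = 1 %[mod 4])%Z.

Lemma power_odd_sign (e N : int) : e = d \/ e = - d ->
  (forall e : int, p%:Z = c ^+ 2 + e ^+ 2 -> (2 %| e)%Z ->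
    (odd_exponent c e x y)%:~R = (2 * N)%:~R :> 'Z_4) ->
  ~~ ((11 %| x + 2 * e) && (11 %| 2 * c))%Z ->
  (x%:~R / y%:~R) ^+ (p %/ 4) * (e%:~R / c%:~R) ^+ qsym 11 (x + 2 * e, 2 * c)
    * (e%:~R / c%:~R) = (-1) ^ N :> 'F_p.
Proof.
move=> he hN nd; have p_ce : p%:Z = c ^+ 2 + e ^+ 2 by case: he => ->; rewrite ?sqrrN.
rewrite (power_odd p_pr p1 p_ce c_mod4 p_xy x_odd y_mod4 nd).
rewrite (hN _ p_ce (d_is_even p1 p_ce c_mod4)); apply: i_exp_sign.
exact: j_sq p_ce.
Qed.

End OddX.

Section EvenX.

Variables (x1 y1 y0 : int) (T : nat).
Hypothesis x_x1 : x = 2 * x1.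
Hypothesis y_y1 : y = 2 * y1.
Hypothesis x1_odd : odd `|x1|.
Hypothesis y1_y0 : y1 = 2 ^+ T.+1 * y0.
Hypothesis y0_mod4 : (y0 = 1 %[mod 4])%Z.

Lemma p_x1y1 : p%:Z = x1 ^+ 2 + 11 * y1 ^+ 2.
Proof.
apply: (mulfI (isT : (4 : int) != 0)); rewrite p_xy x_x1 y_y1; ring.
Qed.

Lemma power_even_sign (e N : int) : e = d \/ e = - d ->
  (forall e : int, p%:Z = c ^+ 2 + e ^+ 2 -> (2 %| e)%Z -> exists v sx sA : int,
    [/\ v = 1 \/ v = -1, (4 %| v * c - (x1 + e))%Z,
        star4 `|x1| = sx%:~R /\ star4 `|x1 + e| = sA%:~R
      & (even_exponent c e x1 (x1 + e) v sx sA T)%:~R = (2 * N)%:~R :> 'Z_4]) ->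
  ~~ ((11 %| x + 2 * e) && (11 %| 2 * c))%Z ->
  (x%:~R / y%:~R) ^+ (p %/ 4) * (e%:~R / c%:~R) ^+ qsym 11 (x + 2 * e, 2 * c)
    * (e%:~R / c%:~R) = (-1) ^ N :> 'F_p.
Proof.
move=> he hN nd; have p_ce : p%:Z = c ^+ 2 + e ^+ 2 by case: he => ->; rewrite ?sqrrN.
have x2e : x + 2 * e = 2 * (x1 + e) by rewrite x_x1; ring.
have [v [sx [sA [hv h4 [hx hA] hE]]]] := hN e p_ce (d_is_even p1 p_ce c_mod4).
have nd1 : ~~ ((11 %| x1 + e) && (11 %| c))%Z.
  by apply: contra nd => /andP[h1 h2]; rewrite x2e !dvdz_mull.
have g11 : ~~ (11 %| gnorm (x1 + e, c))%Z.
  by apply/negP => h; have := @eleven_sum2 (x1 + e) c h; rewrite (negPf nd1).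
have -> : qsym 11 (x + 2 * e, 2 * c) = qsym 11 (x1 + e, c).
  by apply: (@qsym11_scale 2) => //; rewrite ?x2e subrr.
have -> : x%:~R / y%:~R = x1%:~R / y1%:~R :> 'F_p.
  rewrite x_x1 y_y1 !intrM -mulf_div divff ?mul1r //.
  exact: Fp_two_neq0 p_pr p1.
have V := power_even p_pr p1 p_ce c_mod4 p_x1y1 x1_odd y1_y0 y0_mod4 hv h4 hx hA nd1.
by rewrite V hE; apply: i_exp_sign; exact: j_sq p_ce.
Qed.

End EvenX.

End Conclusion.

Unset Implicit Arguments.
Set Strict Implicit.

(* Congruences modulo p between p-integral rationals are equalities in 'F_p.
   The sign s encodes the paired signs: +- is s and -+ is - s, with s = 1 for
   the upper and s = -1 for the lower signs. The integer division %/ by a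
   positive integer is the floor of the quotient, and it is exact in y / 8,
   (x ^ 2 - 1) / 8 and (p - 5) / 8. *)
Theorem theorem3p5 (p : nat) (c d x y d0 y0 : int) (r t : nat)
  (p_prime : prime p) (p_mod4 : (p = 1 %[mod 4])%N)
  (p_leg : legendre (-11) p = 1)
  (p_cd : p%:Z = c ^+ 2 + d ^+ 2)
  (p_xy : 4 * p%:Z = x ^+ 2 + 11 * y ^+ 2)
  (c_mod4 : (c = 1 %[mod 4])%Z)
  (d_d0 : d = 2 ^+ r * d0) (d0_odd : ~~ (2 %| d0)%Z)
  (y_y0 : y = 2 ^+ t * y0) (y0_mod4 : (y0 = 1 %[mod 4])%Z)
  (cop : gcdz c (x + 2 * d) = 1 \/ gcdz d0 (x + 2 * c) = 1) :
  ((p = 1 %[mod 8])%N ->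
    forall s : int, s = 1 \/ s = -1 ->
    [/\ ~~ (2 %| x)%Z -> mod11_cond s x c ->
          (-11 : 'F_p) ^+ (p %/ 8)%N = s%:~R * (-1) ^ (x %/ 4)%Z,
        ~~ (2 %| x)%Z -> mod11_cond s x d ->
          (-11 : 'F_p) ^+ (p %/ 8)%N
            = s%:~R * (-1) ^ (x %/ 4)%Z * (d%:~R / c%:~R),
        (2 %| x)%Z -> mod11_cond s x c ->
          (-11 : 'F_p) ^+ (p %/ 8)%N
            = - s%:~R * (-1) ^ ((x %/ 8)%Z + (y %/ 8)%Z)
      & (2 %| x)%Z -> mod11_cond s x d ->
          (-11 : 'F_p) ^+ (p %/ 8)%N
            = - s%:~R * (-1) ^ ((x %/ 8)%Z + (y %/ 8)%Z) * (d%:~R / c%:~R)])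
  /\
  ((p = 5 %[mod 8])%N ->
    forall s : int, s = 1 \/ s = -1 ->
    [/\ ~~ (2 %| x)%Z -> mod11_cond s x c ->
          (-11 : 'F_p) ^+ (p %/ 8)%N
            = - s%:~R * (-1) ^ ((x ^+ 2 - 1) %/ 8)%Z * (y%:~R / x%:~R),
        ~~ (2 %| x)%Z -> mod11_cond s x d ->
          (-11 : 'F_p) ^+ (p %/ 8)%N
            = - s%:~R * (-1) ^ ((x ^+ 2 - 1) %/ 8)%Z
              * ((d * y)%:~R / (c * x)%:~R),
        (2 %| x)%Z -> mod11_cond s x c ->
          (-11 : 'F_p) ^+ (p %/ 8)%N
            = - s%:~R * (-1) ^ ((p%:Z - 5) %/ 8)%Z * (y%:~R / x%:~R)
      & (2 %| x)%Z -> mod11_cond s x d ->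
          (-11 : 'F_p) ^+ (p %/ 8)%N
            = - s%:~R * (-1) ^ ((p%:Z - 5) %/ 8)%Z
              * ((d * y)%:~R / (c * x)%:~R)]).
Proof.
have p1 : (p %% 4 = 1)%N := p_mod4.
have sgn (n : int) : (-1) ^ (1 + n) = - (-1) ^ n :> 'F_p.
  by rewrite expfzDr ?oppr_eq0 ?oner_neq0 // expr1z mulN1r.
have dycx (a : 'F_p) : a * ((d * y)%:~R / (c * x)%:~R) =
    a * (d%:~R / c%:~R) * (y%:~R / x%:~R).
  by rewrite !intrM invfM; ring.
have key := @power_of_qsym11 p c d x y p_prime p1 p_cd p_xy ((x%:~R / y%:~R) ^+ (p %/ 4)).
split=> p8 s hs.
- rewrite (pow_neg11_1mod8 p_prime p1 p_cd p_xy p8); have [x2|x2] := boolP (2 %| x)%Z.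
    have [x1 [y1 [T [hx hy x1_odd hy1]]]] := even_x_shape p1 p_xy x2 y_y0 y0_mod4.
    have p_x1 := p_x1y1 p_xy hx hy.
    have [] := key (1 + ((x %/ 8)%Z + (y %/ 8)%Z)) s hs.
      move=> e he; apply: (power_even_sign p_prime p1 p_cd p_xy c_mod4 hx hy x1_odd hy1 y0_mod4 he).
      move=> e' pe ee; have y1_even : (2 %| y1)%Z by rewrite hy1 exprS -mulrA dvdz_mulr.
      have [v [sx [sA [hv h4 hst hE]]]] :=
        even_exponent_1 pe p_x1 c_mod4 ee x1_odd p8 y1_even.
      by exists v, sx, sA; split; rewrite // hE -hx -hy.
    rewrite sgn mulrN -mulNr => K1 K2.
    by split.
  have [x_odd y_mod4] := odd_x_shape p_xy x2 y_y0 y0_mod4.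
  have [] := key (x %/ 4)%Z s hs.
    move=> e he; apply: (power_odd_sign p_prime p1 p_cd p_xy c_mod4 x_odd y_mod4 he).
    by move=> e' pe ee; apply: odd_exponent_1 pe p_xy c_mod4 y_mod4 ee x_odd p8.
  by move=> K1 K2; split.
- rewrite (pow_neg11_5mod8 p_prime p1 p_cd p_xy p8); have [x2|x2] := boolP (2 %| x)%Z.
    have [x1 [y1 [T [hx hy x1_odd hy1]]]] := even_x_shape p1 p_xy x2 y_y0 y0_mod4.
    have p_x1 := p_x1y1 p_xy hx hy.
    have T0 : T = 0%N.
      case: T hy1 => [//|T] hy1; exfalso; move: p_x1.
      have -> : y1 = 4 * (2 ^+ T * y0) by rewrite hy1 !exprS; ring.
      have [k ->] := odd_sq x1_odd.
      have -> : 11 * (4 * (2 ^+ T * y0)) ^+ 2 = 8 * (22 * (2 ^+ T * y0) ^+ 2) by ring.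
      by move: p8; move: (22 * (2 ^+ T * y0) ^+ 2); clear; lia.
    rewrite T0 in hy1.
    have [] := key (1 + ((p%:Z - 5) %/ 8)%Z) s hs.
      move=> e he; apply: (power_even_sign p_prime p1 p_cd p_xy c_mod4 hx hy x1_odd hy1 y0_mod4 he).
      move=> e' pe ee.
      have [v [sx [sA [hv h4 hst hE]]]] :=
        even_exponent_5 pe p_x1 c_mod4 ee x1_odd p8 hy1 y0_mod4.
      by exists v, sx, sA.
    rewrite sgn mulrN -mulNr => K1 K2.
    split=> // _ hc; first by rewrite (K1 hc).
    by rewrite dycx (K2 hc).
  have [x_odd y_mod4] := odd_x_shape p_xy x2 y_y0 y0_mod4.
  have [] := key (1 + ((x ^+ 2 - 1) %/ 8)%Z) s hs.
    move=> e he; apply: (power_odd_sign p_prime p1 p_cd p_xy c_mod4 x_odd y_mod4 he).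
    by move=> e' pe ee; apply: odd_exponent_5 pe p_xy c_mod4 y_mod4 ee x_odd p8.
  rewrite sgn mulrN -mulNr => K1 K2.
  split=> // _ hc; first by rewrite (K1 hc).
  by rewrite dycx (K2 hc).
Qed.
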